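(* Let $f\in L^2([0,1))$, let $Y^n=(Y_1^n,\dots,Y_n^n)$, $n\in\mathbb{N}$, be observations from the regression model described in the context (with noise satisfying Condition (A)), let $(\gamma_n)_{n\in\mathbb{N}}$ be a (possibly random) sequence of smoothing parameters, and let $\hat f_n\in\iota^n(\arg\min H_{\gamma_n}(\cdot,Y^n))$. (i) Assume that $f\in L^2([0,1))$ and $\gamma>0$ are such that $f_\gamma$ is a unique minimizer of $H^\infty_\gamma(\cdot,f)$. Moreover, suppose $\gamma_n\to\gamma$ $\mathbb{P}$-almost surely. Then $\hat f_n\to f_\gamma$ in $L^2([0,1))$ as $n\to\infty$, $\mathbb{P}$-almost surely. (ii) Let $f\in L^2([0,1))$ and suppose that $\gamma_n\to0$ and $\gamma_n n/\log n\to\infty$ $\mathbb{P}$-almost surely. Then $\hat f_n\to f$ in $L^2([0,1))$ as $n\to\infty$, $\mathbb{P}$-almost surely. (iii) Let $f\in S([0,1))$ and suppose that $\gamma_n\to0$ and $\gamma_n n/\log n\to\infty$ $\mathbb{P}$-almost surely. Then $$\|\hat f_n-f\|=O\left(\sqrt{\frac{\log n}{n}}\right)\quad\mathbb{P}\text{-almost surely}.$$ Moreover, $$\|\hat f_n-f\|=O_{\mathbb{P}}\left(\sqrt{\frac1n}\right).$$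
   Context: $\|\cdot\|$ is the norm of $L^2([0,1))$. Regression model: for each $n$, with $x_i^n=i/n$ ($0\le i\le n$), one observes $Y_i^n=\overline f_i^n+\xi_i^n$, $i=1,\dots,n$, where $\overline f_i^n=(x_i^n-x_{i-1}^n)^{-1}\int_{x_{i-1}^n}^{x_i^n}f(u)\,du$. Condition (A) on the triangular array of noise variables $(\xi_i^n)_{n\in\mathbb{N},1\le i\le n}$ (zero-mean, defined on a common probability space with measure $\mathbb{P}$): (i) for every $n$ the random variables $(\xi_i^n)_{1\le i\le n}$ are independent; (ii) there is a universal constant $\beta\in\mathbb{R}$ such that $\mathbb{E}e^{\nu\xi_i^n}\le e^{\beta\nu^2}$ for all $\nu\in\mathbb{R}$, $1\le i\le n$, $n\in\mathbb{N}$. Potts functional: for $u,Y\in\mathbb{R}^n$, $H_\gamma(u,Y)=\frac1n\sum_{i=1}^n(u_i-Y_i)^2+\gamma\cdot\#\{i:1\le i\le n-1,\ u_i\ne u_{i+1}\}$. The set of minimizers over $u\in\mathbb{R}^n$ is denoted $\arg\min H_\gamma(\cdot,Y)$; it need not be a singleton, and $\hat f_n$ comes from any choice of minimizer. Embedding: $\iota^n:\mathbb{R}^n\to L^2([0,1))$, $\iota^n((u_1,\dots,u_n))=\sum_{i=1}^nu_i\mathbf{1}_{[(i-1)/n,i/n)}$. $S([0,1))$ is the space of right-continuous step functions $\sum_{i=1}^m\alpha_i\mathbf{1}_{[t_i,t_{i+1})}$, $\alpha_i\in\mathbb{R}$, $0=t_1<\dots<t_{m+1}=1$, $m\in\mathbb{N}$,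 regarded as a subspace of $L^2([0,1))$. For $g\in S([0,1))$, $J(g)=\{t\in(0,1):g(t-)\ne g(t+)\}$. Continuous Potts functional, for $\gamma>0$ and $f,g\in L^2([0,1))$: $H_\gamma^\infty(g,f)=\gamma\cdot\#J(g)+\|f-g\|^2$ if $g\in S([0,1))$, and $H^\infty_\gamma(g,f)=\infty$ otherwise. ''$O(\cdot)$ $\mathbb{P}$-almost surely'' means that almost surely the ratio is bounded in $n$ (with a possibly random bound); $O_{\mathbb{P}}$ denotes boundedness in probability. *)

(* Defs.v *)
From HB Require Import structures.
From mathcomp Require Import all_boot all_order all_algebra.
From mathcomp Require Import all_classical all_reals all_analysis.

Set Implicit Arguments.
Unset Strict Implicit.
Unset Printing Implicit Defensive.

Import Order.TTheory GRing.Theory Num.Theory.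
Import numFieldNormedType.Exports.

Local Open Scope classical_set_scope.
Local Open Scope ring_scope.

(* Elements of L^2([0,1)) are represented by functions R -> R of which only
   the restriction to [0,1) matters; equality in L^2([0,1)) is equality almost
   everywhere on [0,1).  The 1-based index i of the array, 1 <= i <= n, is the
   0-based [i : 'I_n], so that the i-th cell is [x_i, x_(i+1)). *)

Section L2.
Context {R : realType}.
Implicit Types f g s : R -> R.

Definition unitI : set R := `[0, 1[%classic.

Definition in_L2 f : Prop := (f \_ unitI) \in Lfun (@lebesgue_measure R) 2%:E.

Definition L2norm f : R :=
  fine ('N[@lebesgue_measure R]_2%:E[EFin \o (f \_ unitI)])%E.

Definition L2eq f g : Prop := f = g %[ae (@lebesgue_measure R) in unitI].

Definition step_function s : Prop :=
  exists (m : nat) (t alpha : nat -> R),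
    [/\ t 0%N = 0, t m = 1, (forall i, (i < m)%N -> t i < t i.+1) &
        s = fun x => \sum_(i < m) alpha i * \1_(`[t i, t i.+1[) x].

Definition in_step_space g : Prop := exists2 s, step_function s & L2eq s g.

(* The right-continuous step representative of a class in the step space,
   which is unique on [0,1). *)
Definition step_repr g : R -> R :=
  get [set s | step_function s /\ L2eq s g].

(* One-sided limits are only meaningful for the step representative. *)
Definition jump_set g : set R :=
  let s := step_repr g in
  [set t | 0 < t < 1 /\ lim (s x @[x --> t^'-]) != lim (s x @[x --> t^'+])].

Definition potts_cont (gamma : R) g f : \bar R :=
  if `[< in_step_space g >]
  then (gamma%:E * counting (jump_set g) + (L2norm (f \- g) ^+ 2)%:E)%E
  else +oo%E.

Definition unique_minimizer_cont (gamma : R) f g : Prop :=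
  [/\ in_L2 g,
      forall h, in_L2 h -> (potts_cont gamma g f <= potts_cont gamma h f)%E &
      forall g', in_L2 g' ->
        (forall h, in_L2 h -> (potts_cont gamma g' f <= potts_cont gamma h f)%E) ->
        L2eq g' g].

End L2.

Section Discrete.
Context {R : realType}.

Definition design (n i : nat) : R := i%:R / n%:R.

Definition cell (n i : nat) : set R := `[design n i, design n i.+1[%classic.

Definition cell_mean (f : R -> R) (n i : nat) : R :=
  (design n i.+1 - design n i)^-1 *
  \int[@lebesgue_measure R]_(u in cell n i) f u.

Definition num_jumps (n : nat) (u : 'rV[R]_n) : nat :=
  #|[set i : 'I_n | [exists j : 'I_n,
      (j == i.+1 :> nat) && (u ord0 i != u ord0 j)]]|.

Definition potts (n : nat) (gamma : R) (u y : 'rV[R]_n) : R :=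
  n%:R^-1 * \sum_(i < n) (u ord0 i - y ord0 i) ^+ 2 + gamma * (num_jumps u)%:R.

Definition potts_argmin (n : nat) (gamma : R) (y : 'rV[R]_n) : set 'rV[R]_n :=
  [set u | forall v, potts gamma u y <= potts gamma v y].

Definition embed (n : nat) (u : 'rV[R]_n) : R -> R :=
  fun x => \sum_(i < n) u ord0 i * \1_(cell n i) x.

End Discrete.

Section Noise.
Context {d : measure_display} {T : measurableType d} {R : realType}.
Variable P : probability T R.

Definition independent_family (I : finType) (X : I -> {RV P >-> R}) : Prop :=
  forall (J : {set I}) (B : I -> set R),
    (forall i, i \in J -> measurable (B i)) ->
    (P (\bigcap_(i in [set` J]) (X i @^-1` B i)) =
     \prod_(i in J) P (X i @^-1` B i))%E.

Record condition_A (xi : forall n : nat, 'I_n -> {RV P >-> R}) : Prop := {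
  noise_centered : forall n (i : 'I_n), ('E_P[xi n i] = 0)%E ;
  noise_independent : forall n, independent_family (xi n) ;
  noise_subgaussian : exists beta : R, forall n (i : 'I_n) (nu : R),
    ('M_P (xi n i) nu <= (expR (beta * nu ^+ 2))%:E)%E
}.

Definition observation (f : R -> R) (xi : forall n : nat, 'I_n -> {RV P >-> R})
    (n : nat) (w : T) : 'rV[R]_n :=
  \row_(i < n) (cell_mean f n i + xi n i w).

(* [P^*] is the outer measure of P, which agrees with P on measurable events:
   the minimizers may be selected in a non-measurable way. *)
Definition bounded_in_probability (X : nat -> T -> R) (r : nat -> R) : Prop :=
  forall eps : R, 0 < eps -> exists C : R, forall n, (0 < n)%N ->
    (mu_ext P [set w | (C * r n < `|X n w|)%R] <= eps%:E)%E.

End Noise.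

(* Main.v *)
Require Import Defs.
From HB Require Import structures.
From mathcomp Require Import all_boot all_order all_algebra.
From mathcomp Require Import all_classical all_reals all_analysis.
From mathcomp Require Import measurable_realfun.
From mathcomp Require Import ring lra zify.

Set Implicit Arguments.
Unset Strict Implicit.
Unset Printing Implicit Defensive.

Import Order.TTheory GRing.Theory Num.Theory.
Import numFieldNormedType.Exports.

Local Open Scope classical_set_scope.
Local Open Scope ring_scope.

(* Let M be such that S_I^2 <= |I| M for the noise sums S_I over all index
   intervals I. Decomposing w into its J(w)+1 constant runs gives
   2<w,xi> <= l |w|^2 + (J(w)+1) M/l for every l > 0; comparing the minimizer u
   with an arbitrary vector v and writing fbar for the vector of cell means,
     |u-fbar|^2/2 + n gamma J(u)
       <= (3/2) |v-fbar|^2 + n gamma J(v) + 4 (J(u)+J(v)+1) M.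
   Chernoff bounds and Borel-Cantelli allow M to be a multiple of log n almost
   surely. Taking for v a sampled step function close to f proves (ii).
   For (iii), u is close to f, hence jumps near every jump of f; each further
   jump costs n gamma, more than the 4M it can gain, which gives the almost
   sure rate. The same inequality excludes further jumps, and then only the
   noise sums over the constancy intervals of f and over the intervals with an
   end point at a jump of f matter. These are O(sqrt|I|) and at most
   eta |I| + O(1) in probability, without any logarithm.
   For (i), the jump positions and values of u converge along an ultrafilter
   (a run that shrinks to a point loses its mass, since setting it to zero
   creates no jump), and by the energy inequality with l -> 0 the limit
   minimizes the continuous functional. *)

(** * Jumps and the energy inequality *)

Section Jumps.
Context {R : realType}.
Implicit Types u v w x : nat -> R.

(** The analysis of the minimizer is pathwise: the asymptotic bounds use the noise only through
    [noise_le] and [controlled], so measurable events are formed from the data and [gamma], never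
    from the selected minimizer. The obstacle is that the runs of the minimizer depend on the noise,
    and a union bound over all intervals costs the factor log n. For the rate in probability, noise
    over a run is rewritten as noise over the fixed constancy interval of f plus noise over
    intervals attached to its end points. These have one free end, and the allowance eta |I| + A
    turns the union over that end into a geometric series. The allowance is affordable because there
    the minimizer carries the value from the wrong side of a jump of f and pays a fixed squared
    error per index. The rates must not contain gamma, although gamma n is much larger than log n:
    the penalties cancel because the minimizer has at least as many jumps as the sampled f. An
    ultrafilter makes the finitely many jump positions and values converge at once, also when jumps
    merge. *)

Definition njump u (n : nat) : nat := \sum_(0 <= i < n.-1) (u i != u i.+1).

Lemma njumpS u n : (0 < n)%N -> njump u n.+1 = (njump u n + (u n.-1 != u n))%N.
Proof.
by case: n => // n _; rewrite /njump /= big_nat_recr.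
Qed.

Lemma njumpB u v n : (njump (fun i => u i - v i)%R n <= njump u n + njump v n)%N.
Proof.
rewrite /njump -big_split /=; apply: leq_sum => i _.
have [->|_] := eqVneq (u i) (u i.+1); have [->|_] := eqVneq (v i) (v i.+1);
  by rewrite ?eqxx //=; case: eqP.
Qed.

Definition isum x (a b : nat) : R := \sum_(a <= i < b) x i.

Definition noise_le x n (M : R) := forall a b, (a < b <= n)%N ->
  isum x a b ^+ 2 <= (b - a)%:R * M.

(* The last constant run of [w] starts at [c]. *)
Lemma energy_aux x n (M l : R) w : (0 < n)%N -> 0 < l -> noise_le x n M ->
  forall b, (0 < b <= n)%N -> exists c, [/\ (c < b)%N,
    (forall i, (c <= i < b)%N -> w i = w b.-1) &
    2 * \sum_(0 <= i < c) w i * x i <=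
      l * \sum_(0 <= i < c) w i ^+ 2 + (njump w b)%:R * (M / l)].
Proof.
move=> n0 l0 nx; elim=> // b IH bn.
case: b IH bn => [_ bn|b IH bn].
  exists 0%N; split => //; first by move=> i; rewrite ltnS leqn0 => /eqP->.
  by rewrite !big_geq// /njump big_geq// !mulr0 mul0r addr0.
have [|c [cb cw IHc]] := IH; first lia.
have [wE|wN] := eqVneq (w b) (w b.+1).
  exists c; split; first lia.
    by move=> i ib; rewrite /= -wE; have [->|ib'] := eqVneq i b.+1; [by rewrite wE| rewrite cw//; lia].
  by rewrite njumpS //= wE eqxx addn0.
exists b.+1; split; first lia.
  by move=> i ib; congr w; lia.
have cb' : (c <= b.+1)%N by lia.
rewrite !(big_cat_nat (leq0n c) cb') /=.
have s1 : \sum_(c <= i < b.+1) w i * x i = w b * isum x c b.+1.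
  rewrite /isum mulr_sumr big_nat_cond [RHS]big_nat_cond.
  by apply: eq_bigr => i /andP[ib _]; rewrite cw.
have s2 : \sum_(c <= i < b.+1) w i ^+ 2 = (b.+1 - c)%:R * w b ^+ 2.
  rewrite mulr_natl -sumr_const_nat big_nat_cond [RHS]big_nat_cond.
  by apply: eq_bigr => i /andP[ib _]; rewrite cw.
rewrite s1 s2 njumpS//= wN natrD.
have h := nx c b.+1 ltac:(lia).
move: h IHc; set S := isum _ _ _; set L : R := (b.+1 - c)%:R.
have L0 : 0 < L by rewrite ltr0n; lia.
move=> h IHc.
(* A run of length [L], value [v] and noise sum [S] contributes 2 v S <= l L v^2 + S^2 / (l L), by
   completing the square, and S^2 <= L M turns the last term into M / l. *)
have : 2 * (w b * S) <= l * (L * w b ^+ 2) + M / l.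
  have : S ^+ 2 / (L * l) <= M / l.
    by rewrite invfM mulrA ler_pM2r ?invr_gt0// ler_pdivrMr// mulrC.
  move=> h1.
  have e : l * (L * w b ^+ 2) + S ^+ 2 / (L * l) - 2 * (w b * S)
     = (l * L * w b - S) ^+ 2 / (L * l) by field; rewrite !gt_eqF.
  have g : 0 <= (l * L * w b - S) ^+ 2 / (L * l) by rewrite divr_ge0 ?sqr_ge0// mulr_ge0// ltW.
  lra.
by rewrite /= !(mulrDr 2) mulrDr mulrDl mul1r; lra.
Qed.

Lemma energy x n (M l : R) w : (0 < n)%N -> 0 < l -> noise_le x n M ->
  2 * \sum_(0 <= i < n) w i * x i <=
  l * \sum_(0 <= i < n) w i ^+ 2 + ((njump w n).+1)%:R * (M / l).
Proof.
move=> n0 l0 nx.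
(* Appending a fresh value at [n] closes the last run. *)
pose w' i := if (i < n)%N then w i else w n.-1 + 1.
pose x' i := if (i < n)%N then x i else 0.
have M0 : 0 <= M.
  have := nx 0%N 1%N ltac:(lia); rewrite subn0 mul1r; apply: le_trans; exact: sqr_ge0.
(* The appended noise entry is 0, so an interval reaching past [n] keeps its sum while its length,
   and with it the bound, grows. *)
have nx' : noise_le x' n.+1 M.
  move=> a b ab; have [bn|bn] := leqP b n.
    have -> : isum x' a b = isum x a b.
      rewrite /isum big_nat_cond [RHS]big_nat_cond.
      by apply: eq_bigr => i /andP[ib _]; rewrite /x' ifT//; lia.
    by apply: nx; lia.
  have -> : b = n.+1 by lia.
  rewrite /isum big_nat_recr/=; last lia.
  rewrite {2}/x' ltnn addr0.
  have -> : \sum_(a <= i < n) x' i = isum x a n.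
    rewrite /isum big_nat_cond [RHS]big_nat_cond.
    by apply: eq_bigr => i /andP[ib _]; rewrite /x' ifT//; lia.
  have [an|an] := ltnP a n.
    apply: (le_trans (nx a n ltac:(lia))); rewrite ler_wpM2r// ler_nat; lia.
  by rewrite /isum big_geq// expr0n mulr_ge0.
have [c [cb cw]] := @energy_aux x' n.+1 M l w' ltac:(lia) l0 nx' n.+1 ltac:(lia).
have cn : c = n.
  apply/eqP; rewrite eqn_leq; apply/andP; split; first lia.
  rewrite leqNgt; apply/negP => cn.
  have := cw n.-1 ltac:(lia); rewrite /= /w' ltnn ifT; last lia.
  lra.
rewrite {}cn njumpS//.
have -> : njump w' n = njump w n.
  rewrite /njump big_nat_cond [RHS]big_nat_cond.
  by apply: eq_bigr => i /andP[ib _]; rewrite /w' !ifT//; lia.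
have -> : (w' n.-1 != w' n) = true.
  rewrite /w' ltnn ifT; last lia.
  by apply/eqP; lra.
rewrite addn1.
have -> : \sum_(0 <= i < n) w' i * x' i = \sum_(0 <= i < n) w i * x i.
  rewrite big_nat_cond [RHS]big_nat_cond.
  by apply: eq_bigr => i /andP[ib _]; rewrite /w' /x' !ifT//; lia.
have -> // : \sum_(0 <= i < n) w' i ^+ 2 = \sum_(0 <= i < n) w i ^+ 2.
rewrite big_nat_cond [RHS]big_nat_cond.
by apply: eq_bigr => i /andP[ib _]; rewrite /w' !ifT//; lia.
Qed.

(* [p 0 = 0 < p 1 < ... < p k.+1 = n] delimits the [k.+1] maximal constant runs of [u]. *)
Record pieces u n k (p : nat -> nat) : Prop := Pieces {
  pieces0 : p 0%N = 0%N;
  piecesn : p k.+1 = n;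
  pieces_lt : forall j, (j <= k)%N -> (p j < p j.+1)%N;
  pieces_cst : forall j i, (j <= k)%N -> (p j <= i < p j.+1)%N -> u i = u (p j);
  pieces_jump : forall j, (0 < j <= k)%N -> u (p j).-1 != u (p j) }.

Lemma pieces_exist u n : (0 < n)%N -> exists p, pieces u n (njump u n) p.
Proof.
elim: n => // -[_ _|n IH _].
  exists id; rewrite /njump big_geq//; split => //; last lia.
  by move=> [|//] i _; rewrite ltnS leqn0 => /eqP->.
have {IH}[//|p [p0 pn pl pc pj]] := IH.
rewrite njumpS//=.
set k := njump u n.+1 in pn pl pc pj *.
have pkn : (p k <= n)%N by have := pl k (leqnn k); lia.
have uk : u n = u (p k) by apply: pc => //; lia.
have [uE|uN] := eqVneq (u n) (u n.+1).
  rewrite addn0; exists (fun j => if (j <= k)%N then p j else n.+2); split => //.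
  - by rewrite ltnn.
  - move=> j jk; rewrite jk; case: ifP => jk'; first exact: pl.
    (have -> : j = k by lia); lia.
  - move=> j i jk; rewrite jk; case: ifP => jk' ij; first exact: pc.
    have ejk : j = k by lia.
    rewrite ejk in ij *; have [->|ni] := eqVneq i n.+1; first by rewrite -uE.
    by apply: pc => //; lia.
  - by move=> j jk; rewrite ifT; [apply: pj|lia].
rewrite addn1; exists (fun j => if (j <= k)%N then p j else if j == k.+1 then n.+1 else n.+2); split => //.
- by rewrite ifF ?ifF//; lia.
- move=> j jk; have [jk1|jk1|->] := ltngtP j k.
  + by apply: pl; lia.
  + by rewrite ifT ?ifF; lia.
  + by rewrite eqxx; lia.
- move=> j i jk; have [jk1|jk1|->] := ltngtP j k.
  + by move=> ij; apply: pc; lia.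
  + by rewrite ifT ?ifF => [ij||]; [congr u| |]; lia.
  + by rewrite eqxx => ij; apply: pc => //; rewrite pn.
- move=> j jk; case: ifP => jk1; first by apply: pj; lia.
  by rewrite ifT//; lia.
Qed.

Lemma pieces_mono u n k p : pieces u n k p ->
  forall i j, (i <= j <= k.+1)%N -> (p i <= p j)%N.
Proof.
move=> H i; elim=> [|j IH] ij; first by have -> : i = 0%N by lia.
have [->//|nij] := eqVneq i j.+1.
have := pieces_lt H (j := j) ltac:(lia); have := IH ltac:(lia); lia.
Qed.

Lemma pieces_locate u n k p : pieces u n k p -> forall i, (i < n)%N ->
  exists2 j, (j <= k)%N & (p j <= i < p j.+1)%N.
Proof.
move=> H i.
have key : forall m, (m <= k.+1)%N -> (i < p m)%N -> exists2 j, (j < m)%N & (p j <= i < p j.+1)%N.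
  elim=> [|m IH] mk; first by rewrite (pieces0 H).
  move=> im; have [im'|im'] := ltnP i (p m).
    by have [j jm ij] := IH ltac:(lia) im'; exists j => //; lia.
  by exists m => //; rewrite im'.
by rewrite -{1}(piecesn H) => /(key _ (leqnn _)) [j jk ij]; exists j.
Qed.

Lemma pieces_jumpP u n k p i : pieces u n k p -> (i.+1 < n)%N -> u i != u i.+1 ->
  exists2 j, (0 < j <= k)%N & p j = i.+1.
Proof.
move=> H ni ui.
have [j jk ij] := pieces_locate H ni.
have [E|E] := eqVneq (p j) i.+1.
  exists j => //; case: j jk ij E => //; rewrite (pieces0 H) //.
exfalso; move/eqP: ui; apply.
by rewrite (pieces_cst H (j := j) (i := i)) ?(pieces_cst H (j := j) (i := i.+1))//; lia.
Qed.

Definition zeroed u (a b : nat) : nat -> R := fun i => if (a <= i < b)%N then 0 else u i.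

(** At an interior end of a maximal run [u] already jumps, so whatever jump the zeroed vector has
    there is charged to a jump of [u]; inside the run there is none. *)
Lemma njump_zeroed u n k p j : (0 < n)%N -> pieces u n k p -> (j <= k)%N ->
  (njump (zeroed u (p j) (p j.+1)) n <= njump u n)%N.
Proof.
move=> n0 H jk; rewrite /njump big_nat_cond [leqRHS]big_nat_cond.
apply: leq_sum => i /andP[ib _].
rewrite /zeroed; have plt := pieces_lt H jk.
case: ifP => h1; case: ifP => h2; rewrite ?eqxx//.
- have e : i.+1 = p j.+1 by lia.
  have jk' : (j < k)%N.
    rewrite ltn_neqAle jk andbT; apply/eqP => E; move: e; rewrite E (piecesn H); lia.
  by have := pieces_jump H (j := j.+1) ltac:(lia); rewrite -e /= => ->; case: eqP.
- have e : i.+1 = p j by lia.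
  have j0 : (0 < j)%N.
    by rewrite lt0n; apply/eqP => E; move: e; rewrite E (pieces0 H).
  by have := pieces_jump H (j := j) ltac:(lia); rewrite -e /= => ->; case: eqP.
Qed.

End Jumps.

(** * Sums of independent subgaussian variables *)

Section Independence.
Context {d : measure_display} {T : measurableType d} {R : realType}.
Variable P : probability T R.
Local Open Scope ereal_scope.
Import HBNNSimple.

(** The usual passage from indicators to nonnegative functions: linearity gives the factorization
    for simple functions of [X], monotone convergence for [phi]. The weight [A] enters only through
    the factorization on preimages, so it can be any partial product built from the other
    variables. *)
Lemma ge0_integral_mul_comp (A : T -> R) (X : {mfun T >-> R}) (c : \bar R) (phi : R -> R) :
  measurable_fun setT A -> (forall w, 0 <= A w)%R -> 0 <= c -> c \is a fin_num ->
  (forall C, measurable C ->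
    \int[P]_w (A w * \1_(X @^-1` C) w)%:E = c * P (X @^-1` C)) ->
  measurable_fun setT phi -> (forall x, 0 <= phi x)%R ->
  \int[P]_w (A w * phi (X w))%:E = c * \int[P]_w (phi (X w))%:E.
Proof.
move=> mA A0 c0 cfin H mphi phi0.
have mXC C : measurable C -> measurable (X @^-1` C).
  by move=> mC; rewrite -(setTI (_ @^-1` _)); exact: measurable_funP.
have mf : measurable_fun setT (fun x : measurableTypeR R => (phi x)%:E) by exact/measurable_EFinP.
pose g := nnsfun_approx measurableT mf.
have gcvg x : (g n x)%:E @[n --> \oo] --> (phi x)%:E.
  by apply: (@cvg_nnsfun_approx _ _ _ setT measurableT _ mf) => // t _; rewrite lee_fin.
have gnd m n x : (m <= n)%N -> (g m x <= g n x)%R.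
  by move=> mn; exact/lefP/nd_nnsfun_approx.
have gs n : \int[P]_w (A w * g n (X w))%:E = c * \int[P]_w (g n (X w))%:E.
  pose s := finmap.enum_fset (fset_set (range (g n))).
  have gE x : (g n x = \sum_(r <- s) r * \1_(g n @^-1` [set r]) x)%R.
    by rewrite {1}fimfunE fsbig_finite.
  have mgr (r : R) : measurable (X @^-1` (g n @^-1` [set r])).
    by apply: mXC; apply: (measurable_funPTI (g n)); exact: measurable_set1.
  have r0 r : r \in s -> (0 <= r)%R.
    rewrite /s; by rewrite in_fset_set// inE => -[x _ <-].
  have -> : \int[P]_w (A w * g n (X w))%:E =
     \sum_(r <- s) r%:E * (c * P (X @^-1` (g n @^-1` [set r]))).
    (* [Num.max r 0] equals [r] on the range of [g n] and makes every summand nonnegative without a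
       side condition on [r], as exchanging sum and integral demands. *)
    transitivity (\int[P]_w \sum_(r <- s)
        (Num.max r 0 * (A w * \1_(X @^-1` (g n @^-1` [set r])) w))%:E).
      apply: eq_integral => w _; rewrite gE mulr_sumr -sumEFin.
      rewrite big_seq [RHS]big_seq; apply: eq_bigr => r rg; congr EFin.
      by rewrite (max_idPl (r0 _ rg)) mulrCA.
    rewrite ge0_integral_sum//=; last 2 first.
    - move=> r; apply/measurable_EFinP; apply: measurable_funM => //.
      by apply: measurable_funM => //; exact: measurable_indic.
    - by move=> r w _; rewrite lee_fin mulr_ge0// ?le_max ?lexx ?orbT// mulr_ge0.
    rewrite big_seq [RHS]big_seq; apply: eq_bigr => r rg.
    under eq_integral do rewrite (max_idPl (r0 _ rg)) EFinM.
    rewrite ge0_integralZl_EFin ?H ?r0//.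
    - by apply: (measurable_funPTI (g n)); exact: measurable_set1.
    - by move=> w _; rewrite lee_fin mulr_ge0.
    - by apply/measurable_EFinP; apply: measurable_funM => //; exact: measurable_indic.
  have -> : \int[P]_w (g n (X w))%:E =
     \sum_(r <- s) r%:E * P (X @^-1` (g n @^-1` [set r])).
    transitivity (\int[P]_w \sum_(r <- s)
        (Num.max r 0 * \1_(X @^-1` (g n @^-1` [set r])) w)%:E).
      apply: eq_integral => w _; rewrite gE -sumEFin.
      rewrite big_seq [RHS]big_seq; apply: eq_bigr => r rg; congr EFin.
      by rewrite (max_idPl (r0 _ rg)).
    rewrite ge0_integral_sum//=; last 2 first.
    - move=> r; apply/measurable_EFinP; apply: measurable_funM => //.
    - by move=> r w _; rewrite lee_fin mulr_ge0// ?le_max ?lexx ?orbT.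
    rewrite big_seq [RHS]big_seq; apply: eq_bigr => r rg.
    under eq_integral do rewrite (max_idPl (r0 _ rg)) EFinM.
    rewrite ge0_integralZl_EFin ?r0//.
    - by rewrite integral_indic// setIT.
    - exact/measurable_EFinP.
  rewrite [in RHS]big_seq ge0_sume_distrr; last first.
    by move=> r rs; rewrite mule_ge0// lee_fin r0.
  by rewrite big_seq; apply: eq_bigr => r _; rewrite muleCA.
have mgX n : measurable_fun setT (fun w => (g n (X w))).
  exact: (measurableT_comp (measurable_funPT (g n)) (measurable_funPT X)).
have L1 : \int[P]_w (A w * g n (X w))%:E @[n --> \oo] --> \int[P]_w (A w * phi (X w))%:E.
  have -> : \int[P]_w (A w * phi (X w))%:E = \int[P]_w (limn (fun n => (A w * g n (X w))%:E)).
    apply: eq_integral => w _; apply/esym/cvg_lim => //.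
    under eq_fun do rewrite EFinM; rewrite EFinM.
    by apply: cvgeZl.
  apply: cvg_monotone_convergence => //.
  - by move=> n; apply/measurable_EFinP; apply: measurable_funM.
  - by move=> n w _; rewrite lee_fin mulr_ge0.
  - by move=> w _ m n mn; rewrite lee_fin ler_wpM2l// gnd.
have L2 : \int[P]_w (g n (X w))%:E @[n --> \oo] --> \int[P]_w (phi (X w))%:E.
  have -> : \int[P]_w (phi (X w))%:E = \int[P]_w (limn (fun n => (g n (X w))%:E)).
    by apply: eq_integral => w _; apply/esym/cvg_lim.
  apply: cvg_monotone_convergence => //.
  - by move=> n; apply/measurable_EFinP.
  - by move=> n w _; rewrite lee_fin.
  - by move=> w _ m n mn; rewrite lee_fin gnd.
have {}L2 := cvgeZl cfin L2.
have {}L1 : c * \int[P]_w (g n (X w))%:E @[n --> \oo] --> \int[P]_w (A w * phi (X w))%:E.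
  by under eq_fun do rewrite -gs.
exact: cvg_unique L1 L2.
Qed.

(** Induction replaces indicators by factors [phi (X i)] one index at a time. The indicator of the
    events on the remaining indices is carried along because the next step needs the factorization
    against an arbitrary event of the variable being converted. *)
Lemma independent_prod_aux (I : finType) (X : I -> {RV P >-> R}) (phi : R -> R) (m : I -> R) :
  independent_family X -> measurable_fun setT phi -> (forall x, 0 <= phi x)%R ->
  (forall i, \int[P]_w (phi (X i w))%:E = (m i)%:E) ->
  forall (s : seq I), uniq s -> forall B : I -> set R,
   (forall i, measurable (B i)) -> (forall i, i \in s -> B i = setT) ->
   \int[P]_w ((\prod_(i <- s) phi (X i w)) *
      \1_([set w | forall i, B i (X i w)]) w)%:E
   = ((\prod_(i <- s) m i) * \prod_i fine (P (X i @^-1` B i)))%:E.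
Proof.
move=> indX mphi phi0 mE; elim=> [_ B mB _|i s IH /= /andP[si us] B mB BT].
  rewrite big_nil mul1r.
  under eq_integral do rewrite big_nil mul1r.
  have -> : [set w | forall i, B i (X i w)] =
      \bigcap_(i in [set` [set: I]%SET]) (X i @^-1` B i).
    by apply/seteqP; split=> w Bw i; [move=> _; exact: Bw|apply: Bw; rewrite /= inE].
  rewrite integral_indic//; last first.
    apply: fin_bigcap_measurable => // i _; exact: measurable_funPTI.
  rewrite setIT (big_morph EFin (@EFinM R) erefl).
  apply: (etrans (indX [set: I]%SET B (fun i _ => mB i))).
  apply: eq_big => [i|i _]; first by rewrite inE.
  by rewrite fineK// fin_num_measure//; exact: measurable_funPTI.
have m0 j : (0 <= m j)%R.
  by rewrite -lee_fin -mE; apply: integral_ge0 => w _; rewrite lee_fin.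
have mphiX i' : measurable_fun setT (fun w => phi (X i' w)).
  exact: (measurableT_comp mphi (measurable_funPT (X i'))).
pose C D i' := if i' == i then D else B i'.
have CI D : C D i = D by rewrite /C eqxx.
have CE D : [set w | forall i, C D i (X i w)] =
    [set w | forall i, B i (X i w)] `&` X i @^-1` D.
  apply/seteqP; split => w.
    move=> H; split.
      move=> j; have := H j; rewrite /C /=; case: eqP => [->|//].
      by rewrite BT// mem_head.
    by have := H i; rewrite /C /= eqxx; apply.
  move=> [H Di] j; rewrite /C /=; case: eqP => [->//|_]; exact: H.
have mC D : measurable D -> forall i', measurable (C D i').
  by move=> mD i'; rewrite /C; case: ifP.
have mEv : measurable [set w | forall i, B i (X i w)].
  have -> : [set w | forall i, B i (X i w)] =
      \bigcap_(i in [set: I]) (X i @^-1` B i).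
    by apply/seteqP; split=> w Bw j; [move=> _; exact: Bw|apply: Bw].
  by apply: fin_bigcap_measurable => // j _; exact: measurable_funPTI.
pose A w := ((\prod_(i <- s) phi (X i w)) * \1_([set w | forall i, B i (X i w)]) w)%R.
have mA : measurable_fun setT A.
  apply: measurable_funM; last exact: measurable_indic.
  exact: measurable_prod.
have A0 w : (0 <= A w)%R by rewrite mulr_ge0// prodr_ge0.
pose c := ((\prod_(j <- s) m j) * \prod_(j | j != i) fine (P (X j @^-1` B j)))%R.
have c0 : (0 <= c)%R.
  by rewrite /c mulr_ge0//; apply: prodr_ge0 => // j _; exact: fine_ge0.
have H D : measurable D ->
    \int[P]_w (A w * \1_(X i @^-1` D) w)%:E = c%:E * P (X i @^-1` D).
  move=> mD.
  have CT j : j \in s -> C D j = setT.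
    move=> js; rewrite /C ifF ?BT// ?inE ?js ?orbT//.
    by apply/eqP => ji; rewrite -ji js in si.
  have := IH us (C D) (mC D mD) CT.
  rewrite CE (bigD1 i)//= CI.
  have -> : (\prod_(j | j != i) fine (P (X j @^-1` C D j)) =
     \prod_(j | j != i) fine (P (X j @^-1` B j)))%R.
    by apply: eq_bigr => j /negbTE ji; rewrite /C ji.
  have <- : c%:E * P (X i @^-1` D) = ((\prod_(j <- s) m j) *
      (fine (P (X i @^-1` D)) * \prod_(j | j != i) fine (P (X j @^-1` B j))))%:E.
    rewrite -[P (X i @^-1` D)]fineK ?fin_num_measure//; last exact: measurable_funPTI.
    by rewrite /= /c -EFinM mulrAC mulrA.
  by move=> <-; apply: eq_integral => w _; rewrite /A indicI mulrA.
have := @ge0_integral_mul_comp A (X i) c%:E phi mA A0 c0 isT H mphi phi0.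
rewrite mE /A => H'.
have -> : \int[P]_w ((\prod_(j <- (i :: s)) phi (X j w)) *
      \1_([set w | forall i, B i (X i w)]) w)%:E = c%:E * (m i)%:E.
  by rewrite -H'; apply: eq_integral => w _; rewrite big_cons -mulrA mulrC.
rewrite big_cons (bigD1 i)//= (BT i) ?mem_head// preimage_setT probability_setT.
by rewrite /= mul1r -EFinM /c mulrC mulrA.
Qed.

Lemma independent_prod (I : finType) (X : I -> {RV P >-> R}) (phi : R -> R) (m : I -> R) (s : seq I) :
  independent_family X -> measurable_fun setT phi -> (forall x, 0 <= phi x)%R ->
  (forall i, \int[P]_w (phi (X i w))%:E = (m i)%:E) -> uniq s ->
  \int[P]_w (\prod_(i <- s) phi (X i w))%:E = (\prod_(i <- s) m i)%:E.
Proof.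
move=> indX mphi phi0 mE us.
have := @independent_prod_aux I X phi m indX mphi phi0 mE s us (fun=> setT) (fun=> measurableT) (fun _ _ => erefl).
rewrite [X in (_ * X)%R]big1 ?mulr1; last first.
  by move=> i _; rewrite preimage_setT probability_setT.
move=> <-; apply: eq_integral => w _; rewrite indicE mem_set ?mulr1//.
Qed.

Lemma mgf_sum (I : finType) (X : I -> {RV P >-> R}) (beta nu : R) (s : seq I) :
  independent_family X -> uniq s ->
  (forall i, 'M_P (X i) nu <= (expR (beta * nu ^+ 2))%:E) ->
  \int[P]_w (expR (nu * \sum_(i <- s) X i w))%:E <=
    (expR ((size s)%:R * (beta * nu ^+ 2)))%:E.
Proof.
move=> indX us mX.
have mXE i : 'M_P (X i) nu = \int[P]_w (expR (nu * X i w))%:E.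
  rewrite /mmt_gen_fun unlock; apply: eq_integral => w _ /=; congr (expR _)%:E.
  by rewrite mulrC.
have I0 i : 0 <= \int[P]_w (expR (nu * X i w))%:E.
  by apply: integral_ge0 => w _; rewrite lee_fin expR_ge0.
have If i : \int[P]_w (expR (nu * X i w))%:E \is a fin_num.
  by rewrite ge0_fin_numE// -mXE (le_lt_trans (mX i))// ltry.
pose m i := fine (\int[P]_w (expR (nu * X i w))%:E).
have mexp : measurable_fun setT (fun x : measurableTypeR R => expR (nu * x)).
  apply: measurableT_comp => //; exact: measurable_funM.
have := @independent_prod I X (fun x => expR (nu * x)) m s indX mexp (fun x => expR_ge0 _) _ us.
have -> : \int[P]_w (\prod_(i <- s) expR (nu * X i w))%:E =
    \int[P]_w (expR (nu * \sum_(i <- s) X i w))%:E.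
  by apply: eq_integral => w _; rewrite mulr_sumr expR_sum.
move=> ->; last by move=> i; rewrite /m fineK.
rewrite lee_fin expRM_natl.
have -> : (expR (beta * nu ^+ 2) ^+ size s = \prod_(i <- s) expR (beta * nu ^+ 2))%R.
  by rewrite big_const_seq count_predT -Monoid.iteropE.
apply: ler_prod => i _; rewrite /m fine_ge0//=.
by rewrite -lee_fin fineK// -mXE.
Qed.

(** Chernoff's bound for the sum and for its negative, hence the factor 2. The parameter [nu] stays
    free because the later tail estimates choose it differently. *)
Lemma subgaussian_tail (I : finType) (X : I -> {RV P >-> R}) (beta nu a : R) (s : seq I) :
  independent_family X -> uniq s -> (0 < nu)%R ->
  (forall i nu, 'M_P (X i) nu <= (expR (beta * nu ^+ 2))%:E) ->
  P [set w | (a <= `|\sum_(i <- s) X i w|)%R] <=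
    (2 * expR ((size s)%:R * (beta * nu ^+ 2) - nu * a))%:E.
Proof.
move=> indX us nu0 mX.
pose Z w := (\sum_(i <- s) X i w)%R.
have mZ : measurable_fun setT Z by apply: measurable_sum => i; exact: measurable_funPT.
have mNZ : measurable_fun setT (\- Z)%R by exact: measurable_funN.
pose Z1 : {RV P >-> R} := HB.pack Z (isMeasurableFun.Build _ _ _ _ _ mZ).
pose Z2 : {RV P >-> R} := HB.pack (\- Z)%R (isMeasurableFun.Build _ _ _ _ _ mNZ).
have c1 := @chernoff _ _ _ P Z1 nu a nu0.
have c2 := @chernoff _ _ _ P Z2 nu a nu0.
have m1 : 'M_P Z1 nu <= (expR ((size s)%:R * (beta * nu ^+ 2)))%:E.
  rewrite /mmt_gen_fun unlock; apply: le_trans (mgf_sum indX us (mX^~ nu)).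
  rewrite le_eqVlt; apply/orP; left; apply/eqP; apply: eq_integral => w _ /=.
  by rewrite mulrC.
have m2 : 'M_P Z2 nu <= (expR ((size s)%:R * (beta * nu ^+ 2)))%:E.
  have <- : ((- nu) ^+ 2 = nu ^+ 2)%R by rewrite sqrrN.
  rewrite /mmt_gen_fun unlock; apply: le_trans (mgf_sum indX us (mX^~ (- nu)%R)).
  rewrite le_eqVlt; apply/orP; left; apply/eqP; apply: eq_integral => w _ /=.
  by rewrite mulrC mulrN mulNr.
have ms : forall Z' : {RV P >-> R}, measurable [set w | (a <= Z' w)%R].
  move=> Z'; have -> : [set w | (a <= Z' w)%R] = Z' @^-1` `[a, +oo[%classic.
    by apply/seteqP; split => w /=; rewrite in_itv/= andbT.
  exact: measurable_funPTI.
have -> : [set w | (a <= `|\sum_(i <- s) X i w|)%R] = [set w | (a <= Z1 w)%R] `|` [set w | (a <= Z2 w)%R].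
  by apply/seteqP; split => w /=; rewrite ler_normr => /orP.
apply: le_trans (measureU2 _ _ _) _ => //.
have e0 : 0 <= (expR (- (nu * a)))%:E :> \bar R by rewrite lee_fin expR_ge0.
rewrite expRD mulr_natl mulr2n EFinD; apply: leeD.
  by apply: (le_trans c1); rewrite EFinM; exact: lee_wpmul2r.
by apply: (le_trans c2); rewrite EFinM; exact: lee_wpmul2r.
Qed.

End Independence.

(** * Deviations of interval sums and union bounds *)

Section Tails.
Context {d : measure_display} {T : measurableType d} {R : realType}.
Variable P : probability T R.

(** Extension by 0 to all natural indices, so that interval sums carry no proofs of [i < n]. *)
Definition ext (n : nat) (x : 'I_n -> R) (i : nat) : R := oapp x 0 (insub i).

Lemma ext_ord n (x : 'I_n -> R) (i : 'I_n) : ext x i = x i.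
Proof. by rewrite /ext valK. Qed.

Definition iseg n a b := [seq i : 'I_n <- enum 'I_n | (a <= i < b)%N].

Lemma isum_ext n (x : 'I_n -> R) a b : (b <= n)%N ->
  isum (ext x) a b = \sum_(i <- iseg n a b) x i.
Proof.
move=> bn; rewrite big_filter big_enum_cond /= /isum.
rewrite (big_nat_widen _ _ _ _ _ bn) (big_nat_widenl _ _ _ _ _ (leq0n a)) big_mkord.
by apply: eq_big => [i|i _]; [rewrite andbC|rewrite ext_ord].
Qed.

Lemma size_iseg n a b : (b <= n)%N -> size (iseg n a b) = (b - a)%N.
Proof.
move=> bn; rewrite -sum1_size big_filter big_enum_cond /=.
rewrite -[RHS]muln1 -sum_nat_const_nat.
rewrite (big_nat_widen _ _ _ _ _ bn) (big_nat_widenl _ _ _ _ _ (leq0n a)) big_mkord.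
by apply: eq_big => [i|i _]; rewrite 1?andbC.
Qed.

Lemma measurable_isum n (X : 'I_n -> {RV P >-> R}) a b :
  measurable_fun setT (fun w => isum (ext (X^~ w)) a b).
Proof.
apply: measurable_sum => i; rewrite /ext; case: insubP => [j _ _|_] /=.
  exact: measurable_funPT.
exact: measurable_cst.
Qed.

Definition deviates n (X : 'I_n -> {RV P >-> R}) (a b : nat) (s : R) : set T :=
  [set w | s < `|isum (ext (X^~ w)) a b| ].

Lemma measurable_deviates n (X : 'I_n -> {RV P >-> R}) a b s :
  measurable (deviates X a b s).
Proof.
have mf : measurable_fun setT (fun w => `|isum (ext (X^~ w)) a b|).
  exact: (measurableT_comp (@normr_measurable _ setT) (measurable_isum X a b)).
have -> : deviates X a b s =
    (fun w => `|isum (ext (X^~ w)) a b|) @^-1` `]s, +oo[%classic.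
  by apply/seteqP; split => w /=; rewrite in_itv/= andbT.
by rewrite -[X in measurable X]setTI; apply: mf.
Qed.

Lemma deviates_tail n (X : 'I_n -> {RV P >-> R}) (beta nu s : R) a b : (b <= n)%N ->
  independent_family X -> 0 < nu ->
  (forall i nu, ('M_P (X i) nu <= (expR (beta * nu ^+ 2))%:E)%E) ->
  (P (deviates X a b s) <=
    (2 * expR ((b - a)%:R * (beta * nu ^+ 2) - nu * s))%:E)%E.
Proof.
move=> bn indX nu0 mX.
have us : uniq (iseg n a b) by rewrite filter_uniq// enum_uniq.
have := subgaussian_tail s indX us nu0 mX.
rewrite size_iseg//; apply: le_trans.
apply: le_measure; rewrite ?inE; first exact: measurable_deviates.
  have mf : measurable_fun setT (fun w => `|\sum_(i <- iseg n a b) X i w|).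
    apply: (measurableT_comp (@normr_measurable _ setT)).
    by apply: measurable_sum => i; exact: measurable_funPT.
  have -> : [set w | s <= `|\sum_(i <- iseg n a b) X i w| ] =
      (fun w => `|\sum_(i <- iseg n a b) X i w|) @^-1` `[s, +oo[%classic.
    by apply/seteqP; split => w /=; rewrite in_itv/= andbT.
  by rewrite -[X in measurable X]setTI; apply: mf.
by move=> w; rewrite /deviates /= isum_ext// => /ltW.
Qed.

Definition deviates_some n (X : 'I_n -> {RV P >-> R}) (ends : seq (nat * nat))
    (lev : nat * nat -> R) : set T :=
  [set w | exists2 e, e \in ends & deviates X e.1 e.2 (lev e) w].

Lemma deviates_someP n (X : 'I_n -> {RV P >-> R}) (ends : seq (nat * nat)) (lev : nat * nat -> R) :
  measurable (deviates_some X ends lev) /\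
  (P (deviates_some X ends lev) <= \sum_(e <- ends) P (deviates X e.1 e.2 (lev e)))%E.
Proof.
elim: ends => [|e s [mI PI]].
  rewrite big_nil; have -> : deviates_some X [::] lev = set0.
    by apply/seteqP; split => // w [].
  by split; [exact: measurable0|rewrite measure0].
have E : deviates_some X (e :: s) lev =
   deviates X e.1 e.2 (lev e) `|` deviates_some X s lev.
  apply/seteqP; split => w /=.
    by move=> [e' /[!inE] /orP[/eqP->|e's] h]; [left|right; exists e'].
  move=> [h|[e' e's h]]; first by exists e => //; rewrite mem_head.
  by exists e' => //; rewrite inE e's orbT.
have me := measurable_deviates X e.1 e.2 (lev e).
rewrite E; split; first exact: measurableU.
rewrite big_cons; apply: (le_trans (measureU2 _ _ _)) => //.
exact: leeD2l.
Qed.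

(** Pairs with b <= a are kept, which makes the length exactly n^2; their sums are empty and never
    exceed a nonnegative level. *)
Definition segs n := [seq (a, b) | a <- iota 0 n, b <- iota 1 n].

Definition noise_bad n (X : 'I_n -> {RV P >-> R}) (M : R) : set T :=
  deviates_some X (segs n) (fun e => Num.sqrt ((e.2 - e.1)%:R * M)).

Lemma noise_badE n (X : 'I_n -> {RV P >-> R}) (M : R) w : 0 <= M ->
  ~ noise_bad X M w -> noise_le (ext (X^~ w)) n M.
Proof.
move=> M0 nb a b ab; rewrite leNgt; apply/negP => h; apply: nb.
exists (a, b).
  by apply/allpairsP; exists (a, b); split; rewrite ?mem_iota//=; lia.
by rewrite /deviates /= -sqrtr_sqr ltr_sqrt// (le_lt_trans _ h)// mulr_ge0.
Qed.

(** With nu = sqrt (ln n / |I|) the exponent is beta ln n - (beta + 4) ln n = - 4 ln n. Each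
    interval then has probability at most 2 / n^4, and the n^2 intervals together give a summable 2
    / n^2; this is the origin of the constant (beta + 4)^2. *)
Lemma noise_bad_le n (X : 'I_n -> {RV P >-> R}) (beta : R) : (1 < n)%N ->
  independent_family X -> 0 < beta ->
  (forall i nu, ('M_P (X i) nu <= (expR (beta * nu ^+ 2))%:E)%E) ->
  (P (noise_bad X ((beta + 4) ^+ 2 * ln n%:R)) <= (2 / n%:R ^+ 2)%:E)%E.
Proof.
move=> n1 indX b0 mX.
have [_] := deviates_someP X (segs n) (fun e => Num.sqrt ((e.2 - e.1)%:R * ((beta + 4) ^+ 2 * ln n%:R))).
move/le_trans; apply.
have nR : 1 < n%:R :> R by rewrite ltr1n.
have n0 : 0 < n%:R :> R by rewrite (lt_trans ltr01).
have L0 : 0 < ln n%:R :> R by rewrite ln_gt0.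
have each e : e \in segs n ->
  (P (deviates X e.1 e.2 (Num.sqrt ((e.2 - e.1)%:R * ((beta + 4) ^+ 2 * ln n%:R)))) <= (2 / n%:R ^+ 4)%:E)%E.
  move=> /allpairsP[[a b] [/= ai bi ->]] /=.
  rewrite !mem_iota in ai bi.
  have [ab|ab] := ltnP a b; last first.
    have -> : deviates X a b (Num.sqrt ((b - a)%:R * ((beta + 4) ^+ 2 * ln n%:R))) = set0.
      apply/seteqP; split => // w; rewrite /deviates /= /isum big_geq// normr0 ltNge sqrtr_ge0//.
    by rewrite measure0 lee_fin divr_ge0// exprn_ge0// ltW.
  have d0 : 0 < (b - a)%:R :> R by rewrite ltr0n; lia.
  pose nu := Num.sqrt (ln n%:R / (b - a)%:R) : R.
  have nu0 : 0 < nu by rewrite sqrtr_gt0 divr_gt0.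
  have bn : (b <= n)%N by lia.
  apply: (le_trans (deviates_tail _ a bn indX nu0 mX)).
  rewrite lee_fin ler_pM2l//.
  have -> : nu * Num.sqrt ((b - a)%:R * ((beta + 4) ^+ 2 * ln n%:R)) = (beta + 4) * ln n%:R.
    rewrite -sqrtrM; last by rewrite divr_ge0// ltW.
    have -> : ln n%:R / (b - a)%:R * ((b - a)%:R * ((beta + 4) ^+ 2 * ln n%:R)) = ((beta + 4) * ln n%:R) ^+ 2 :> R.
      by field; rewrite gt_eqF.
    by rewrite sqrtr_sqr ger0_norm// mulr_ge0 ?addr_ge0// ltW.
  have -> : (b - a)%:R * (beta * nu ^+ 2) - (beta + 4) * ln n%:R = - (4%:R * ln n%:R) :> R.
    rewrite sqr_sqrtr; last by rewrite divr_ge0// ltW.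
    by field; rewrite gt_eqF.
  by rewrite expRN expRM_natl lnK// posrE.
have : (\sum_(e <- segs n) P (deviates X e.1 e.2 (Num.sqrt ((e.2 - e.1)%:R * ((beta + 4) ^+ 2 * ln n%:R))))
   <= \sum_(e <- segs n) (2 / n%:R ^+ 4)%:E)%E.
  by rewrite big_seq [leRHS]big_seq; apply: lee_sum => e /each.
move/le_trans; apply.
rewrite sumEFin lee_fin big_const_seq count_predT iter_addr_0 /segs size_allpairs !size_iota.
rewrite -[X in X <= _]mulr_natl natrM.
rewrite le_eqVlt; apply/orP; left; apply/eqP; by field; rewrite gt_eqF.
Qed.

Lemma geometric_partial_le (r : R) N : 0 <= r < 1 -> \sum_(0 <= i < N) r ^+ i <= (1 - r)^-1.
Proof.
move=> /andP[r0 r1]; have d0 : 0 < 1 - r by lra.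
rewrite -(ler_pM2l d0) divff ?gt_eqF//.
suff -> : (1 - r) * \sum_(0 <= i < N) r ^+ i = 1 - r ^+ N.
  by rewrite lerBlDr lerDl exprn_ge0.
elim: N => [|N IH]; first by rewrite big_geq// mulr0 expr0 subrr.
by rewrite big_nat_recr//= mulrDr IH exprS; ring.
Qed.

(** There is one interval for each length l. The choice nu = eta / (2 beta) gives the exponent - l
    eta^2 / (4 beta) - eta A / (2 beta), so the union bound is a geometric series in l and its sum
    does not depend on [m] or [n]. *)
Lemma drift_tail n (X : 'I_n -> {RV P >-> R}) (beta eta A : R) (ends : nat -> nat * nat) m :
  independent_family X -> 0 < beta -> 0 < eta ->
  (forall i nu, ('M_P (X i) nu <= (expR (beta * nu ^+ 2))%:E)%E) ->
  (forall l, (l < m)%N -> ((ends l).2 <= n)%N /\ ((ends l).2 - (ends l).1 = l)%N) ->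
  (P (deviates_some X [seq ends l | l <- iota 0 m] (fun e => (eta * (e.2 - e.1)%:R + A)%R))
   <= (2 * expR (- (eta * A / (2 * beta))) / (1 - expR (- (eta ^+ 2 / (4 * beta)))))%:E)%E.
Proof.
move=> indX b0 e0 mX hends.
have [_] := deviates_someP X [seq ends l | l <- iota 0 m] (fun e => (eta * (e.2 - e.1)%:R + A)%R).
move/le_trans; apply.
pose r := expR (- (eta ^+ 2 / (4 * beta))).
have r1 : r < 1 by rewrite expR_lt1 oppr_lt0 divr_gt0// ?mulr_gt0// exprn_gt0.
rewrite big_map.
have : (\sum_(l <- iota 0 m) P (deviates X (ends l).1 (ends l).2 (eta * ((ends l).2 - (ends l).1)%:R + A)%R)
   <= \sum_(l <- iota 0 m) (2 * expR (- (eta * A / (2 * beta))) * r ^+ l)%:E)%E.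
  rewrite big_seq [leRHS]big_seq; apply: lee_sum => l; rewrite mem_iota => lm.
  have [en el] := hends l ltac:(lia).
  have nu0 : 0 < eta / (2 * beta) by rewrite divr_gt0// mulr_gt0.
  apply: (le_trans (deviates_tail _ _ en indX nu0 mX)).
  rewrite lee_fin -[X in _ <= X]mulrA (ler_pM2l (ltr0n R 2)) el -expRM_natl -expRD ler_expR le_eqVlt; apply/orP; left; apply/eqP.
  by field; rewrite gt_eqF.
move/le_trans; apply.
rewrite sumEFin lee_fin -mulr_sumr ler_wpM2l ?mulr_ge0 ?expR_ge0//.
have := @geometric_partial_le r m; rewrite /index_iota subn0; apply.
by rewrite expR_ge0.
Qed.

End Tails.

(** * The space L2 and the regular grid *)

Section L2.
Context {R : realType}.
Notation mu := (@lebesgue_measure R).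
Implicit Types f g h : R -> R.

Lemma measurable_unitI : measurable (@unitI R : set (measurableTypeR R)). Proof. exact: measurable_itv. Qed.
Hint Resolve measurable_unitI : core.

Lemma unitI1 : mu unitI = 1%E.
Proof. by rewrite lebesgue_measure_itv/= lte_fin ltr01 -EFinB subr0. Qed.

Lemma unitI_lty : (mu unitI < +oo)%E.
Proof. by rewrite unitI1 ltry. Qed.

Lemma Lnorm2_integral f :
  (\int[mu]_x `|(EFin \o (f \_ unitI)) x| `^ 2 = \int[mu]_(x in unitI) (f x ^+ 2)%:E)%E.
Proof.
rewrite [RHS]integral_mkcond; apply: eq_integral => x _ /=.
rewrite powR_mulrn// -normrX ger0_norm ?sqr_ge0//.
by rewrite /patch; case: ifP => //; rewrite expr0n.
Qed.

Lemma in_L2P f : in_L2 f <->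
  measurable_fun unitI f /\ mu.-integrable unitI (EFin \o (fun x => f x ^+ 2)).
Proof.
have sqE : (fun x : R => (f \_ unitI) x ^+ 2) = (fun x => f x ^+ 2) \_ unitI.
  by apply/funext => x; rewrite /patch; case: ifP => //; rewrite expr0n.
split.
  move=> h; have := h; rewrite /in_L2 inE => /andP[/[!inE]/= mf _].
  split; first exact/(measurable_restrictT _ _).2.
  have := Lfun2_integrable_sqr h.
  rewrite (_ : EFin \o _ = (EFin \o (fun x => f x ^+ 2)) \_ unitI); last first.
    apply/funext => x /=; rewrite -[RHS]/(((EFin \o (fun x => f x ^+ 2)) \_ unitI) x).
    by rewrite /patch; case: ifP => //= _; rewrite expr0n.
  by move/integrable_restrict; rewrite setTI; apply.
move=> [mf fi]; rewrite /in_L2 inE; apply/andP; split; rewrite inE/=.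
  exact/(measurable_restrictT _ _).1.
rewrite /finite_norm unlock; apply: poweR_lty.
rewrite Lnorm2_integral; exact: integrable_lty.
Qed.

Lemma L2norm_ge0 f : 0 <= L2norm f.
Proof. by rewrite fine_ge0// Lnorm_ge0. Qed.
Hint Resolve L2norm_ge0 : core.

Lemma L2norm_sqr f : in_L2 f -> L2norm f ^+ 2 = \int[mu]_(x in unitI) (f x ^+ 2).
Proof.
move=> /in_L2P[_ fi]; rewrite /L2norm unlock Lnorm2_integral /Rintegral.
have := integrable_fin_num measurable_unitI fi.
have : (0 <= \int[mu]_(x in unitI) ((EFin \o (fun x => (f x ^+ 2)%R)) x))%E.
  by apply: integral_ge0 => x _; rewrite lee_fin sqr_ge0.
rewrite /=; case: (\int[mu]_(x in unitI) _)%E => //= r r0 _.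
by rewrite powR12_sqrt// sqr_sqrtr.
Qed.

Lemma L2norm_le f (c : R) : in_L2 f -> 0 <= c ->
  \int[mu]_(x in unitI) (f x ^+ 2) <= c ^+ 2 -> L2norm f <= c.
Proof.
move=> hf c0; rewrite -L2norm_sqr// => h.
by rewrite -(@ler_pXn2r _ 2)// nnegrE.
Qed.

Lemma in_L2_measurable f : in_L2 f -> measurable_fun unitI f.
Proof. by move=> /in_L2P[]. Qed.

Lemma in_L2_integrable f : in_L2 f -> mu.-integrable unitI (EFin \o (fun x => f x ^+ 2)).
Proof. by move=> /in_L2P[]. Qed.

Lemma in_L2D f g : in_L2 f -> in_L2 g -> in_L2 (f \+ g).
Proof.
move=> /in_L2P[mf fi] /in_L2P[mg gi]; apply/in_L2P; split.
  exact: measurable_funD.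
have h := integrableD measurable_unitI (integrableZl measurable_unitI 2 fi) (integrableZl measurable_unitI 2 gi).
apply: (le_integrable measurable_unitI _ _ h).
  by apply/measurable_EFinP; apply: measurable_funX; exact: measurable_funD.
move=> x _ /=; rewrite lee_fin ger0_norm ?sqr_ge0// [leRHS]ger0_norm; last first.
  by rewrite addr_ge0// mulr_ge0// sqr_ge0.
by have := sqr_ge0 (f x - g x); rewrite sqrrB sqrrD; lra.
Qed.

Lemma in_L2N f : in_L2 f -> in_L2 (\- f).
Proof.
move=> /in_L2P[mf fi]; apply/in_L2P; split; first exact: measurable_funN.
by apply: eq_integrable fi => // x _ /=; rewrite sqrrN.
Qed.

Lemma in_L2B f g : in_L2 f -> in_L2 g -> in_L2 (f \- g).
Proof. by move=> hf /in_L2N; exact: in_L2D. Qed.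

Lemma in_L2_bounded f (B : R) : measurable_fun unitI f ->
  (forall x, unitI x -> `|f x| <= B) -> in_L2 f.
Proof.
move=> mf fB; apply/in_L2P; split => //.
apply: measurable_bounded_integrable => //.
- exact: unitI_lty.
- exact: measurable_funX.
- exists (B ^+ 2); split; first exact: num_real.
  move=> y By x /fB xB /=; apply: le_trans (ltW By).
  by rewrite ger0_norm ?sqr_ge0// -[f x ^+ 2]real_normK ?num_real// lerXn2r// ?nnegrE// (le_trans _ xB).
Qed.

Lemma L2normD f g : in_L2 f -> in_L2 g -> L2norm (f \+ g) <= L2norm f + L2norm g.
Proof.
move=> hf hg; have hfg := in_L2D hf hg.
have fin h : in_L2 h -> ('N[mu]_2%:E[EFin \o (h \_ unitI)] \is a fin_num)%E.
  by rewrite /in_L2 inE => /andP[_ /[!inE]] ?; rewrite ge0_fin_numE// Lnorm_ge0.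
rewrite /L2norm -fineD ?fin// fine_le ?fin_numD ?fin//.
have -> : (f \+ g) \_ unitI = (f \_ unitI) \+ (g \_ unitI).
  by apply/funext => x; rewrite /patch /=; case: ifP; rewrite ?addr0.
apply: minkowski_EFin; rewrite ?ler1n//.
- by apply/(measurable_restrictT _ _).1 => //; exact: in_L2_measurable.
- by apply/(measurable_restrictT _ _).1 => //; exact: in_L2_measurable.
Qed.

Lemma L2norm_distC f g : L2norm (f \- g) = L2norm (g \- f).
Proof.
rewrite /L2norm -oppe_Lnorm; congr (fine (Lnorm _ _ _)).
by apply/funext => x /=; rewrite /patch; case: ifP => // _; rewrite ?oppr0//= opprB.
Qed.

Lemma L2norm_tri f g h : in_L2 f -> in_L2 g -> in_L2 h ->
  L2norm (f \- h) <= L2norm (f \- g) + L2norm (g \- h).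
Proof.
move=> hf hg hh; apply: le_trans (L2normD (in_L2B hf hg) (in_L2B hg hh)).
rewrite le_eqVlt; apply/orP; left; apply/eqP; congr (L2norm _).
by apply/funext => x /=; rewrite addrA subrK.
Qed.

Lemma L2norm_eq f g : in_L2 f -> in_L2 g -> L2eq f g -> L2norm f = L2norm g.
Proof.
move=> hf hg fg; apply/eqP; rewrite -(@eqrXn2 _ 2)//; apply/eqP.
rewrite !L2norm_sqr//; congr fine; apply: ae_eq_integral => //.
- by apply/measurable_EFinP; apply: measurable_funX; exact: in_L2_measurable.
- by apply/measurable_EFinP; apply: measurable_funX; exact: in_L2_measurable.
- case: fg => N [mN N0 sub]; exists N; split => // x /= nx; apply: sub => /= fgx.
  by apply: nx => xI; rewrite fgx.
Qed.

Lemma in_L2_integrable1 f : in_L2 f -> mu.-integrable unitI (EFin \o f).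
Proof.
move=> /in_L2P[mf fi].
have c1 : mu.-integrable unitI (EFin \o (fun=> 1)).
  apply: measurable_bounded_integrable => //.
  - exact: unitI_lty.
  - by exists 1; split; [exact: num_real|move=> y y1 x _ /=; rewrite normr1 ltW].
apply: (le_integrable measurable_unitI _ _ (integrableD measurable_unitI c1 fi)).
  exact/measurable_EFinP.
move=> x _ /=; rewrite lee_fin [leRHS]ger0_norm ?addr_ge0 ?sqr_ge0//.
have := sqr_ge0 (`|f x| - 1); rewrite sqrrB expr1n mulr1 real_normK ?num_real//.
have := normr_ge0 (f x); lra.
Qed.

End L2.
#[global] Hint Resolve L2norm_ge0 measurable_unitI : core.

(** * The regular grid and its cell means *)

Section Cells.
Context {R : realType}.
Notation mu := (@lebesgue_measure R).
Implicit Types f g h : R -> R.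

Lemma measurable_itvco (a b : R) : measurable (`[a, b[%classic : set (measurableTypeR R)).
Proof. exact: measurable_itv. Qed.

Lemma measurable_cell n i : measurable (cell n i : set (measurableTypeR R)).
Proof. exact: measurable_itv. Qed.

Lemma in_cell n (i : nat) (x : R) : (0 < n)%N ->
  cell n i x = (i%:R <= x * n%:R < i.+1%:R) :> Prop.
Proof.
move=> n0; have n0' : 0 < n%:R :> R by rewrite ltr0n.
by rewrite /cell /design /= in_itv/= ler_pdivrMr// ltr_pdivlMr.
Qed.

Lemma cell_inj n (i j : nat) (x : R) : (0 < n)%N -> cell n i x -> cell n j x -> i = j.
Proof.
move=> n0; rewrite !in_cell// => /andP[a b] /andP[c e].
have := le_lt_trans a e; have := le_lt_trans c b.
rewrite !ltr_nat !ltnS => h1 h2; apply/eqP; rewrite eqn_leq h1 h2//.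
Qed.

Lemma cell_unitI n (i : nat) (x : R) : (i < n)%N -> cell n i x -> unitI x.
Proof.
move=> iN; have n0 : (0 < n)%N by lia.
have n0' : 0 < n%:R :> R by rewrite ltr0n.
rewrite in_cell// /unitI /= in_itv/= => /andP[a b].
rewrite -(pmulr_lge0 x n0') (le_trans _ a)//=.
rewrite -(ltr_pM2r n0') mul1r (lt_le_trans b)// ler_nat//.
Qed.

Lemma cell_exists n (x : R) : (0 < n)%N -> unitI x -> exists2 i, (i < n)%N & cell n i x.
Proof.
move=> n0; have n0' : 0 < n%:R :> R by rewrite ltr0n.
rewrite /unitI /= in_itv/= => /andP[x0 x1].
have xn0 : 0 <= x * n%:R by rewrite mulr_ge0// ltW.
have /andP[a b] := truncn_itv xn0.
exists (Num.truncn (x * n%:R)); last by rewrite in_cell// a b.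
by rewrite -(ltr_nat R) (le_lt_trans a)// -[ltRHS]mul1r ltr_pM2r.
Qed.

Lemma embedE n (u : 'rV[R]_n) (i : 'I_n) x : cell n i x -> embed u x = u ord0 i.
Proof.
move=> ix; rewrite /embed (bigD1 i)//= indicE mem_set// mulr1 big1 ?addr0// => j ji.
rewrite indicE memNset ?mulr0// => jx; move/eqP: ji; apply.
by apply/val_inj; apply: (cell_inj _ jx ix); exact: leq_ltn_trans (ltn_ord i).
Qed.

Lemma measurable_embed n (u : 'rV[R]_n) D : measurable_fun D (embed u : measurableTypeR R -> R).
Proof.
apply: measurable_sum => i; apply: measurable_funM => //.
by apply: measurable_indic; exact: measurable_cell.
Qed.

Lemma in_L2_embed n (u : 'rV[R]_n) : in_L2 (embed u).
Proof.
apply: (@in_L2_bounded _ _ (\sum_i `|u ord0 i|)); first exact: measurable_embed.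
move=> x _; apply: le_trans (ler_norm_sum _ _ _) _; apply: ler_sum => i _.
rewrite normrM -[leRHS]mulr1 ler_wpM2l// indicE; case: (_ \in _); rewrite ?normr0 ?normr1//.
Qed.
Hint Resolve in_L2_embed : core.

Lemma integral_cells n h : (0 < n)%N -> mu.-integrable unitI (EFin \o h) ->
  \int[mu]_(x in unitI) h x = \sum_(i < n) \int[mu]_(x in cell n i) h x.
Proof.
move=> n0 ih.
have n0' : 0 < n%:R :> R by rewrite ltr0n.
have ihs (a b : R) : 0 <= a -> b <= 1 -> mu.-integrable `[a, b[%classic (EFin \o h).
  move=> a0 b1; apply: integrableS ih => //.
  move=> x; rewrite /unitI /= !in_itv/= => /andP[ax xb].
  by rewrite (le_trans a0 ax) (lt_le_trans xb b1).
suff H : forall k, (k <= n)%N ->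
    \int[mu]_(x in `[0, design n k[%classic) h x = \sum_(0 <= i < k) \int[mu]_(x in cell n i) h x.
  have := H n (leqnn n); rewrite /design divff ?gt_eqF// => ->.
  by rewrite big_mkord.
elim=> [_|k IH kn].
  by rewrite /design mul0r set_itvco0 Rintegral_set0 big_geq.
rewrite big_nat_recr//= -IH; last exact: ltnW.
have d1 : (0 : R) <= design n k by rewrite /design divr_ge0.
have d2 : (design n k : R) <= design n k.+1 by rewrite /design ler_pM2r ?invr_gt0// ler_nat.
have d3 : (design n k.+1 : R) <= 1 by rewrite /design ler_pdivrMr// mul1r ler_nat.
have E : `[0, design n k.+1[%classic = `[0, design n k[%classic `|` cell n k :> set R.
  apply/seteqP; split => x /=; rewrite /cell /= !in_itv/=.
    by case/andP => x0 xk; have [xk'|xk'] := ltP x (design n k); [left; rewrite x0|right; rewrite xk].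
  by case=> /andP[a b]; apply/andP; split => //; [exact: lt_le_trans d2|exact: le_trans a].
rewrite E Rintegral_setU//.
- exact: measurable_cell.
- by rewrite -E; exact: ihs.
- apply/disj_setPS => x [/=]; rewrite /cell /= !in_itv/= => /andP[_ a] /andP[b _].
  by have := lt_le_trans a b; rewrite ltxx.
Qed.

Lemma cell_measure n i : (0 < n)%N -> mu (cell n i) = (n%:R^-1)%:E.
Proof.
move=> n0; have n0' : 0 < n%:R :> R by rewrite ltr0n.
rewrite lebesgue_measure_itv/= lte_fin ifT; last first.
  by rewrite /design ltr_pM2r ?invr_gt0// ltr_nat.
by rewrite -EFinB /design -mulrBl -natrB// subSnn mul1r.
Qed.

Lemma cell_measure_lty n i : (0 < n)%N -> (mu (cell n i) < +oo)%E.
Proof. by move=> n0; rewrite cell_measure// ltry. Qed.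

Lemma Rintegral_cell_cst n i (c : R) : (0 < n)%N ->
  \int[mu]_(x in cell n i) c = c / n%:R.
Proof.
move=> n0; rewrite Rintegral_cst; last exact: measurable_itv.
have -> : fine (mu (cell n i)) = fine (n%:R^-1)%:E by rewrite -(cell_measure i n0).
by [].
Qed.

Lemma L2norm_sub_embed n f (u : 'rV[R]_n) : (0 < n)%N -> in_L2 f ->
  L2norm (f \- embed u) ^+ 2 = \sum_(i < n) \int[mu]_(x in cell n i) ((f x - u ord0 i) ^+ 2).
Proof.
move=> n0 hf; have h := in_L2B hf (in_L2_embed u).
rewrite L2norm_sqr// (integral_cells n0); last exact: in_L2_integrable.
apply: eq_bigr => i _; apply: eq_Rintegral => x; rewrite inE => ix.
by rewrite /= (embedE _ ix).
Qed.

Lemma L2norm_embed n (u v : 'rV[R]_n) : (0 < n)%N ->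
  L2norm (embed u \- embed v) ^+ 2 = n%:R^-1 * \sum_(i < n) (u ord0 i - v ord0 i) ^+ 2.
Proof.
move=> n0; rewrite L2norm_sub_embed// mulr_sumr; apply: eq_bigr => i _.
rewrite mulrC -(Rintegral_cell_cst i _ n0).
by apply: eq_Rintegral => x; rewrite inE => ix; rewrite (embedE _ ix).
Qed.

Lemma design_diff n i : (0 < n)%N -> design n i.+1 - design n i = n%:R^-1 :> R.
Proof. by move=> n0; rewrite /design -mulrBl -natrB// subSnn mul1r. Qed.

Lemma integrable_cell n (i : 'I_n) h : mu.-integrable unitI (EFin \o h) ->
  mu.-integrable (cell n i) (EFin \o h).
Proof.
move=> ih; apply: integrableS ih => //.
  exact: measurable_cell.
by move=> x; exact: (cell_unitI (ltn_ord i)).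
Qed.

(* Jensen's inequality for the conditional expectation on the grid. *)
Lemma cell_mean_contraction n f (v : 'rV[R]_n) : (0 < n)%N -> in_L2 f ->
  n%:R^-1 * \sum_(i < n) (cell_mean f n i - v ord0 i) ^+ 2 <= L2norm (f \- embed v) ^+ 2.
Proof.
move=> n0 hf; rewrite L2norm_sub_embed// mulr_sumr; apply: ler_sum => i _.
have n0' : 0 < n%:R :> R by rewrite ltr0n.
set m := cell_mean f n i; set c := v ord0 i.
have if1 := integrable_cell i (in_L2_integrable1 hf).
have if2 := integrable_cell i (in_L2_integrable hf).
have ic (c' : R) : mu.-integrable (cell n i) (EFin \o (fun=> c')).
  apply: measurable_bounded_integrable; first exact: measurable_itv.
  - exact: cell_measure_lty.
  - exact: measurable_cst.
  - by exists `|c'|; split; [exact: num_real|move=> y y1 x _ /=; rewrite ltW].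
have If : \int[mu]_(x in cell n i) f x = m / n%:R.
  by rewrite /m /cell_mean design_diff// invrK mulrC mulKf// gt_eqF.
have E : (fun x => (f x - c) ^+ 2) = (fun x => (f x - m) ^+ 2 + ((m - c) * 2 * f x + (c ^+ 2 - m ^+ 2))).
  by apply/funext => x; ring.
have mc := measurable_cell n i.
have ifm : mu.-integrable (cell n i) (EFin \o (fun x => (m - c) * 2 * f x)).
  have := integrableZl mc ((m - c) * 2) if1.
  by apply: eq_integrable => // x _ /=; rewrite EFinM.
have ifmc : mu.-integrable (cell n i) (EFin \o (fun x => (m - c) * 2 * f x + (c ^+ 2 - m ^+ 2))).
  have := integrableD mc ifm (ic (c ^+ 2 - m ^+ 2)).
  by apply: eq_integrable => // x _ /=; rewrite EFinD.
have iff : mu.-integrable (cell n i) (EFin \o (fun x => (f x - m) ^+ 2)).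
  have ifm2 : mu.-integrable (cell n i) (EFin \o (fun x => - (2 * m) * f x)).
    have := integrableZl mc (- (2 * m)) if1.
    by apply: eq_integrable => // x _ /=; rewrite EFinM.
  have := integrableD mc if2 (integrableD mc ifm2 (ic (m ^+ 2))).
  by apply: eq_integrable => // x _ /=; rewrite -!EFinD; congr EFin; ring.
rewrite [X in _ <= X](_ : _ = \int[mu]_(x in cell n i) ((f x - m) ^+ 2 + ((m - c) * 2 * f x + (c ^+ 2 - m ^+ 2)))); last first.
  by rewrite -E.
rewrite RintegralD// RintegralD// RintegralZl// If Rintegral_cell_cst//.
have : 0 <= \int[mu]_(x in cell n i) ((f x - m) ^+ 2).
  by apply: Rintegral_ge0 => x _; exact: sqr_ge0.
suff : n%:R^-1 * (m - c) ^+ 2 = (m - c) * 2 * (m / n%:R) + (c ^+ 2 - m ^+ 2) / n%:R by lra.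
by field; rewrite gt_eqF.
Qed.

End Cells.
#[global] Hint Resolve in_L2_embed : core.

(** * Step functions *)

Section Steps.
Context {R : realType}.
Notation mu := (@lebesgue_measure R).
Implicit Types (t alpha : nat -> R) (f g : R -> R).

Definition wstep (m : nat) t alpha : R -> R :=
  fun x => \sum_(i < m) alpha i * \1_(`[t i, t i.+1[) x.

(** Break points may coincide, unlike in [step_function]: weak inequalities survive limits, and
    [wstep_reduce] restores strictness when it matters. *)
Definition subdivision (m : nat) t :=
  [/\ t 0%N = 0, t m = 1 & forall i, (i < m)%N -> t i <= t i.+1].

Lemma subdivision_mono m t : subdivision m t ->
  forall i j, (i <= j <= m)%N -> t i <= t j.
Proof.
move=> [_ _ H] i; elim=> [|j IH] ij; first by have -> : i = 0%N by lia.
have [->//|nij] := eqVneq i j.+1.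
by apply: le_trans (IH ltac:(lia)) (H j ltac:(lia)).
Qed.

Lemma subdivision_gt0 m t : subdivision m t -> (0 < m)%N.
Proof. by case=> t0 t1 _; case: m t1 => // t1; have := oner_neq0 R; rewrite -t1 t0 eqxx. Qed.

Lemma wstepE m t alpha (i : nat) x : subdivision m t -> (i < m)%N ->
  t i <= x < t i.+1 -> wstep m t alpha x = alpha i.
Proof.
move=> H im /andP[a b]; have mono := subdivision_mono H.
rewrite /wstep (bigD1 (Ordinal im))//= indicE mem_set ?mulr1 ?big1 ?addr0//; last first.
  by rewrite /= in_itv/= a b.
move=> j; rewrite -val_eqE /= => ji; rewrite indicE memNset ?mulr0//= in_itv/= => /andP[c e].
have [ij|ij] := ltnP i j.
  have := mono i.+1 j ltac:(have := ltn_ord j; lia); move: b c; lra.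
have := mono j.+1 i ltac:(lia); move: a e; lra.
Qed.

Lemma subdivision_locate m t x : subdivision m t -> 0 <= x < 1 ->
  exists2 i, (i < m)%N & t i <= x < t i.+1.
Proof.
move=> [t0 t1 H] /andP[x0 x1].
have key : forall k, (k <= m)%N -> x < t k -> exists2 i, (i < k)%N & t i <= x < t i.+1.
  elim=> [|k IH] km; first by rewrite t0 ltNge x0.
  move=> xk; have [xk'|xk'] := ltP x (t k).
    by have [i ik ix] := IH ltac:(lia) xk'; exists i => //; lia.
  by exists k => //; rewrite xk'.
by have [|i im ix] := key m (leqnn m); [rewrite t1|exists i].
Qed.

Lemma wstep_bound m t alpha x : `|wstep m t alpha x| <= \sum_(i < m) `|alpha i|.
Proof.
apply: le_trans (ler_norm_sum _ _ _) _; apply: ler_sum => i _.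
by rewrite normrM -[leRHS]mulr1 ler_wpM2l// indicE; case: (_ \in _); rewrite ?normr0 ?normr1.
Qed.

Lemma measurable_wstep m t alpha D : measurable_fun D (wstep m t alpha : measurableTypeR R -> R).
Proof.
by apply: measurable_sum => i; apply: measurable_funM.
Qed.

Lemma in_L2_wstep m t alpha : in_L2 (wstep m t alpha).
Proof.
apply: (@in_L2_bounded _ _ (\sum_(i < m) `|alpha i|)); first exact: measurable_wstep.
by move=> x _; exact: wstep_bound.
Qed.

Definition sample (s : R -> R) n : 'rV[R]_n := \row_(i < n) s (design n i).

Lemma design_itv n i : (i < n)%N -> 0 <= (design n i : R) < 1.
Proof.
move=> iN; have n0 : 0 < n%:R :> R by rewrite ltr0n; lia.
by rewrite /design divr_ge0//= ltr_pdivrMr// mul1r ltr_nat.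
Qed.

Lemma Rintegral_sum (h : nat -> R -> R) m :
  (forall j, mu.-integrable unitI (EFin \o h j)) ->
  \int[mu]_(x in unitI) (\sum_(j < m) h j x) = \sum_(j < m) \int[mu]_(x in unitI) h j x.
Proof.
move=> ih; elim: m => [|m IH].
  rewrite big_ord0 (_ : (fun x => _) = fun=> 0) ?Rintegral_cst ?mul0r//.
  by apply/funext => x; rewrite big_ord0.
rewrite big_ord_recr/= -IH -RintegralD//.
  by apply: eq_Rintegral => x _; rewrite big_ord_recr.
have := @integrable_sum _ _ _ mu _ measurable_unitI _ (index_enum _) predT _ (fun (j : 'I_m) _ => ih j).
by apply: eq_integrable => // x _ /=; rewrite sumEFin.
Qed.

(* On its grid cell, [s] differs from the sampled value only just after a break point. *)
Lemma sample_error m t alpha n : subdivision m t -> (0 < n)%N ->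
  L2norm (wstep m t alpha \- embed (sample (wstep m t alpha) n)) <=
  2 * (\sum_(i < m) `|alpha i|) * Num.sqrt (m.+1%:R / n%:R).
Proof.
move=> H n0; set B := \sum_(i < m) `|alpha i|; set s := wstep m t alpha.
have n0' : 0 < n%:R :> R by rewrite ltr0n.
have B0 : 0 <= B by apply: sumr_ge0 => i _.
have hL : in_L2 (s \- embed (sample s n)).
  by apply: in_L2B; [exact: in_L2_wstep|exact: in_L2_embed].
apply: L2norm_le => //; first by rewrite !mulr_ge0.
rewrite exprMn sqr_sqrtr ?divr_ge0//.
(* [G] is the bound (2 B)^2 for the squared error times the number of windows of width 1/n, starting
   at a break point, that contain [x]. Each of the [m.+1] windows has measure at most 1/n. *)
pose G := fun x : R => (2 * B) ^+ 2 * \sum_(j < m.+1) \1_(`[t j, t j + n%:R^-1[) x.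
have m1 j : measurable_fun unitI (\1_(`[t j, t j + n%:R^-1[) : measurableTypeR R -> R).
  by apply: measurable_indic; exact: measurable_itv.
have i1 (j : nat) : mu.-integrable unitI (EFin \o (\1_(`[t j, t j + n%:R^-1[) : R -> R)).
  apply: measurable_bounded_integrable => //; first exact: unitI_lty.
  exists 1; split; first exact: num_real.
  move=> y y1 x _ /=; rewrite indicE; apply: le_trans (ltW y1).
  by case: (_ \in _); rewrite ?normr0 ?normr1.
have iS : mu.-integrable unitI (EFin \o (fun x : R => \sum_(j < m.+1) \1_(`[t j, t j + n%:R^-1[) x)).
  have := @integrable_sum _ _ _ mu _ measurable_unitI _ (index_enum _) predT _ (fun (j : 'I_m.+1) _ => i1 j).
  by apply: eq_integrable => // x _ /=; rewrite sumEFin.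
have iG : mu.-integrable unitI (EFin \o G).
  have := integrableZl measurable_unitI ((2 * B) ^+ 2) iS.
  by apply: eq_integrable => // x _ /=; rewrite /G EFinM.
apply: (@le_trans _ _ (\int[mu]_(x in unitI) G x)).
  apply: le_Rintegral => //; first exact: in_L2_integrable.
  move=> x xI /=.
  have Gx : 0 <= \sum_(j < m.+1) (\1_(`[t j, t j + n%:R^-1[) x : R) by apply: sumr_ge0 => j _.
  have [i iN ix] := cell_exists n0 xI.
  rewrite (embedE (i := Ordinal iN) _ ix) mxE /=.
  have xd := design_itv iN.
  have [j jm /andP[jx xj]] := subdivision_locate H (x := x) ltac:(by move: xI; rewrite /unitI /= in_itv).
  have ix1 : design n i <= x by move: ix; rewrite /cell /= in_itv/= => /andP[].
  have ix2 : x < design n i + n%:R^-1.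
    by rewrite -(design_diff i n0) addrC subrK; move: ix; rewrite /cell /= in_itv/= => /andP[].
  have [tjd|tjd] := leP (t j) (design n i).
    rewrite /s (wstepE alpha H jm (x := x)) ?jx// (wstepE alpha H jm (x := design n i)).
      by rewrite subrr expr0n /= /G mulr_ge0// sqr_ge0.
    by rewrite tjd (le_lt_trans ix1 xj).
  apply: (@le_trans _ _ ((2 * B) ^+ 2)).
    rewrite -real_normK ?num_real// lerXn2r ?nnegrE ?mulr_ge0//.
    apply: (le_trans (ler_normB _ _)).
    by rewrite mulr_natl mulr2n lerD// wstep_bound.
  rewrite /G -[leLHS]mulr1 ler_wpM2l ?sqr_ge0//.
  have jm' : (j < m.+1)%N by exact: leqW.
  rewrite (bigD1 (Ordinal jm'))//= indicE mem_set; last first.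
    by rewrite /= in_itv/= jx/=; apply: (lt_trans ix2); rewrite ltrD2r.
  by rewrite lerDl; apply: sumr_ge0 => k _.
rewrite RintegralZl// ler_wpM2l ?sqr_ge0//.
rewrite (@Rintegral_sum (fun j => \1_(`[t j, t j + n%:R^-1[)) m.+1 i1).
apply: (@le_trans _ _ (\sum_(j < m.+1) n%:R^-1)); last first.
  by rewrite le_eqVlt sumr_const card_ord -[X in X == _]mulr_natl eqxx.
apply: ler_sum => j _; rewrite /Rintegral integral_indic//.
have : (mu (`[t j, (t j + n%:R^-1)%R[%classic `&` unitI) <= (n%:R^-1)%:E)%E.
  have <- : mu `[t j, (t j + n%:R^-1)%R[%classic = (n%:R^-1)%:E.
    by rewrite lebesgue_measure_itv/= lte_fin ltrDl invr_gt0 n0' -EFinB addrAC subrr add0r.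
  apply: le_measure => [||x []//]; rewrite inE; last exact: measurable_itvco.
  by apply: measurableI => //; exact: measurable_itvco.
set z := (X in (X <= _)%E) => zle; change (fine z <= n%:R^-1).
have z0 : (0 <= z)%E by exact: measure_ge0.
by rewrite -lee_fin fineK// ge0_fin_numE// (le_lt_trans zle)// ltry.
Qed.

End Steps.

(** * Sampled step functions and reduced representations *)

Section StepReps.
Context {R : realType}.
Notation mu := (@lebesgue_measure R).
Implicit Types (t alpha : nat -> R) (f g : R -> R).

(** For [x >= 0] this is the number of grid points i/n strictly below [x], hence the first index at
    which a sampled step function has switched to the piece starting at [x]. *)
Definition gridpos (n : nat) (x : R) : nat := `|Num.ceil (x * n%:R)|%N.

Lemma gridposP n (x : R) i : (0 < n)%N -> 0 <= x -> (i < gridpos n x)%N = (design n i < x).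
Proof.
move=> n0 x0; have n0' : 0 < n%:R :> R by rewrite ltr0n.
rewrite /design ltr_pdivrMr// /gridpos.
have c0 : -1 < Num.ceil (x * n%:R).
  by rewrite ceil_gt_int (lt_le_trans (ltrN10 R))// mulr_ge0// ltW.
by rewrite -ltz_nat gez0_abs ?ceil_gt_int//; lia.
Qed.

Lemma gridpos_le n (x y : R) : (0 < n)%N -> 0 <= x <= y -> (gridpos n x <= gridpos n y)%N.
Proof.
move=> n0 /andP[x0 xy]; rewrite leqNgt; apply/negP.
rewrite gridposP// => h.
have := gridposP (gridpos n y) n0 (le_trans x0 xy).
by rewrite ltnn (lt_le_trans h xy).
Qed.

Lemma gridpos0 n : gridpos n (0 : R) = 0%N.
Proof. by rewrite /gridpos mul0r ceil0. Qed.

Lemma gridpos1 n : gridpos n (1 : R) = n.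
Proof. by rewrite /gridpos mul1r -[n%:R]/(n%:Z%:~R) intrKceil absz_nat. Qed.

Lemma sampleE m t alpha n i j : subdivision m t -> (i < n)%N -> (j < m)%N ->
  (gridpos n (t j) <= i < gridpos n (t j.+1))%N -> wstep m t alpha (design n i) = alpha j.
Proof.
move=> H iN jm /andP[a b]; have n0 : (0 < n)%N by lia.
have tj k : (k <= m)%N -> 0 <= t k.
  by move=> km; case: (H) => t0 _ _; rewrite -t0; apply: (subdivision_mono H); lia.
apply: (wstepE alpha H jm).
rewrite -gridposP ?b ?tj//.
by rewrite leNgt -gridposP ?tj//; lia.
Qed.

(** Double counting: a jump between i and i+1 forces [gridpos n (t j) = i.+1] for some interior
    break point, and each of the m - 1 interior break points accounts for at most one i. *)
Lemma njump_sample m t alpha n : subdivision m t -> (0 < n)%N ->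
  (njump (fun i => wstep m t alpha (design n i)) n <= m.-1)%N.
Proof.
move=> H n0; rewrite /njump.
have tj k : (k <= m)%N -> 0 <= t k.
  by move=> km; case: (H) => t0 _ _; rewrite -t0; apply: (subdivision_mono H); lia.
apply: (@leq_trans (\sum_(0 <= i < n.-1) \sum_(1 <= j < m) (gridpos n (t j) == i.+1))).
  rewrite big_nat_cond [leqRHS]big_nat_cond; apply: leq_sum => i /andP[iN _].
  case: eqP => //= ne.
  have iN' : (i.+1 < n)%N by lia.
  have [j jm /andP[jx xj]] := subdivision_locate H (design_itv iN').
  have p1 : (i.+1 < gridpos n (t j.+1))%N by rewrite gridposP// tj.
  have p2 : (gridpos n (t j) <= i.+1)%N by rewrite leqNgt gridposP ?(tj j (ltnW jm))// -leNgt.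
  have p3 : gridpos n (t j) = i.+1.
    apply/eqP; rewrite eqn_leq p2/= ltnNge; apply/negP => p3; apply: ne.
    by rewrite (sampleE alpha H (j := j)) ?(sampleE alpha H (j := j) (i := i.+1))//; lia.
  have j0 : (0 < j)%N.
    rewrite lt0n; apply/eqP => j0; move: p3; rewrite j0; case: (H) => -> _ _.
    by rewrite gridpos0.
  by rewrite (bigD1_seq j) ?iota_uniq ?mem_index_iota ?j0//= p3 eqxx.
rewrite exchange_big/=.
apply: (@leq_trans (\sum_(1 <= j < m) 1)); last by rewrite sum_nat_const_nat muln1; lia.
apply: leq_sum => j _.
have [[i iN]|no] := pselect (exists i, (i < n.-1)%N /\ gridpos n (t j) = i.+1).
  rewrite (bigD1_seq i) ?iota_uniq ?mem_index_iota//=; last by case: iN.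
  rewrite big1 ?addn0; first by case: eqP.
  by move=> k ki; case: iN => _ ->; case: eqP => // -[ik]; rewrite ik eqxx in ki.
rewrite big_nat_cond big1// => i /andP[iN _]; case: eqP => // e.
by exfalso; apply: no; exists i; split => //; lia.
Qed.

Lemma bump_lt i j : (j < i)%N -> bump i j = j.
Proof. by move=> ij; rewrite /bump leqNgt ij. Qed.

Lemma bump_ge i j : (i <= j)%N -> bump i j = j.+1.
Proof. by move=> ij; rewrite /bump ij. Qed.

(** Composition with [bump i] skips index [i], which removes the empty piece together with one of
    its two equal ends. *)
Lemma wstep_drop_empty m t alpha i : subdivision m.+1 t -> (i <= m)%N -> t i = t i.+1 ->
  subdivision m (t \o bump i) /\ wstep m.+1 t alpha = wstep m (t \o bump i) (alpha \o bump i).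
Proof.
move=> H im ti; have [t0 t1 tm] := H.
have shift j : t (bump i j).+1 = t (bump i j.+1).
  have [ij|ij] := ltnP j i; last by rewrite !bump_ge//; lia.
  rewrite (bump_lt ij); have [ij'|ij'] := ltnP j.+1 i; first by rewrite bump_lt.
  have e : j.+1 = i by lia.
  by rewrite e bump_ge.
split.
  split => /=.
  - by case: i im ti shift => [|i] im ti _; [rewrite bump_ge// -ti|rewrite bump_lt].
  - by rewrite bump_ge.
  - by move=> j jm /=; rewrite -shift; apply: tm; rewrite /bump; case: leqP; lia.
apply/funext => x; rewrite /wstep (bigD1_ord (Ordinal (im : (i < m.+1)%N)))//=.
rewrite {1}ti (_ : \1_(`[t i.+1, t i.+1[) x = 0) ?mulr0 ?add0r; last first.
  by rewrite indicE memNset//= in_itv/= => /andP[a b]; have := le_lt_trans a b; rewrite ltxx.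
by apply: eq_bigr => j _ /=; rewrite shift.
Qed.

(** Skipping index [i.+1] deletes the break point between two pieces of equal value; the two
    indicators add up to that of the united piece. *)
Lemma wstep_merge m t alpha i : subdivision m.+1 t -> (i.+1 <= m)%N -> alpha i = alpha i.+1 ->
  subdivision m (t \o bump i.+1) /\
  wstep m.+1 t alpha = wstep m (t \o bump i.+1) (alpha \o bump i.+1).
Proof.
move=> H im ai; have [t0 t1 tm] := H.
split.
  split => /=.
  - by rewrite bump_lt.
  - by rewrite bump_ge.
  - move=> j jm /=; apply: (subdivision_mono H); rewrite /bump.
    by case: (leqP i.+1 j); case: (leqP i.+1 j.+1); lia.
apply/funext => x; rewrite /wstep (bigD1_ord (Ordinal (im : (i.+1 < m.+1)%N)))//=.
have im' : (i < m)%N by lia.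
rewrite (bigD1 (Ordinal im'))//= [in RHS](bigD1 (Ordinal im'))//= !(bump_lt (ltnSn i)) (bump_ge (leqnn i.+1)) addrA; congr (_ + _).
  rewrite -ai -mulrDr addrC; congr (_ * _).
  have h1 := tm i ltac:(lia); have h2 := tm i.+1 ltac:(lia).
  rewrite !indicE !mem_setE /= !in_itv/=.
  case: (leP (t i) x) => a; case: (ltP x (t i.+1)) => b; case: (leP (t i.+1) x) => c;
    case: (ltP x (t i.+2)) => e /=; rewrite ?addr0 ?add0r//; exfalso; lra.
apply: eq_bigr => j; rewrite -val_eqE /= => ji.
have [ij|ij] := ltnP j i; first by rewrite !bump_lt//; lia.
by rewrite !bump_ge//; lia.
Qed.

(* A representation with the fewest pieces has no empty and no mergeable pieces. *)
Lemma wstep_reduce m t alpha : subdivision m t -> exists m' t' alpha',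
  [/\ (m' <= m)%N, subdivision m' t', wstep m t alpha = wstep m' t' alpha',
      (forall i, (i < m')%N -> t' i < t' i.+1) &
      (forall i, (i.+1 < m')%N -> alpha' i != alpha' i.+1)].
Proof.
elim: m t alpha => [t alpha H|m IH t alpha H].
  by exists 0%N, t, alpha; split.
have [[i [im ti]]|nA] := pselect (exists i, (i <= m)%N /\ t i = t i.+1).
  have [H' ->] := wstep_drop_empty alpha H im ti.
  have [m' [t' [a' [mm ? ? ? ?]]]] := IH _ (alpha \o bump i) H'.
  by exists m', t', a'; split => //; lia.
have [[i [im ai]]|nB] := pselect (exists i, (i.+1 <= m)%N /\ alpha i = alpha i.+1).
  have [H' ->] := wstep_merge H im ai.
  have [m' [t' [a' [mm ? ? ? ?]]]] := IH _ (alpha \o bump i.+1) H'.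
  by exists m', t', a'; split => //; lia.
exists m.+1, t, alpha; split => //.
  move=> i im; rewrite lt_neqAle; case: (H) => _ _ ->//; rewrite andbT.
  by apply/eqP => ti; apply: nA; exists i; split.
by move=> i im; apply/eqP => ai; apply: nB; exists i; split.
Qed.

End StepReps.

(** * Jump sets of step functions *)

Section JumpSets.
Context {R : realType}.
Notation mu := (@lebesgue_measure R).
Implicit Types (t alpha : nat -> R) (f g : R -> R).

Lemma step_functionP (s : R -> R) : step_function s <->
  exists m t alpha, [/\ subdivision m t, (forall i, (i < m)%N -> t i < t i.+1) & s = wstep m t alpha].
Proof.
split.
  move=> [m [t [alpha [t0 t1 tm ->]]]]; exists m, t, alpha; split => //.
  by split => // i /tm/ltW.
by move=> [m [t [alpha [[t0 t1 _] tm ->]]]]; exists m, t, alpha.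
Qed.

Lemma step_function_wstep m t alpha : subdivision m t -> step_function (wstep m t alpha).
Proof.
move=> H; have [m' [t' [a' [_ H' -> ? _]]]] := wstep_reduce alpha H.
by apply/step_functionP; exists m', t', a'.
Qed.

(** To the right of [x], up to the nearer of the two next break points, both functions are constant.
    A difference at [x] would persist on an interval of positive length. *)
Lemma wstep_ae_eq m t alpha m' t' alpha' : subdivision m t -> subdivision m' t' ->
  L2eq (wstep m t alpha) (wstep m' t' alpha') ->
  forall x, 0 <= x < 1 -> wstep m t alpha x = wstep m' t' alpha' x.
Proof.
move=> H H' [N [mN N0 sub]] x x01; apply: contrapT => ne.
have [i im /andP[ix xi]] := subdivision_locate H x01.
have [j jm /andP[jx xj]] := subdivision_locate H' x01.
pose y := Num.min (t i.+1) (t' j.+1).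
have xy : x < y by rewrite lt_min xi xj.
have t1 : t i.+1 <= 1 by case: (H) => _ <- _; apply: (subdivision_mono H); lia.
have inN : `[x, y[%classic `<=` N.
  move=> z /=; rewrite in_itv/= lt_min => /andP[xz /andP[zi zj]]; apply: sub => /= h.
  apply: ne; rewrite (wstepE alpha H im (x := x)) ?ix//.
  rewrite (wstepE alpha' H' jm (x := x)) ?jx//.
  rewrite -(wstepE alpha H im (x := z)) ?zi ?(le_trans ix)//.
  rewrite -(wstepE alpha' H' jm (x := z)) ?zj ?(le_trans jx)//.
  apply: h; rewrite /unitI /= in_itv/=; case/andP: x01 => x0 x1.
  by rewrite (le_trans x0 xz) (lt_le_trans zi t1).
have : (mu `[x, y[%classic <= mu N)%E.
  by apply: le_measure; rewrite ?inE//; exact: measurable_itvco.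
have -> : mu N = 0%E by exact: N0.
by rewrite lebesgue_measure_itv/= lte_fin xy -EFinB lee_fin subr_le0 leNgt xy.
Qed.

(** The representative picked by [get] is unknown, but it is a step function in the same class, so
    it agrees on [0,1) with any given one and may be put in reduced form. This makes [jump_set]
    computable. *)
Lemma step_repr_wstep m t alpha g : subdivision m t -> L2eq (wstep m t alpha) g ->
  exists m' t' alpha', [/\ subdivision m' t', step_repr g = wstep m' t' alpha',
   (forall i, (i < m')%N -> t' i < t' i.+1),
   (forall i, (i.+1 < m')%N -> alpha' i != alpha' i.+1) &
   forall x, 0 <= x < 1 -> wstep m t alpha x = wstep m' t' alpha' x].
Proof.
move=> H sg.
have [] : [set s | step_function s /\ L2eq s g] (step_repr g).
  by apply: getPex; exists (wstep m t alpha); split => //; exact: step_function_wstep.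
move=> /step_functionP[m1 [t1 [a1 [H1 _ E1]]]]; rewrite E1 => s1g.
have [m' [t' [a' [_ H' E' lt' ne']]]] := wstep_reduce a1 H1.
exists m', t', a'; split => // x x01; rewrite -E'.
apply: wstep_ae_eq => //.
apply: (negligibleS _ (negligibleU sg s1g)) => z nz.
apply: contrapT => /not_orP[/contrapT h /contrapT h1]; apply: nz => zI.
by rewrite (h zI) (h1 zI).
Qed.

Lemma lim_left_cst f (x a c : R) : a < x ->
  (forall y, a <= y < x -> f y = c) -> lim (f y @[y --> x^'-]) = c.
Proof.
move=> ax H; apply: cvg_lim => //; apply/cvgrPdist_le => e e0; near=> y.
have -> : f y = c; last by rewrite subrr normr0 ltW.
apply: H; apply/andP; split.
  by near: y; exact: nbhs_left_ge.
by near: y; exact: nbhs_left_lt.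
Unshelve. all: by end_near. Qed.

Lemma lim_right_cst f (x b c : R) : x < b ->
  (forall y, x <= y < b -> f y = c) -> lim (f y @[y --> x^'+]) = c.
Proof.
move=> xb H; apply: cvg_lim => //; apply/cvgrPdist_le => e e0; near=> y.
have -> : f y = c; last by rewrite subrr normr0 ltW.
apply: H; apply/andP; split.
  by apply: ltW; near: y; exact: nbhs_right_gt.
by near: y; exact: nbhs_right_lt.
Unshelve. all: by end_near. Qed.

Lemma jump_set_sub m t alpha g : subdivision m t -> L2eq (wstep m t alpha) g ->
  forall x, jump_set g x -> exists2 j, (0 < j < m)%N & x = t j.
Proof.
move=> H sg x.
have [m' [t' [a' [H' E _ _ eq']]]] := step_repr_wstep H sg.
rewrite /jump_set /= E => -[/andP[x0 x1]] /eqP ne; apply: contrapT => nj; apply: ne.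
have [j jm /andP[jx xj]] := subdivision_locate H (x := x) ltac:(by rewrite (ltW x0) x1).
have tjx : t j < x.
  rewrite lt_neqAle jx andbT; apply/eqP => e; apply: nj; exists j => //.
  rewrite jm andbT lt0n; apply/eqP => j0; move: x0; rewrite -e j0.
  by case: (H) => -> _ _; rewrite ltxx.
have t0 : 0 <= t j by case: (H) => <- _ _; apply: (subdivision_mono H); lia.
have t1 : t j.+1 <= 1 by case: (H) => _ <- _; apply: (subdivision_mono H); lia.
have c y : t j <= y < t j.+1 -> wstep m' t' a' y = alpha j.
  move=> yj; rewrite -eq' ?(wstepE alpha H jm yj)//.
  by case/andP: yj => a b; rewrite (le_trans t0 a) (lt_le_trans b t1).
rewrite (@lim_left_cst _ _ (t j) (alpha j))//; last first.
  by move=> y /andP[a b]; apply: c; rewrite a (lt_trans b xj).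
rewrite (@lim_right_cst _ _ (t j.+1) (alpha j))//.
by move=> y /andP[a b]; apply: c; rewrite b (le_trans jx a).
Qed.

Lemma counting_jump_set_le m t alpha g : subdivision m t -> L2eq (wstep m t alpha) g ->
  (counting (jump_set g) <= m.-1%:R%:E :> \bar R)%E.
Proof.
move=> H sg.
have sub : jump_set g `<=` [set` map t (iota 1 m.-1)].
  move=> x /(jump_set_sub H sg)[j jm ->] /=; apply/mapP; exists j => //.
  by rewrite mem_iota; lia.
have fin : finite_set (jump_set g).
  by apply: sub_finite_set sub _; exact: finite_seq.
rewrite /counting asboolT// lee_fin ler_nat.
apply: (@leq_trans (size (map t (iota 1 m.-1)))); last by rewrite size_map size_iota.
apply: uniq_leq_size; first exact: finmap.fset_uniq.
by move=> x; rewrite in_fset_set// inE => /sub.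
Qed.

(** In the reduced form of the chosen representative neighbouring values differ, so each of the m -
    1 interior break points is a genuine jump. This lower bound serves the minimizer, while
    [counting_jump_set_le] serves competitors. *)
Lemma counting_jump_set_ge g : in_step_space g ->
  exists m t alpha, [/\ subdivision m t, L2eq (wstep m t alpha) g &
  (m.-1%:R%:E <= counting (jump_set g) :> \bar R)%E].
Proof.
move=> [s /step_functionP[m0 [t0 [a0 [H0 _ ->]]]] sg].
have [m [t [alpha [H E lt ne eq0]]]] := step_repr_wstep H0 sg.
exists m, t, alpha; split => //.
  case: sg => N [mN N0 sub]; exists N; split => // x /= nx; apply: sub => /= h; apply: nx => xI.
  by rewrite -eq0 ?h//; move: xI; rewrite /unitI /= in_itv.
have jt j : (0 < j < m)%N -> jump_set g (t j).
  move=> jm; rewrite /jump_set /= E.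
  have [tt0 tt1 _] := H.
  have a : t 0%N <= t j.-1 by apply: (subdivision_mono H); lia.
  have b : t j.+1 <= t m by apply: (subdivision_mono H); lia.
  have c : t j.-1 < t j by have := lt j.-1 ltac:(lia); rewrite prednK//; lia.
  have e : t j < t j.+1 by apply: lt; lia.
  split; first by rewrite -tt0 -tt1 (le_lt_trans a c) (lt_le_trans e b).
  rewrite (@lim_left_cst _ _ (t j.-1) (alpha j.-1))//; last first.
    by move=> y yj; apply: (wstepE alpha H); [lia|rewrite prednK//; lia].
  rewrite (@lim_right_cst _ _ (t j.+1) (alpha j))//; last first.
    by move=> y yj; apply: (wstepE alpha H) => //; lia.
  by have := ne j.-1 ltac:(lia); rewrite prednK//; lia.
rewrite /counting; case: asboolP => fin; last by rewrite leey.
rewrite lee_fin ler_nat.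
apply: (@leq_trans (size (map t (iota 1 m.-1)))); first by rewrite size_map size_iota.
apply: uniq_leq_size.
  rewrite map_inj_in_uniq ?iota_uniq// => i j; rewrite !mem_iota => im jm tij.
  have strict k l : (k < l <= m)%N -> t k < t l.
    move=> kl; apply: lt_le_trans (lt k ltac:(lia)) _; apply: (subdivision_mono H); lia.
  case: (ltngtP i j) => // ij.
    by have := strict i j ltac:(lia); rewrite tij ltxx.
  by have := strict j i ltac:(lia); rewrite tij ltxx.
move=> x /mapP[j jm ->]; rewrite in_fset_set// inE; apply: jt.
by move: jm; rewrite mem_iota; lia.
Qed.

End JumpSets.

(** * Density of step functions in L2 *)

Section Density.
Context {R : realType}.
Notation mu := (@lebesgue_measure R).
Implicit Types (f g h : R -> R).

Definition clip (c y : R) : R := Num.max (- c) (Num.min c y).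

Lemma clip_id c y : `|y| <= c -> clip c y = y.
Proof.
by rewrite ler_norml => /andP[a b]; rewrite /clip (min_idPr b) (max_idPr a).
Qed.

Lemma clip_bound c y : 0 <= c -> `|clip c y| <= c.
Proof.
move=> c0; rewrite /clip ler_norml; apply/andP; split; first by rewrite le_max lexx.
by rewrite ge_max ge_min lexx andbT; lra.
Qed.

Lemma clip_lip c y z : `|clip c y - clip c z| <= `|y - z|.
Proof.
have h1 := ler_norm (y - z); have h2 := ler_norm (z - y).
rewrite (distrC z) in h2; have h3 := normr_ge0 (y - z).
rewrite /clip !maxElt !minElt.
case: (ltP c y) => ?; case: (ltP c z) => ?; rewrite ler_norml;
  apply/andP; split; case: ltP => ?; case: ltP => ?; lra.
Qed.

Lemma clip_dist c y : 0 <= c -> `|clip c y - y| <= `|y|.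
Proof.
move=> c0; have h1 := ler_norm y; have h2 := ler_norm (- y).
rewrite normrN in h2; rewrite /clip !maxElt !minElt.
case: (ltP c y) => ?; rewrite ler_norml;
  apply/andP; split; case: ltP => ?; lra.
Qed.

Lemma continuous_clip c : continuous (clip c).
Proof.
move=> x; apply/cvgrPdist_le => e e0; near=> y.
apply: le_trans (clip_lip _ _ _) _; near: y.
exact: cvgr_dist_le.
Unshelve. all: by end_near. Qed.

Lemma measurable_clip c D : measurable_fun D (clip c : measurableTypeR R -> R).
Proof.
apply: measurable_funS (@measurableT _ _) _ _ => //.
exact: (continuous_measurable_fun (@continuous_clip c)).
Qed.

(** Dominated convergence for the squared error. The domination concerns [F n - f], and adding [f]
    back shows that [F n] itself is in L2. *)
Lemma L2_dominated (F : nat -> R -> R) f (g : R -> R) :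
  (forall n, measurable_fun unitI (F n : measurableTypeR R -> R)) -> in_L2 f -> in_L2 g ->
  (forall x, unitI x -> F n x @[n --> \oo] --> f x) ->
  (forall n x, unitI x -> `|F n x - f x| <= `|g x|) ->
  forall e : R, 0 < e -> exists n, [/\ (0 < n)%N, in_L2 (F n) & L2norm (f \- F n) <= e].
Proof.
move=> mF hf hg Ff Fg e e0.
have hF n : in_L2 (F n).
  have hFf : in_L2 (F n \- f).
    apply/in_L2P; split.
      exact: (measurable_funB (mF n) (in_L2_measurable hf)).
    apply: (le_integrable measurable_unitI _ _ (in_L2_integrable hg)).
      apply/measurable_EFinP; apply: measurable_funX.
      exact: (measurable_funB (mF n) (in_L2_measurable hf)).
    by move=> x xI /=; rewrite lee_fin !normrX lerXn2r ?nnegrE// Fg.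
  have -> : F n = (F n \- f) \+ f by apply/funext => x /=; rewrite subrK.
  exact: in_L2D.
pose G n := EFin \o (fun x => (f x - F n x) ^+ 2).
have mG n : measurable_fun unitI (G n).
  apply/measurable_EFinP; apply: measurable_funX.
  exact: (measurable_funB (in_L2_measurable hf) (mF n)).
have cG : {ae mu, forall x, unitI x -> G^~ x @ \oo --> (cst 0%E : R -> \bar R) x}.
  apply: aeW => x xI; rewrite /G /=.
  have h : (f x - F n x) ^+ 2 @[n --> \oo] --> (0 : R).
    have -> : (0 : R) = (f x - f x) * (f x - f x) by rewrite subrr mul0r.
    under eq_fun do rewrite expr2.
    by apply: cvgM; apply: cvgB; [exact: cvg_cst|exact: Ff|exact: cvg_cst|exact: Ff].
  by apply: cvg_comp h _.
have dG : {ae mu, forall x n, unitI x -> (`|G n x| <= (g x ^+ 2)%:E)%E}.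
  apply: aeW => x n xI; rewrite /G /= lee_fin ger0_norm ?sqr_ge0//.
  by rewrite -real_normK ?num_real// distrC -[leRHS]real_normK ?num_real// lerXn2r ?nnegrE// Fg.
have [_ _ lim0] := dominated_convergence measurable_unitI mG (measurable_cst _) cG (in_L2_integrable hg) dG.
rewrite integral0 in lim0.
have e20 : 0 < e ^+ 2 by rewrite exprn_gt0.
move/fine_cvgP : lim0 => [_ /cvgrPdist_le/(_ _ e20)] [N _ HN].
(* The successor makes the witness positive, so that it can serve as a grid size. *)
exists N.+1; split => //.
apply: L2norm_le; [exact: in_L2B|exact: ltW|].
have /= := HN N.+1 (leqnSn N); rewrite sub0r normrN; apply: le_trans.
exact: ler_norm.
Qed.

Lemma wstep_embed n (u : 'rV[R]_n) :
  embed u = wstep n (design n) (fun i => oapp (u ord0) 0 (insub i)).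
Proof. by apply/funext => x; apply: eq_bigr => i _; rewrite valK. Qed.

Lemma subdivision_design n : (0 < n)%N -> subdivision n (design n : nat -> R).
Proof.
move=> n0; split; rewrite /design ?mul0r ?divff ?pnatr_eq0 -?lt0n//.
by move=> i _; rewrite ler_wpM2r ?invr_ge0// ler_nat.
Qed.

(** Three approximations cost e/3 each: truncation of [f] at level n, a continuous function, and
    sampling of the latter on a fine grid. The continuous approximation is in L1; clipping it at
    level n gives |F - h|^2 <= 2 n |F - g|, which converts L1 accuracy (e/3)^2 / (2 n) into L2
    accuracy e/3. *)
Lemma step_dense f : in_L2 f -> forall e : R, 0 < e ->
  exists m t alpha, subdivision m t /\ L2norm (f \- wstep m t alpha) <= e.
Proof.
move=> hf e e0.
have e30 : 0 < e / 3 by rewrite divr_gt0.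
have mf := in_L2_measurable hf.
have [n [n0 hfn fn]] : exists n : nat, [/\ (0 < n)%N, in_L2 (clip n%:R \o f) &
    L2norm (f \- (clip n%:R \o f)) <= e / 3].
  apply: (@L2_dominated (fun n => clip n%:R \o f) f f) => //.
  - by move=> n; apply: measurableT_comp => //; exact: measurable_clip.
  - move=> x _; apply/cvgrPdist_le => d d0; near=> n.
    have fxn : `|f x| <= n%:R.
      near: n; exists (Num.truncn `|f x|).+1 => // k /= kn.
      by apply: ltW; apply: lt_le_trans (truncnS_gt _) _; rewrite ler_nat.
    by rewrite /= clip_id// subrr normr0 ltW.
  - move=> n x _ /=; exact: clip_dist.
have c0 : 0 <= n%:R :> R by [].
set F := clip n%:R \o f in fn hfn.
have iF := in_L2_integrable1 hfn.
have [g [cg ig lg]] := approximation_continuous_integrable measurable_unitI unitI_lty iF.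
have d0 : 0 < (e / 3) ^+ 2 / (2 * n%:R) by rewrite divr_gt0 ?exprn_gt0// mulr_gt0// ltr0n.
move/fine_cvgP : lg => [lgf /cvgrPdist_le/(_ _ d0) lg].
near \oo => k.
pose h := clip n%:R \o g k.
have ch : continuous h.
  by move=> x; apply: continuous_comp; [exact: cg|exact: continuous_clip].
have mh : measurable_fun setT (h : measurableTypeR R -> R) by exact: continuous_measurable_fun.
have hh : in_L2 h.
  apply: (@in_L2_bounded _ _ n%:R); first exact: measurable_funS mh.
  by move=> x _; exact: clip_bound.
have Fh : L2norm (F \- h) <= e / 3.
  apply: L2norm_le; [exact: in_L2B|exact: ltW|].
  have iFg : mu.-integrable unitI (EFin \o (fun x => `|F x - g k x|)).
    exact: (integrable_norm (integrableB measurable_unitI iF (ig k))).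
  apply: (@le_trans _ _ (\int[mu]_(x in unitI) (2 * n%:R * `|F x - g k x|))).
    apply: le_Rintegral => //.
    - by apply: (in_L2_integrable); exact: in_L2B.
    - have := integrableZl measurable_unitI (2 * n%:R) iFg.
      by apply: eq_integrable => // x _ /=; rewrite EFinM.
    move=> x xI; rewrite -real_normK ?num_real// expr2 ler_pM//.
      apply: (le_trans (ler_normB _ _)); rewrite mulr_natl mulr2n lerD//; exact: clip_bound.
    have Fx : clip n%:R (F x) = F x by rewrite clip_id//; exact: clip_bound.
    by have := clip_lip n%:R (F x) (g k x); rewrite Fx.
  rewrite RintegralZl//.
  rewrite -ler_pdivlMl ?mulr_gt0 ?ltr0n// mulrC.
  near: k; apply: filterS lg => k; rewrite sub0r normrN; apply: le_trans.
  exact: ler_norm.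
have [N [N0 hN hNh]] : exists N, [/\ (0 < N)%N, in_L2 (embed (sample h N)) &
    L2norm (h \- embed (sample h N)) <= e / 3].
  have cc : in_L2 (fun=> 2 * n%:R : R).
    apply: (@in_L2_bounded _ _ (2 * n%:R)); first exact: measurable_cst.
    by move=> x _; rewrite ger0_norm// mulr_ge0.
  apply: (@L2_dominated (fun N => embed (sample h N)) h (fun=> 2 * n%:R)) => //.
  - by move=> N; exact: measurable_embed.
  - move=> x xI; apply/cvgrPdist_le => d dd0.
    have /cvgrPdist_le/(_ d dd0) := ch x.
    move=> [r /= r0 Hr].
    near=> N.
    have N0 : (0 < N)%N by near: N; exists 1%N.
    have [i iN ix] := cell_exists N0 xI.
    rewrite (embedE (i := Ordinal iN) _ ix) mxE /=; apply: Hr => /=.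
    have ix1 : design N i <= x by move: ix; rewrite /cell /= in_itv/= => /andP[].
    have ix2 : x < design N i + N%:R^-1.
      by rewrite -(design_diff i N0) addrC subrK; move: ix; rewrite /cell /= in_itv/= => /andP[].
    rewrite ger0_norm ?subr_ge0//.
    have : N%:R^-1 <= r.
      near: N; exists (Num.truncn r^-1).+1 => // k' /= kN.
      rewrite -[leRHS]invrK lef_pV2 ?posrE ?invr_gt0 ?ltr0n//; last exact: (leq_trans _ kN).
      by apply: ltW; apply: lt_le_trans (truncnS_gt _) _; rewrite ler_nat.
    move: ix2; lra.
  - move=> N x xI; have [->|N0] := posnP N.
      rewrite /embed big_ord0 sub0r normrN [leRHS]ger0_norm ?mulr_ge0//.
      by apply: le_trans (clip_bound _ _) _ => //; rewrite mulr_natl mulr2n lerDl.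
    have [i iN ix] := cell_exists N0 xI.
    rewrite (embedE (i := Ordinal iN) _ ix) mxE [leRHS]ger0_norm ?mulr_ge0//.
    by apply: (le_trans (ler_normB _ _)); rewrite mulr_natl mulr2n lerD//; exact: clip_bound.
exists N, (design N), (fun i => oapp (sample h N ord0) 0 (insub i)); split.
  exact: subdivision_design.
rewrite -wstep_embed.
have h1 := L2norm_tri hf hfn hN; have h2 := L2norm_tri hfn hh hN.
lra.
Unshelve. all: by end_near. Qed.
End Density.

(** * Oracle inequality for the minimizer *)

Section Basic.
Context {R : realType}.
Implicit Types (n : nat).

Definition vec n (u : 'rV[R]_n) : nat -> R := ext (u ord0).

Lemma vec_ord n (u : 'rV[R]_n) (i : 'I_n) : vec u i = u ord0 i.
Proof. exact: ext_ord. Qed.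

Lemma eq_njump n (u v : nat -> R) : (forall i, (i < n)%N -> u i = v i) -> njump u n = njump v n.
Proof.
move=> uv; rewrite /njump big_nat_cond [RHS]big_nat_cond.
by apply: eq_bigr => i /andP[iN _]; rewrite !uv//; lia.
Qed.

Lemma num_jumpsE n (u : 'rV[R]_n) : num_jumps u = njump (vec u) n.
Proof.
rewrite /num_jumps /njump.
rewrite (@eq_card _ _ [pred i : 'I_n | [exists j : 'I_n,
      (j == i.+1 :> nat) && (u ord0 i != u ord0 j)]]); last first.
  by move=> i; rewrite [LHS]asboolb.
rewrite -sum1_card big_mkcond /=.
case: n u => [|n] u; first by rewrite big_ord0 big_geq.
rewrite big_ord_recr /= [X in (_ + X)%N](_ : _ = 0%N) ?addn0; last first.
  case: ifP => //; rewrite inE => /existsP[j /andP[/eqP jn _]].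
  by have := ltn_ord j; rewrite jn ltnn.
rewrite big_mkord; apply: eq_bigr => i _; rewrite inE.
have iE : vec u i = u ord0 (widen_ord (leqnSn n) i) by rewrite -vec_ord.
have jE : vec u i.+1 = u ord0 (lift ord0 i) by rewrite -vec_ord.
rewrite iE jE; case: eqP => [e|ne].
  case: existsP => // -[j /andP[/eqP ji /eqP]]; rewrite e; case.
  by congr (u _ _); apply/val_inj; rewrite /= ji.
case: existsP => // h; exfalso; apply: h.
by exists (lift ord0 i); rewrite /= eqxx/=; apply/eqP.
Qed.

Lemma pottsE n (gamma : R) (u y : 'rV[R]_n) :
  potts gamma u y = n%:R^-1 * \sum_(0 <= i < n) (vec u i - vec y i) ^+ 2
    + gamma * (njump (vec u) n)%:R.
Proof.
rewrite /potts num_jumpsE big_mkord; congr (_ * _ + _).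
by apply: eq_bigr => i _; rewrite !vec_ord.
Qed.

Lemma vec_row n (V : nat -> R) i : (i < n)%N -> vec (\row_(i < n) V i) i = V i.
Proof. by move=> iN; rewrite -[i]/(val (Ordinal iN)) vec_ord mxE. Qed.

Lemma eq_sumn n (F G : nat -> R) : (forall i, (i < n)%N -> F i = G i) ->
  \sum_(0 <= i < n) F i = \sum_(0 <= i < n) G i.
Proof.
move=> FG; rewrite big_nat_cond [RHS]big_nat_cond.
by apply: eq_bigr => i /andP[iN _]; rewrite FG.
Qed.

Definition sqd n (u v : nat -> R) : R := \sum_(0 <= i < n) (u i - v i) ^+ 2.

Lemma sqdC n u v : sqd n u v = sqd n v u.
Proof. by apply: eq_bigr => i _; rewrite -sqrrN opprB. Qed.

Lemma sqd_tri n (u v w : nat -> R) (c : R) : 0 < c ->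
  sqd n u w <= (1 + c) * sqd n u v + (1 + c^-1) * sqd n v w.
Proof.
move=> c0; rewrite /sqd !mulr_sumr -big_split /=; apply: ler_sum => i _.
set a := u i - v i; set b := v i - w i.
have -> : u i - w i = a + b by rewrite /a /b; ring.
have h : 0 <= (c * a - b) ^+ 2 / c by rewrite divr_ge0 ?sqr_ge0// ltW.
suff -> : (1 + c) * a ^+ 2 + (1 + c^-1) * b ^+ 2 = (a + b) ^+ 2 + (c * a - b) ^+ 2 / c by rewrite lerDl.
by field; rewrite gt_eqF.
Qed.

(** Compare [u] with [V], multiply by n and expand the squares: everything that involves neither
    vector cancels, and of the noise only the inner product with [u - V] is left. *)
Lemma argmin_basic n (gamma : R) (u : 'rV[R]_n) (fb x V : nat -> R) : (0 < n)%N ->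
  potts_argmin gamma (\row_(i < n) (fb i + x i)) u ->
  sqd n (vec u) fb + n%:R * gamma * (njump (vec u) n)%:R <=
  sqd n V fb + n%:R * gamma * (njump V n)%:R +
  2 * \sum_(0 <= i < n) (vec u i - V i) * x i.
Proof.
move=> n0 /(_ (\row_(i < n) V i)); rewrite !pottsE.
have n0' : 0 < n%:R :> R by rewrite ltr0n.
rewrite (@eq_njump n (vec (\row_i V i)) V); last by move=> i iN; exact: vec_row.
set Y := vec (\row_(i < n) (fb i + x i)).
have YE i : (i < n)%N -> Y i = fb i + x i.
  by move=> iN; rewrite /Y (@vec_row n (fun i => fb i + x i)).
rewrite -(ler_pM2l n0') !mulrDr !mulrA divff ?gt_eqF// !mul1r.
rewrite (@eq_sumn n _ (fun i => ((vec u i - fb i) ^+ 2 - 2 * (vec u i * x i)) + (2 * (fb i * x i) + x i ^+ 2))); last first.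
  by move=> i iN; rewrite YE//; ring.
rewrite [X in _ <= X + _](@eq_sumn n _ (fun i => ((V i - fb i) ^+ 2 - 2 * (V i * x i)) + (2 * (fb i * x i) + x i ^+ 2))); last first.
  by move=> i iN; rewrite YE// vec_row//; ring.
rewrite !big_split /= !sumrN.
rewrite [X in _ -> _ <= _ + 2 * X](@eq_sumn n _ (fun i => vec u i * x i - V i * x i)); last first.
  by move=> i iN; ring.
rewrite sumrB -!mulr_sumr /sqd.
lra.
Qed.

Lemma noise_le_ge0 n x (M : R) : (0 < n)%N -> noise_le x n M -> 0 <= M.
Proof.
move=> n0 /(_ 0%N 1%N); rewrite subn0 mul1r => h.
by apply: le_trans (sqr_ge0 (isum x 0 1)) (h _); rewrite n0.
Qed.

(** The parameter [l] remains free: a fixed value gives the oracle inequality, while [l] tending to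
    0 after n gives the sharp comparison of limits. *)
Lemma argmin_energy n (gamma M : R) (u : 'rV[R]_n) (fb x V : nat -> R) (l : R) : (0 < n)%N -> 0 < l ->
  potts_argmin gamma (\row_(i < n) (fb i + x i)) u -> noise_le x n M ->
  sqd n (vec u) fb + n%:R * gamma * (njump (vec u) n)%:R <=
  sqd n V fb + n%:R * gamma * (njump V n)%:R +
  (l * sqd n (vec u) V + (njump (vec u) n + njump V n).+1%:R * (M / l)).
Proof.
move=> n0 l0 hu hx; apply: le_trans (argmin_basic V n0 hu) _; rewrite lerD2l.
apply: (le_trans (@energy _ x n M l (fun i => vec u i - V i) n0 l0 hx)).
rewrite lerD2l ler_wpM2r//.
  by rewrite divr_ge0 ?(noise_le_ge0 n0 hx)// ltW.
by rewrite ler_nat ltnS njumpB.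
Qed.

(** Take l = 1/4. Since |u - V|^2 <= 2 |u - fb|^2 + 2 |V - fb|^2, the energy term costs half of each
    squared distance, which leaves the factors 1/2 and 3/2, and M / l = 4 M. *)
Lemma argmin_oracle n (gamma M : R) (u : 'rV[R]_n) (fb x V : nat -> R) : (0 < n)%N ->
  potts_argmin gamma (\row_(i < n) (fb i + x i)) u -> noise_le x n M ->
  sqd n (vec u) fb / 2 + n%:R * gamma * (njump (vec u) n)%:R <=
  3 / 2 * sqd n V fb + n%:R * gamma * (njump V n)%:R +
  4 * (njump (vec u) n + njump V n).+1%:R * M.
Proof.
move=> n0 hu hx.
have q0 : 0 < 4^-1 :> R by rewrite invr_gt0.
have := argmin_energy V n0 q0 hu hx; rewrite invrK.
have := @sqd_tri n (vec u) fb V 1 ltr01; rewrite invr1 (sqdC n fb V).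
lra.
Qed.

End Basic.

Section Link.
Context {R : realType}.
Variable f : R -> R.
Hypothesis hf : in_L2 f.

Definition fbar n : 'rV[R]_n := \row_(i < n) cell_mean f n i.

Lemma L2norm_vec n (u v : 'rV[R]_n) : (0 < n)%N ->
  L2norm (embed u \- embed v) ^+ 2 = sqd n (vec u) (vec v) / n%:R.
Proof.
move=> n0; rewrite L2norm_embed// mulrC /sqd big_mkord; congr (_ / _).
by apply: eq_bigr => i _; rewrite !vec_ord.
Qed.

Lemma fbar_contraction n (v : 'rV[R]_n) : (0 < n)%N ->
  L2norm (embed (fbar n) \- embed v) <= L2norm (f \- embed v).
Proof.
move=> n0; rewrite -ler_sqr ?nnegrE ?L2norm_ge0// L2norm_embed//.
apply: le_trans (cell_mean_contraction v n0 hf).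
by rewrite le_eqVlt; apply/orP; left; apply/eqP; congr (_ * _); apply: eq_bigr => i _; rewrite mxE.
Qed.

(** The vector [v] is fixed by the grid projection, which is a contraction, so f is within 2 |f - v|
    of its own projection. *)
Lemma fit_dist n (u v : 'rV[R]_n) : (0 < n)%N ->
  L2norm (embed u \- f) <= L2norm (embed u \- embed (fbar n)) + 2 * L2norm (f \- embed v).
Proof.
move=> n0; have hv := fbar_contraction v n0.
have h1 := L2norm_tri (in_L2_embed u) (in_L2_embed (fbar n)) hf.
have h2 := L2norm_tri (in_L2_embed (fbar n)) (in_L2_embed v) hf.
rewrite (L2norm_distC (embed v)) in h2.
lra.
Qed.

Lemma observationE n (x : 'I_n -> R) : 
  \row_(i < n) (cell_mean f n i + x i) = \row_(i < n) (vec (fbar n) i + ext x i).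
Proof. by apply/rowP => i; rewrite !mxE vec_ord mxE ext_ord. Qed.

Lemma fit_oracle n (gamma M : R) (u v : 'rV[R]_n) (x : 'I_n -> R) : (0 < n)%N ->
  potts_argmin gamma (\row_(i < n) (cell_mean f n i + x i)) u -> noise_le (ext x) n M ->
  L2norm (embed u \- embed (fbar n)) ^+ 2 / 2 + gamma * (njump (vec u) n)%:R <=
  3 / 2 * L2norm (f \- embed v) ^+ 2 + gamma * (njump (vec v) n)%:R +
  4 * (njump (vec u) n + njump (vec v) n).+1%:R * (M / n%:R).
Proof.
move=> n0; rewrite observationE => hu hx.
have n0' : 0 < n%:R :> R by rewrite ltr0n.
have h := argmin_oracle (vec v) n0 hu hx.
have hv : sqd n (vec v) (vec (fbar n)) / n%:R <= L2norm (f \- embed v) ^+ 2.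
  by rewrite -L2norm_vec// L2norm_distC lerXn2r ?nnegrE ?L2norm_ge0//; exact: fbar_contraction.
rewrite L2norm_vec//.
apply: (@le_trans _ _ (3 / 2 * (sqd n (vec v) (vec (fbar n)) / n%:R) + gamma * (njump (vec v) n)%:R +
  4 * (njump (vec u) n + njump (vec v) n).+1%:R * (M / n%:R))); last by lra.
rewrite -(ler_pM2l n0').
suff <- : sqd n (vec u) (vec (fbar n)) / 2 + n%:R * gamma * (njump (vec u) n)%:R =
  n%:R * (sqd n (vec u) (vec (fbar n)) / n%:R / 2 + gamma * (njump (vec u) n)%:R).
  apply: (le_trans h); rewrite le_eqVlt; apply/orP; left; apply/eqP; by field; rewrite gt_eqF.
by field; rewrite gt_eqF.
Qed.

End Link.

(** * Minimizers close to a step function *)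

Section Structure.
Context {R : realType}.
Implicit Types (U V x a : nat -> R).

Lemma sum_sub (F : nat -> R) lo hi n : (forall i, 0 <= F i) -> (lo <= hi <= n)%N ->
  \sum_(lo <= i < hi) F i <= \sum_(0 <= i < n) F i.
Proof.
move=> F0 /andP[lh hn].
rewrite (big_cat_nat (leq0n lo) (leq_trans lh hn)) (big_cat_nat lh hn) /=.
have h1 : 0 <= \sum_(0 <= i < lo) F i by apply: sumr_ge0.
have h2 : 0 <= \sum_(hi <= i < n) F i by apply: sumr_ge0.
lra.
Qed.

Lemma sum_block (F : nat -> R) (v : R) lo hi : (forall i, (lo <= i < hi)%N -> F i = v) ->
  \sum_(lo <= i < hi) F i = (hi - lo)%:R * v.
Proof.
move=> H; rewrite mulr_natl -sumr_const_nat big_nat_cond [RHS]big_nat_cond.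
by apply: eq_bigr => i /andP[ib _]; rewrite H.
Qed.

(** Without a jump [U] would equal a constant c on the whole window of radius [L] around [q]. As (c
    - a)^2 + (c - a')^2 >= (a - a')^2 / 2, this would cost at least L b^2 / 2. *)
Lemma window_jump U V n k p (q L : nat) (a a' b : R) : pieces U n k p ->
  (0 < L)%N -> (L <= q)%N -> (q + L <= n)%N ->
  (forall i, (q - L <= i < q)%N -> V i = a) ->
  (forall i, (q <= i < q + L)%N -> V i = a') ->
  0 <= b <= `|a - a'| -> sqd n U V < L%:R * (b ^+ 2 / 2) ->
  exists2 s, (0 < s <= k)%N & (q < p s + L)%N && (p s < q + L)%N.
Proof.
move=> H L0 Lq qn Va Va' /andP[b0 bb] small; apply: contrapT => no.
have cst i : (i < L + L)%N -> U (q - L + i)%N = U (q - L)%N.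
  elim: i => [|i IH] iL; first by rewrite addn0.
  rewrite -IH; last lia.
  apply: contrapT => ne; apply: no.
  have [s sk ps] := @pieces_jumpP R U n k p (q - L + i) H ltac:(lia) ltac:(by apply/eqP => e; apply: ne; rewrite addnS e).
  by exists s => //; lia.
set c := U (q - L)%N in cst.
have Uc i : (q - L <= i < q + L)%N -> U i = c.
  by move=> iq; rewrite -(cst (i - (q - L))%N); [congr U|]; lia.
have h : \sum_(q - L <= i < q + L) (U i - V i) ^+ 2 = L%:R * (c - a) ^+ 2 + L%:R * (c - a') ^+ 2.
  rewrite (@big_cat_nat _ _ _ q)/=; [|lia|lia].
  rewrite (@sum_block _ ((c - a) ^+ 2)); last by move=> i iq; rewrite Uc ?Va//; lia.
  rewrite (@sum_block _ ((c - a') ^+ 2)); last by move=> i iq; rewrite Uc ?Va'//; lia.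
  by congr (_%:R * _ + _%:R * _); lia.
have := @sum_sub (fun i => (U i - V i) ^+ 2) (q - L) (q + L) n (fun i => sqr_ge0 _) ltac:(lia).
rewrite h -/(sqd n U V) => h2.
have L0' : 0 < L%:R :> R by rewrite ltr0n.
have bs : b ^+ 2 <= (a - a') ^+ 2.
  by rewrite -[leRHS]real_normK ?num_real// lerXn2r ?nnegrE.
have := le_lt_trans h2 small.
rewrite -mulrDr ltr_pM2l//.
have := sqr_ge0 (2 * c - a - a').
have -> : (2 * c - a - a') ^+ 2 = 2 * ((c - a) ^+ 2 + (c - a') ^+ 2) - (a - a') ^+ 2 by ring.
lra.
Qed.

(** The windows around the [q j] are disjoint and ordered, so the indices of the detected jumps
    strictly increase with j. Hence j <= s_j <= k - (K - j), which gives K <= k and pins s_j = j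
    when k = K. *)
Lemma order_embedding (p q : nat -> nat) (K k L : nat) :
  (forall i j, (i <= j <= k.+1)%N -> (p i <= p j)%N) ->
  (forall j, (0 < j < K)%N -> (q j + L + L <= q j.+1)%N) ->
  (forall j, (0 < j <= K)%N -> exists2 s, (0 < s <= k)%N & (q j < p s + L)%N && (p s < q j + L)%N) ->
  (K <= k)%N /\ (k = K -> forall j, (0 < j <= K)%N -> (q j < p j + L)%N && (p j < q j + L)%N).
Proof.
move=> mono sep ex.
have [sg Hsg] : {sg : nat -> nat & forall j, (0 < j <= K)%N ->
    (0 < sg j <= k)%N /\ (q j < p (sg j) + L)%N && (p (sg j) < q j + L)%N}.
  apply: (@choice _ _ (fun j s => (0 < j <= K)%N -> (0 < s <= k)%N /\ (q j < p s + L)%N && (p s < q j + L)%N)).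
  move=> j; have [jK|jK] := pselect (0 < j <= K)%N; last by exists 0%N.
  by have [s sk ps] := ex j jK; exists s.
have incr j : (0 < j < K)%N -> (sg j < sg j.+1)%N.
  move=> jK; rewrite ltnNge; apply/negP => le.
  have [h1 h2] := Hsg j ltac:(lia); have [h3 h4] := Hsg j.+1 ltac:(lia).
  have := mono (sg j.+1) (sg j) ltac:(lia); have := sep j ltac:(lia); lia.
have low j : (0 < j <= K)%N -> (j <= sg j)%N.
  elim: j => // j IH jK; have [j0|j0] := posnP j.
    by rewrite j0; have [h1 h2] := Hsg 1%N ltac:(lia); lia.
  have := incr j ltac:(lia); have := IH ltac:(lia); lia.
have up i : (i < K)%N -> (sg (K - i) + i <= k)%N.
  elim: i => [|i IH] iK.
    by rewrite subn0 addn0; have [h1 h2] := Hsg K ltac:(lia); lia.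
  have := incr (K - i.+1)%N ltac:(lia); have := IH ltac:(lia).
  have -> : (K - i.+1).+1 = (K - i)%N by lia.
  lia.
split.
  have [->//|K0] := posnP K.
  by have := low K ltac:(lia); have := up 0%N K0; rewrite subn0; lia.
move=> kK j jK; have [_ ] := Hsg j jK; suff -> : sg j = j by [].
have := low j jK; have := up (K - j)%N ltac:(lia).
have -> : (K - (K - j))%N = j by lia.
lia.
Qed.

Lemma isum_cat x (a b c : nat) : (a <= b <= c)%N -> isum x a c = isum x a b + isum x b c.
Proof. by case/andP=> ab bc; rewrite /isum (big_cat_nat ab bc). Qed.

Lemma isum_geq x (a b : nat) : (b <= a)%N -> isum x a b = 0.
Proof. by move=> ba; rewrite /isum big_geq. Qed.

Lemma sum_block_mul (F x : nat -> R) (v : R) lo hi : (forall i, (lo <= i < hi)%N -> F i = v) ->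
  \sum_(lo <= i < hi) F i * x i = v * isum x lo hi.
Proof.
move=> H; rewrite /isum mulr_sumr big_nat_cond [RHS]big_nat_cond.
by apply: eq_bigr => i /andP[ib _]; rewrite H.
Qed.

(* [U] misses the ends of the constancy interval [q, q') of the truth by fewer than [L] steps. *)
Lemma piece_noise U x (q q' p p' L : nat) (a cl c cr A B eta b : R) :
  (q + 4 * L <= q')%N -> (q < q')%N ->
  (q <= p + L)%N -> (p <= q + L)%N -> (q' <= p' + L)%N -> (p' <= q' + L)%N ->
  (forall i, (q <= i < q')%N -> (i < p)%N -> U i = cl) ->
  (forall i, (q <= i < q')%N -> (p <= i < p')%N -> U i = c) ->
  (forall i, (q <= i < q')%N -> (p' <= i)%N -> U i = cr) ->
  0 <= A -> 0 <= B -> 0 <= eta -> 2 * B * eta <= b ^+ 2 / 8 -> 0 <= b ->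
  isum x q q' ^+ 2 <= A ^+ 2 * (q' - q)%:R ->
  ((q < p)%N -> [/\ `|isum x q p| <= eta * (p - q)%:R + A, b / 2 <= `|cl - a| & `|cl - c| <= B]) ->
  ((p' < q')%N -> [/\ `|isum x p' q'| <= eta * (q' - p')%:R + A, b / 2 <= `|cr - a| & `|cr - c| <= B]) ->
  2 * \sum_(q <= i < q') (U i - a) * x i <=
    2^-1 * \sum_(q <= i < q') (U i - a) ^+ 2 + (4 * A ^+ 2 + 4 * B * A).
Proof.
move=> qL qq' h1 h2 h3 h4 Ul Uc Ur A0 B0 e0 Be b0 Smid Sl Sr.
pose s := maxn q p; pose s' := minn p' q'.
have ss1 : (q <= s)%N by rewrite /s; lia.
have ss2 : (s <= s')%N by rewrite /s /s'; lia.
have ss3 : (s' <= q')%N by rewrite /s'; lia.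
(* The central value [c] is charged on all of [q, q') and corrected on the two ends. The main noise
   sum thus runs over a fixed interval, and only sums with one end at [q] or [q'] depend on where
   [U] jumps. *)
have Ea : \sum_(q <= i < q') (U i - a) * x i =
    (c - a) * isum x q q' + (cl - c) * isum x q p + (cr - c) * isum x p' q'.
  rewrite (big_cat_nat ss1 (leq_trans ss2 ss3)) (big_cat_nat ss2 ss3) /=.
  rewrite (@sum_block_mul (fun i => U i - a) x (cl - a)); last first.
    by move=> i; rewrite /s => ii; rewrite Ul//; lia.
  rewrite (@sum_block_mul (fun i => U i - a) x (c - a)); last first.
    by move=> i; rewrite /s /s' => ii; rewrite Uc//; lia.
  rewrite (@sum_block_mul (fun i => U i - a) x (cr - a)); last first.
    by move=> i; rewrite /s' => ii; rewrite Ur//; lia.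
  have -> : isum x q p = isum x q s.
    have [pq|pq] := leqP p q; first by rewrite !isum_geq// /s; lia.
    by congr (isum _ _ _); rewrite /s; lia.
  have -> : isum x p' q' = isum x s' q'.
    have [pq|pq] := leqP q' p'; first by rewrite !isum_geq// /s'; lia.
    by congr (isum _ _ _); rewrite /s'; lia.
  rewrite (@isum_cat x q s q') ?(@isum_cat x s s' q') ?ss1 ?ss2 ?(leq_trans ss2 ss3)//.
  ring.
have Eb : \sum_(q <= i < q') (U i - a) ^+ 2 =
    (p - q)%:R * (cl - a) ^+ 2 + (s' - s)%:R * (c - a) ^+ 2 + (q' - p')%:R * (cr - a) ^+ 2.
  rewrite (big_cat_nat ss1 (leq_trans ss2 ss3)) (big_cat_nat ss2 ss3) /=.
  rewrite (@sum_block _ ((cl - a) ^+ 2)); last first.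
    by move=> i; rewrite /s => ii; rewrite Ul//; lia.
  rewrite (@sum_block _ ((c - a) ^+ 2)); last first.
    by move=> i; rewrite /s /s' => ii; rewrite Uc//; lia.
  rewrite (@sum_block _ ((cr - a) ^+ 2)); last first.
    by move=> i; rewrite /s' => ii; rewrite Ur//; lia.
  rewrite addrA; congr (_%:R * _ + _ + _%:R * _); rewrite /s /s'; lia.
set l := (q' - q)%:R in Smid.
have l0 : 0 < l by rewrite ltr0n; lia.
(* At most 2 L indices are lost at the two ends, which is at most half of q' - q because q' - q >= 4
   L. *)
have mid : l / 2 <= (s' - s)%:R.
  rewrite ler_pdivrMr// -natrM ler_nat /s /s'; lia.
have T1 : 2 * ((c - a) * isum x q q') <= (s' - s)%:R * (c - a) ^+ 2 / 2 + 4 * A ^+ 2.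
  have sq : 0 <= (l / 2 * (c - a) - 2 * isum x q q') ^+ 2 / l by rewrite divr_ge0 ?sqr_ge0// ltW.
  have E : (l / 2 * (c - a) - 2 * isum x q q') ^+ 2 / l =
     l / 4 * (c - a) ^+ 2 - 2 * ((c - a) * isum x q q') + 4 * (isum x q q' ^+ 2 / l).
    by field; rewrite gt_eqF.
  have S' : isum x q q' ^+ 2 / l <= A ^+ 2 by rewrite ler_pdivrMr.
  have := ler_wpM2r (sqr_ge0 (c - a)) mid.
  rewrite E in sq; lra.
(* On a misplaced end each index carries squared error at least b^2 / 4. Half of that pays for the
   linear part of the noise bound, because 2 B eta <= b^2 / 8; the constant part leaves 2 B A. *)
have side (lo hi : nat) (cs : R) :
    ((lo < hi)%N -> [/\ `|isum x lo hi| <= eta * (hi - lo)%:R + A, b / 2 <= `|cs - a| & `|cs - c| <= B]) ->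
    2 * ((cs - c) * isum x lo hi) <= (hi - lo)%:R * (cs - a) ^+ 2 / 2 + 2 * B * A.
  move=> Hs; have [lh|lh] := leqP hi lo.
    rewrite isum_geq// !mulr0 (eqP (_ : hi - lo == 0)%N) ?subn_eq0// !mul0r add0r.
    by rewrite !mulr_ge0.
  have [k1 k2 k3] := Hs lh.
  have d0 : 0 <= (hi - lo)%:R :> R by [].
  have : (cs - c) * isum x lo hi <= B * (eta * (hi - lo)%:R + A).
    by apply: (le_trans (ler_norm _)); rewrite normrM ler_pM.
  have : b ^+ 2 / 4 <= (cs - a) ^+ 2.
    have -> : b ^+ 2 / 4 = (b / 2) ^+ 2 by field.
    by rewrite -[leRHS]real_normK ?num_real// lerXn2r ?nnegrE// divr_ge0.
  move=> /(ler_wpM2l d0); have := ler_wpM2l d0 Be.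
  lra.
have := side q p cl Sl; have := side p' q' cr Sr.
rewrite Ea Eb; lra.
Qed.

Lemma sum_pieces (F : nat -> R) (q : nat -> nat) m : q 0%N = 0%N ->
  (forall j, (j < m)%N -> (q j <= q j.+1)%N) ->
  \sum_(0 <= i < q m) F i = \sum_(0 <= j < m) \sum_(q j <= i < q j.+1) F i.
Proof.
move=> q0; elim: m => [|m IH] H; first by rewrite q0 !big_geq.
rewrite big_nat_recr//= -IH; last by move=> j jm; apply: H; lia.
by rewrite (big_cat_nat (leq0n (q m))) //=; apply: H.
Qed.

Section Estimate.
Variables (U V x a : nat -> R) (n m L : nat) (q p : nat -> nat) (b Bd eta A : R).
Hypotheses (m0 : (0 < m)%N) (L0 : (0 < L)%N) (q0 : q 0%N = 0%N) (qm : q m = n).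
Hypothesis sep : forall j, (j < m)%N -> (q j + 4 * L <= q j.+1)%N.
Hypothesis VE : forall j i, (j < m)%N -> (q j <= i < q j.+1)%N -> V i = a j.
Hypothesis b0 : 0 < b.
Hypothesis ab : forall j, (j.+1 < m)%N -> b <= `|a j - a j.+1|.
Hypothesis aB : forall j, (j < m)%N -> `|a j| <= Bd.
Hypothesis small : sqd n U V < L%:R * (b ^+ 2 / 16).

Lemma q_mono i j : (i <= j <= m)%N -> (q i <= q j)%N.
Proof.
elim: j => [|j IH] ij; first by have -> : i = 0%N by lia.
have [->//|nij] := eqVneq i j.+1.
have := sep (j := j) ltac:(lia); have := IH ltac:(lia); lia.
Qed.

Let q_lt j : (j < m)%N -> (q j < q j.+1)%N.
Proof. by move=> /sep; move: L0; clear; lia. Qed.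

Lemma jumps_detected k : pieces U n k p ->
  (m.-1 <= k)%N /\ (k = m.-1 -> forall j, (0 < j <= m.-1)%N -> (q j < p j + L)%N && (p j < q j + L)%N).
Proof.
move=> H; apply: (@order_embedding p q m.-1 k L).
- exact: (pieces_mono H).
- by move=> j jm; have := sep (j := j) ltac:(lia); lia.
move=> j jm.
have s1 := sep (j := j.-1) ltac:(lia); have s2 := sep (j := j) ltac:(lia).
have ej : j.-1.+1 = j by lia.
rewrite ej in s1.
have qn : (q j.+1 <= n)%N by rewrite -qm; apply: q_mono; lia.
apply: (@window_jump U V n k p (q j) L (a j.-1) (a j) b H) => //; try lia.
- by move=> i ij; apply: VE; [lia|rewrite ej; lia].
- by move=> i ij; apply: VE; [lia|lia].
- by rewrite (ltW b0)/=; have := ab (j := j.-1) ltac:(lia); rewrite ej.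
apply: lt_le_trans small _; rewrite ler_wpM2l//.
by have := sqr_ge0 b; lra.
Qed.

Hypothesis H : pieces U n m.-1 p.
Hypotheses (A0 : 0 <= A) (e0 : 0 <= eta).
Hypothesis Be : 2 * (2 * Bd + b / 2) * eta <= b ^+ 2 / 8.
Hypothesis Smid : forall j, (j < m)%N -> isum x (q j) (q j.+1) ^+ 2 <= A ^+ 2 * (q j.+1 - q j)%:R.
Hypothesis Sr : forall j e, (0 < j < m)%N -> (q j < e <= n)%N ->
  `|isum x (q j) e| <= eta * (e - q j)%:R + A.
Hypothesis Sl : forall j e, (0 < j < m)%N -> (e < q j)%N ->
  `|isum x e (q j)| <= eta * (q j - e)%:R + A.

Let pm : p m = n.
Proof. by have := piecesn H; rewrite prednK. Qed.

Let near j : (j <= m)%N -> (q j <= p j + L)%N && (p j <= q j + L)%N.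
Proof.
move=> jm; have [j0|j0] := posnP j; first by rewrite j0 q0 (pieces0 H).
have [jm'|jm'] := eqVneq j m; first by rewrite jm' qm pm leq_addr.
by have := (jumps_detected H).2 erefl j ltac:(lia); lia.
Qed.

(** The j-th run of [U] covers the j-th plateau of [V] except for [L] indices at either end, hence
    at least 2 L of them; a larger difference would exceed the bound [small] on the squared
    distance. *)
Let close j : (j < m)%N -> `|U (p j) - a j| <= b / 4.
Proof.
move=> jm; have n1 := near (ltnW jm); have n2 := near jm; have s := sep jm.
have pj := pieces_lt H (j := j) ltac:(lia).
have := @sum_sub (fun i => (U i - V i) ^+ 2) (q j + L) (q j.+1 - L) n (fun i => sqr_ge0 _).
have qn : (q j.+1 <= n)%N by rewrite -qm; apply: q_mono; lia.
move=> /(_ ltac:(lia)).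
rewrite (@sum_block _ ((U (p j) - a j) ^+ 2)); last first.
  move=> i ij; rewrite (VE (j := j))//; last lia.
  by rewrite (pieces_cst H (j := j))//; lia.
move=> /le_lt_trans/(_ small) h.
have L0' : 0 < L%:R :> R by rewrite ltr0n.
have : L%:R * (U (p j) - a j) ^+ 2 < L%:R * (b ^+ 2 / 16).
  by apply: le_lt_trans h; rewrite ler_wpM2r ?sqr_ge0// ler_nat; lia.
rewrite ltr_pM2l// => h'.
have b4 : 0 <= b / 4 by rewrite divr_ge0// ltW.
rewrite -ler_sqr ?nnegrE//= real_normK ?num_real//.
have -> : (b / 4) ^+ 2 = b ^+ 2 / 16 by field.
exact: ltW.
Qed.

(** [piece_noise] is summed over the [m] constancy intervals. Since run values are within b/4 of the
    plateau values, a neighbouring value is off by at least b - b/4 >= b/2, and neighbouring run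
    values differ by at most 2 Bd + b/2. *)
Lemma noise_absorbed :
  2 * \sum_(0 <= i < n) (U i - V i) * x i <=
  2^-1 * sqd n U V + m%:R * (4 * A ^+ 2 + 4 * (2 * Bd + b / 2) * A).
Proof.
have B0 : 0 <= Bd by apply: le_trans (normr_ge0 (a 0%N)) (aB m0).
have qle j : (j < m)%N -> (q j <= q j.+1)%N by move=> /sep; lia.
rewrite /sqd -qm !(sum_pieces _ q0 qle) !mulr_sumr.
have -> : m%:R * (4 * A ^+ 2 + 4 * (2 * Bd + b / 2) * A) =
   \sum_(0 <= j < m) (4 * A ^+ 2 + 4 * (2 * Bd + b / 2) * A).
  by rewrite sumr_const_nat subn0 mulr_natl.
rewrite -big_split /= big_nat_cond [leRHS]big_nat_cond.
apply: ler_sum => j /andP[/andP[_ jm] _].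
have /andP[n11 n12] := near (ltnW jm); have /andP[n21 n22] := near jm; have s := sep jm.
have qj := q_lt jm.
have qn : (q j.+1 <= n)%N by rewrite -qm; apply: q_mono; rewrite jm leqnn.
rewrite (_ : \sum_(q j <= i < q j.+1) (U i - V i) * x i = \sum_(q j <= i < q j.+1) (U i - a j) * x i); last first.
  by rewrite big_nat_cond [RHS]big_nat_cond; apply: eq_bigr => i /andP[ij _]; rewrite (VE (j := j)).
rewrite (_ : \sum_(q j <= i < q j.+1) (U i - V i) ^+ 2 = \sum_(q j <= i < q j.+1) (U i - a j) ^+ 2); last first.
  by rewrite big_nat_cond [RHS]big_nat_cond; apply: eq_bigr => i /andP[ij _]; rewrite (VE (j := j)).
have cj := close jm.
have tri (y z w : R) : `|y - w| <= `|y - z| + `|z - w| by rewrite (_ : y - w = (y - z) + (z - w)) ?ler_normD//; ring.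
(* For the first and last interval the outer neighbour does not exist: [j.-1] or [j.+1] then yields
   a placeholder value, whose hypotheses are vacuous because [p 0 = q 0] and [p m = q m]. *)
apply: (@piece_noise U x (q j) (q j.+1) (p j) (p j.+1) L (a j) (U (p j.-1)) (U (p j)) (U (p j.+1)) A (2 * Bd + b / 2) eta b) => //.
- move=> i ij ip.
  have j0 : (0 < j)%N by rewrite lt0n; apply/eqP => j0; move: ip; rewrite j0 (pieces0 H).
  have ej := prednK j0.
  have j1m : (j.-1 < m)%N by rewrite ej ltnW.
  have /andP[n01 n02] := near (ltnW j1m); have s0 := sep j1m; rewrite ej in s0.
  apply: (pieces_cst H); rewrite ?ej.
    by move: j1m; clear; lia.
  by move: ij ip n01 n02 s0; clear; lia.
- by move=> i ij ip; apply: (pieces_cst H) => //; move: jm; clear; lia.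
- move=> i ij ip.
  have jm1 : (j.+1 < m)%N.
    rewrite ltn_neqAle jm andbT; apply/eqP => e; move: ip ij; rewrite e qm pm; clear; lia.
  have /andP[n31 n32] := near jm1; have s3 := sep jm1.
  apply: (pieces_cst H); first by move: jm1; clear; lia.
  by move: ij ip n31 n32 s3; clear; lia.
- by have := ltW b0; lra.
- exact: ltW.
- exact: Smid.
- move=> qp.
  have j0 : (0 < j)%N by rewrite lt0n; apply/eqP => j0; move: qp; rewrite j0 (pieces0 H).
  have ej := prednK j0.
  have j1m : (j.-1 < m)%N by rewrite ej ltnW.
  have c1 := close j1m.
  have ab1 := ab (j := j.-1); rewrite ej in ab1; have {}ab1 := ab1 jm.
  have aB1 := aB j1m; have aB2 := aB jm.
  have pn : (p j <= n)%N by rewrite -pm; apply: (pieces_mono H); rewrite (ltnW jm) prednK ?leqnn.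
  split.
  + by apply: Sr; rewrite ?j0 ?qp.
  + have := tri (a j.-1) (U (p j.-1)) (a j); rewrite (distrC (a j.-1) (U (p j.-1))).
    have := ltW b0; lra.
  + have := tri (U (p j.-1)) (a j.-1) (U (p j)); have := tri (a j.-1) (a j) (U (p j)).
    rewrite (distrC (a j) (U (p j))); have := ler_normB (a j.-1) (a j); lra.
- move=> qp.
  have jm1 : (j.+1 < m)%N.
    rewrite ltn_neqAle jm andbT; apply/eqP => e; move: qp; rewrite e qm pm; clear; lia.
  have c1 := close jm1.
  have ab1 := ab jm1.
  have aB1 := aB jm1; have aB2 := aB jm.
  split.
  + exact: Sl.
  + have := tri (a j.+1) (U (p j.+1)) (a j); rewrite (distrC (a j.+1) (U (p j.+1))) (distrC (a j.+1) (a j)).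
    have := ltW b0; lra.
  + have := tri (U (p j.+1)) (a j.+1) (U (p j)); have := tri (a j.+1) (a j) (U (p j)).
    rewrite (distrC (a j) (U (p j))); have := ler_normB (a j.+1) (a j); lra.
Qed.

End Estimate.
End Structure.

(** * Consistency, and break points on the grid *)

Section Consistency.
Context {R : realType}.
Implicit Types (f : R -> R) (t alpha : nat -> R).

Lemma sqrtn_eventually (C e : R) : 0 < e -> exists N : nat, forall n, (N <= n)%N -> (0 < n)%N /\ C / n%:R <= e.
Proof.
move=> e0; exists (Num.truncn (`|C| / e)).+1 => n nN; split; first lia.
have n0 : 0 < n%:R :> R by rewrite ltr0n; lia.
rewrite ler_pdivrMr// mulrC -ler_pdivrMr//.
apply: (@le_trans _ _ (`|C| / e)); first by rewrite ler_pM2r ?invr_gt0// ler_norm.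
by apply: ltW; apply: lt_le_trans (truncnS_gt _) _; rewrite ler_nat.
Qed.

Lemma sample_error_sqr m t alpha n : subdivision m t -> (0 < n)%N ->
  L2norm (wstep m t alpha \- embed (sample (wstep m t alpha) n)) ^+ 2 <=
  (2 * (\sum_(i < m) `|alpha i|)) ^+ 2 * m.+1%:R / n%:R :> R.
Proof.
move=> H n0; have n0' : 0 < n%:R :> R by rewrite ltr0n.
have := sample_error alpha H n0.
have B0 : 0 <= 2 * (\sum_(i < m) `|alpha i|) by rewrite mulr_ge0// sumr_ge0.
move=> h; have h2 : L2norm (wstep m t alpha \- embed (sample (wstep m t alpha) n)) ^+ 2 <=
    (2 * (\sum_(i < m) `|alpha i|) * Num.sqrt (m.+1%:R / n%:R)) ^+ 2.
  by rewrite lerXn2r// nnegrE ?L2norm_ge0// mulr_ge0.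
by apply: (le_trans h2); rewrite exprMn sqr_sqrtr ?divr_ge0// mulrA.
Qed.

Lemma njump_vec_sample m t alpha n : subdivision m t -> (0 < n)%N ->
  (njump (vec (sample (wstep m t alpha) n)) n <= m.-1)%N.
Proof.
move=> H n0; apply: leq_trans (njump_sample alpha H n0).
by rewrite (@eq_njump _ _ _ (fun i => wstep m t alpha (design n i)))// => i iN; exact: (vec_row (fun i => wstep m t alpha (design n i))).
Qed.

Lemma L2norm_le_sqr f (e : R) : 0 <= e -> L2norm f ^+ 2 <= e ^+ 2 -> L2norm f <= e.
Proof. by move=> e0; rewrite ler_sqr// nnegrE ?L2norm_ge0. Qed.

(** Compare with a sample [v] of a step function within e/16 of f. As 4 M / n <= gamma, the noise
    term is at most gamma (J(u) + J(v) + 1); its J(u) part is cancelled by the penalty of [u]. What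
    remains is gamma (2 J(v) + 1), small for gamma <= c since J(v) is bounded independently of n. *)
Lemma consistency f : in_L2 f -> forall e : R, 0 < e ->
  exists N (c : R), 0 < c /\ forall n (gamma M : R) (u : 'rV[R]_n) (x : 'I_n -> R),
   (N <= n)%N -> gamma <= c -> 4 * (M / n%:R) <= gamma ->
   potts_argmin gamma (\row_(i < n) (cell_mean f n i + x i)) u -> noise_le (ext x) n M ->
   L2norm (embed u \- f) <= e.
Proof.
move=> hf e e0.
have e16 : 0 < e / 16 by rewrite divr_gt0.
have [m [t [alpha [H fs]]]] := step_dense hf e16.
set s := wstep m t alpha in fs.
set D := (2 * (\sum_(i < m) `|alpha i|)) ^+ 2 * m.+1%:R.
have e162 : 0 < (e / 16) ^+ 2 by rewrite exprn_gt0.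
have [N HN] := sqrtn_eventually D e162.
have m0 : 0 < (2 * m.+1)%:R :> R by rewrite ltr0n.
exists N, (e ^+ 2 / 16 / (2 * m.+1)%:R); split; first by rewrite !divr_gt0// exprn_gt0.
move=> n gamma M u x nN gc Mg hu hx.
have [n0 Dn] := HN n nN.
set v := sample s n.
have sv : L2norm (s \- embed v) <= e / 16.
  apply: L2norm_le_sqr; first exact: ltW.
  by apply: le_trans (sample_error_sqr alpha H n0) Dn.
have fv : L2norm (f \- embed v) <= e / 8.
  have := L2norm_tri hf (in_L2_wstep m t alpha) (in_L2_embed v); rewrite -/s; lra.
have hd := fit_dist hf u v n0.
have ho := fit_oracle hf v n0 hu hx.
have Jv : (njump (vec v) n <= m)%N by apply: leq_trans (njump_vec_sample alpha H n0) _; exact: leq_pred.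
have mu0 : 0 <= M / n%:R by rewrite divr_ge0//; exact: (noise_le_ge0 n0 hx).
set X := L2norm (embed u \- embed _) in hd ho.
have X0 : 0 <= X by exact: L2norm_ge0.
suff Xe : X <= e / 2 by lra.
have fv2 : L2norm (f \- embed v) ^+ 2 <= (e / 8) ^+ 2.
  by rewrite lerXn2r ?nnegrE ?L2norm_ge0// divr_ge0// ltW.
rewrite -ler_sqr ?nnegrE//; last by rewrite divr_ge0// ltW.
move: ho; rewrite -[(_ + _).+1%:R]natr1 natrD.
set J := (njump (vec u) n)%:R; set Jv' := (njump (vec v) n)%:R.
have J0 : 0 <= J :> R by [].
have Jm : Jv' <= m%:R :> R by rewrite ler_nat.
have Jv0 : 0 <= Jv' :> R by [].
set mu := M / n%:R in mu0 Mg *.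
have g0 : 0 <= gamma by lra.
move=> ho.
have h1 : 4 * (J + Jv' + 1) * mu <= gamma * (J + Jv' + 1).
  rewrite (_ : 4 * (J + Jv' + 1) * mu = 4 * mu * (J + Jv' + 1)); last by ring.
  by rewrite ler_wpM2r// !addr_ge0.
have h2 : gamma * (2 * Jv' + 1) <= e ^+ 2 / 16.
  apply: (@le_trans _ _ (gamma * (2 * m.+1)%:R)).
    rewrite ler_wpM2l// natrM -[m.+1%:R]natr1; lra.
  by rewrite -ler_pdivlMr.
have -> : (e / 2) ^+ 2 = e ^+ 2 / 4 by field.
have e2 : (e / 8) ^+ 2 = e ^+ 2 / 64 by field.
have ee : 0 <= e ^+ 2 by exact: sqr_ge0.
rewrite e2 in fv2.
lra.
Qed.

Lemma min_pos (F : nat -> R) m : (forall j, (j < m)%N -> 0 < F j) ->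
  exists2 d, 0 < d & forall j, (j < m)%N -> d <= F j.
Proof.
elim: m => [|m IH] H; first by exists 1.
have [j jm|d d0 Hd] := IH; first by apply: H; lia.
exists (Num.min d (F m)); first by rewrite lt_min d0 H.
move=> j jm; rewrite ge_min; have [->|ne] := eqVneq j m; first by rewrite lexx orbT.
by rewrite Hd//; lia.
Qed.

Lemma gridpos_ge n (y : R) : (0 < n)%N -> 0 <= y -> y * n%:R <= (gridpos n y)%:R.
Proof.
move=> n0 y0; have := gridposP (gridpos n y) n0 y0; rewrite ltnn => /esym/negbT.
by rewrite -leNgt /design ler_pdivlMr// ltr0n.
Qed.

Lemma gridpos_lt n (y : R) : (0 < n)%N -> 0 <= y -> (gridpos n y)%:R < y * n%:R + 1.
Proof.
move=> n0 y0; have n0' : 0 < n%:R :> R by rewrite ltr0n.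
have [->|g0] := posnP (gridpos n y); first by rewrite ltr_pwDr// mulr_ge0// ltW.
have := gridposP (gridpos n y).-1 n0 y0; rewrite prednK// leqnn => /esym.
rewrite /design ltr_pdivrMr// => h.
by rewrite -(prednK g0) -addn1 natrD ltrD2r.
Qed.

Lemma grid_spacing m (t : nat -> R) : subdivision m t -> (forall j, (j < m)%N -> t j < t j.+1) ->
  exists N (d : R), 0 < d /\ forall n, (N <= n)%N -> exists L, [/\ (0 < L)%N, d * n%:R <= L%:R &
    forall j, (j < m)%N -> (gridpos n (t j) + 4 * L <= gridpos n (t j.+1))%N].
Proof.
move=> H lt.
have [d d0 Hd] := @min_pos (fun j => t j.+1 - t j) m (fun j jm => ltac:(by rewrite subr_gt0 lt)).
have d8 : 0 < d / 8 by rewrite divr_gt0.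
have [N HN] := sqrtn_eventually 1 d8.
(* The window radius is the integer part of n d / 8. For n d / 8 >= 1 it is at least n d / 16, and
   four times it is at most n d / 2, less than the spacing n d - 1 of grid positions. *)
exists N, (d / 16); split; first by rewrite divr_gt0.
move=> n nN; have [n0 hn] := HN n nN.
have n0' : 0 < n%:R :> R by rewrite ltr0n.
have nd : 1 <= n%:R * d / 8 by move: hn; rewrite ler_pdivrMr//; lra.
exists (Num.truncn (n%:R * d / 8)).
have nd0 : 0 <= n%:R * d / 8 by lra.
have /andP[t1 t2] := truncn_itv nd0.
split.
- by rewrite truncn_gt0.
- have : 1 <= (Num.truncn (n%:R * d / 8))%:R :> R by rewrite ler1n truncn_gt0.
  move: t2; set L := Num.truncn _; rewrite -[L.+1%:R]natr1; lra.
move=> j jm.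
have tj k : (k <= m)%N -> 0 <= t k.
  by move=> km; case: (H) => t0 _ _; rewrite -t0; apply: (subdivision_mono H); lia.
have g1 := gridpos_ge n0 (tj j.+1 jm).
have g2 := gridpos_lt n0 (tj j (ltnW jm)).
have dj := Hd j jm.
have dn : d * n%:R <= t j.+1 * n%:R - t j * n%:R by rewrite -mulrBl ler_pM2r.
rewrite -(ler_nat R) natrD natrM.
have L1 : 1 <= (Num.truncn (n%:R * d / 8))%:R :> R by rewrite ler1n truncn_gt0.
lra.
Qed.

End Consistency.

Lemma sqr_homo (R : realType) (a b : R) : 0 <= a -> a <= b -> a ^+ 2 <= b ^+ 2.
Proof. by move=> a0 ab; rewrite lerXn2r// nnegrE// (le_trans a0). Qed.

(** * Rates when the regression function is a step function *)

Section StepCase.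
Context {R : realType}.
Variables (f : R -> R) (m : nat) (t alpha : nat -> R).
Hypotheses (hf : in_L2 f) (H : subdivision m t).
Hypothesis tlt : forall j, (j < m)%N -> t j < t j.+1.
Hypothesis ane : forall j, (j.+1 < m)%N -> alpha j != alpha j.+1.
Hypothesis sf : L2eq (wstep m t alpha) f.

Let s := wstep m t alpha.
Let v n := sample s n.
Let q n j := gridpos n (t j).
Let Bd := \sum_(i < m) `|alpha i|.
Let D := (2 * Bd) ^+ 2 * m.+1%:R.

Let m0 : (0 < m)%N := subdivision_gt0 H.
Let Bd0 : 0 <= Bd. Proof. by rewrite sumr_ge0. Qed.
Let D0 : 0 <= D. Proof. by rewrite mulr_ge0// sqr_ge0. Qed.

Lemma L2eq_sub (g h k : R -> R) : L2eq g h -> L2eq (g \- k) (h \- k).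
Proof. by move=> gh; apply: (negligibleS _ gh) => x /= nx h0; apply: nx => xI; rewrite /= h0. Qed.

Lemma L2eq_sym (g h : R -> R) : L2eq g h -> L2eq h g.
Proof. by move=> gh; apply: (negligibleS _ gh) => x /= nx h0; apply: nx => xI; rewrite h0. Qed.

Lemma step_sample_sqr n : (0 < n)%N -> L2norm (f \- embed (v n)) ^+ 2 <= D / n%:R.
Proof.
move=> n0; rewrite -(@L2norm_eq _ (s \- embed (v n)) (f \- embed (v n))).
- exact: sample_error_sqr.
- by apply: in_L2B; [exact: in_L2_wstep|exact: in_L2_embed].
- by apply: in_L2B; [exact: hf|exact: in_L2_embed].
- exact: L2eq_sub.
Qed.

Lemma vec_sampleE n j i : (j < m)%N -> (q n j <= i < q n j.+1)%N -> vec (v n) i = alpha j.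
Proof.
move=> jm ij.
have iN : (i < n)%N.
  have n0 : (0 < n)%N.
    by rewrite lt0n; apply/eqP => n0; move: ij; rewrite /q n0 /gridpos !mulr0 !ceil0 absz0 ltn0 andbF.
  apply: leq_trans (proj2 (andP ij)) _; rewrite /q -[leqRHS](gridpos1 (R := R) n).
  have t1 : t m = 1 by case: (H).
  have t0 : t 0%N = 0 by case: (H).
  rewrite -t1; apply: gridpos_le => //; apply/andP; split.
    by rewrite -t0; apply: (subdivision_mono H); lia.
  by apply: (subdivision_mono H); lia.
rewrite (vec_row (fun i => s (design n i)) iN).
exact: (sampleE alpha H iN jm ij).
Qed.

Lemma alpha_gap : exists2 b, 0 < b & forall j, (j.+1 < m)%N -> b <= `|alpha j - alpha j.+1|.
Proof.
have [|b b0 Hb] := @min_pos R (fun j => `|alpha j - alpha j.+1|) m.-1.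
  by move=> j jm; rewrite normr_gt0 subr_eq0 ane//; lia.
by exists b => // j jm; apply: Hb; lia.
Qed.

Definition fits n (gamma M : R) (u : 'rV[R]_n) (x : 'I_n -> R) : Prop :=
  [/\ 4 * (M / n%:R) <= gamma,
      potts_argmin gamma (\row_(i < n) (cell_mean f n i + x i)) u & noise_le (ext x) n M].

(** Consistency at one fixed accuracy suffices, because the window radius [L] is at least d n. The
    accuracy [e] is such that n (2 e)^2 = n d b^2 / 64, below L b^2 / 16. *)
Lemma step_structure b : 0 < b -> exists N (c : R), 0 < c /\
  forall n (gamma M : R) (u : 'rV[R]_n) (x : 'I_n -> R),
   (N <= n)%N -> gamma <= c -> fits gamma M u x ->
   (0 < n)%N /\ exists L, [/\ (0 < L)%N,
     forall j, (j < m)%N -> (q n j + 4 * L <= q n j.+1)%N &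
     sqd n (vec u) (vec (v n)) < L%:R * (b ^+ 2 / 16)].
Proof.
move=> b0; have [N1 [d [d0 H1]]] := grid_spacing H tlt.
pose e := Num.sqrt (d * b ^+ 2 / 16) / 4.
have db : 0 < d * b ^+ 2 / 16 by rewrite divr_gt0// mulr_gt0// exprn_gt0.
have e0 : 0 < e by rewrite divr_gt0// sqrtr_gt0.
have [N2 [c [c0 H2]]] := consistency hf e0.
have e20 : 0 < e ^+ 2 by rewrite exprn_gt0.
have [N3 H3] := sqrtn_eventually D e20.
exists (maxn N1 (maxn N2 N3)), c; split => // n gamma M u x; rewrite !geq_max => /and3P[nN1 nN2 nN3] gc [Mg hu hx].
have [n0 Dn] := H3 n nN3; split => //.
have [L [L0 dL HL]] := H1 n nN1.
exists L; split => //.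
have n0' : 0 < n%:R :> R by rewrite ltr0n.
have uf := H2 n gamma M u x nN2 gc Mg hu hx.
have fv : L2norm (f \- embed (v n)) <= e.
  by apply: L2norm_le_sqr; [exact: ltW|exact: le_trans (step_sample_sqr n0) Dn].
have uv : L2norm (embed u \- embed (v n)) <= 2 * e.
  have := L2norm_tri (in_L2_embed u) hf (in_L2_embed (v n)); lra.
have := sqr_homo (L2norm_ge0 _) uv.
rewrite L2norm_vec// ler_pdivrMr// => h.
apply: (le_lt_trans h).
have -> : (2 * e) ^+ 2 = d * b ^+ 2 / 16 / 4.
  by rewrite /e exprMn expr_div_n sqr_sqrtr ?ltW//; field.
apply: (@lt_le_trans _ _ (d * n%:R * (b ^+ 2 / 16))).
  have : 0 < d * b ^+ 2 / 16 * n%:R by rewrite mulr_gt0.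
  lra.
by rewrite ler_wpM2r// divr_ge0// sqr_ge0.
Qed.

Lemma alpha_le j : (j < m)%N -> `|alpha j| <= Bd.
Proof. by move=> jm; rewrite /Bd (bigD1 (Ordinal jm))//= lerDl sumr_ge0. Qed.

Let q0 n : q n 0 = 0%N.
Proof. by rewrite /q; case: H => -> _ _; rewrite gridpos0. Qed.

Let qm n : q n m = n.
Proof. by rewrite /q; case: H => _ -> _; rewrite gridpos1. Qed.

Lemma fit_sqr n (u : 'rV[R]_n) (E : R) : (0 < n)%N ->
  L2norm (embed u \- embed (fbar f n)) ^+ 2 <= E / n%:R ->
  L2norm (embed u \- f) ^+ 2 <= (2 * E + 8 * D) / n%:R.
Proof.
move=> n0 hE; have hd := fit_dist hf u (v n) n0; have hv := step_sample_sqr n0.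
have h := sqr_homo (L2norm_ge0 _) hd.
apply: (le_trans h).
have := sqr_ge0 (L2norm (embed u \- embed (fbar f n)) - 2 * L2norm (f \- embed (v n))).
rewrite sqrrB sqrrD exprMn mulrDl; lra.
Qed.

(** The minimizer has J >= m - 1 jumps and the sampled truth at most m - 1. The J - (m - 1) surplus
    jumps pay for their own noise since 4 M / n <= gamma, so gamma disappears and the noise of about
    2 m jumps is left. *)
Lemma step_rate : exists N (c K : R), [/\ 0 < c, 0 <= K &
  forall n (gamma M : R) (u : 'rV[R]_n) (x : 'I_n -> R),
   (N <= n)%N -> gamma <= c -> fits gamma M u x ->
   L2norm (embed u \- f) ^+ 2 <= K * (1 + M) / n%:R].
Proof.
have [b b0 ab] := alpha_gap.
have [N [c [c0 HN]]] := step_structure b0.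
exists N, c, (14 * D + 32 * m%:R); split => //; first by rewrite addr_ge0// mulr_ge0.
move=> n gamma M u x nN gc ft; have [n0 [L [L0 sep small]]] := HN n gamma M u x nN gc ft.
have [Mg hu hx] := ft.
have n0' : 0 < n%:R :> R by rewrite ltr0n.
have [p Hp] := pieces_exist (vec u) n0.
have [mJ _] := jumps_detected m0 L0 (q0 n) (qm n) sep (@vec_sampleE n) b0 ab small Hp.
have ho := fit_oracle hf (v n) n0 hu hx.
have Jv : (njump (vec (v n)) n <= m.-1)%N by exact: njump_vec_sample.
have M0 := noise_le_ge0 n0 hx.
have mu0 : 0 <= M / n%:R by rewrite divr_ge0.
have hv := step_sample_sqr n0.
have X2 : L2norm (embed u \- embed (fbar f n)) ^+ 2 <= (3 * D + 16 * m%:R * M) / n%:R.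
  move: ho; set X := L2norm _ ^+ 2; rewrite -[(_ + _).+1%:R]natr1 natrD.
  set J := (njump (vec u) n)%:R; set Jv' := (njump (vec (v n)) n)%:R.
  have J1 : m%:R <= J + 1 :> R by rewrite natr1 ler_nat (leq_trans (leqSpred m)).
  have J2 : Jv' + 1 <= m%:R :> R by rewrite natr1 ler_nat -(prednK m0).
  have Jv0 : 0 <= Jv' :> R by [].
  have g0 : 0 <= gamma by lra.
  have h1 : gamma * Jv' <= gamma * (m%:R - 1) by rewrite ler_wpM2l//; lra.
  have h2 : 4 * (M / n%:R) * (J - (m%:R - 1)) <= gamma * (J - (m%:R - 1)).
    by rewrite ler_wpM2r//; lra.
  have h3 : (M / n%:R) * Jv' <= (M / n%:R) * (m%:R - 1) by rewrite ler_wpM2l//; lra.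
  have -> : (3 * D + 16 * m%:R * M) / n%:R = 3 * (D / n%:R) + 16 * m%:R * (M / n%:R) by ring.
  set mu := M / n%:R in mu0 h2 h3 Mg *.
  set e := D / n%:R in hv *.
  move=> ho.
  have h4 : 0 <= m%:R * mu by rewrite mulr_ge0.
  lra.
have := fit_sqr n0 X2; move/le_trans; apply.
apply: ler_wpM2r; first by rewrite invr_ge0.
have h4 : 0 <= m%:R * M by rewrite mulr_ge0.
have h5 : 0 <= D * M by rewrite mulr_ge0.
have h6 : 0 <= m%:R :> R by [].
lra.
Qed.

(** The noise sums that [piece_noise] meets: the fixed constancy intervals, with no drift, and the
    intervals to the right or left of an interior break point, with drift [eta]. The end points 0
    and n cannot be misplaced and impose nothing. *)
Definition controlled n (x : nat -> R) (eta A : R) : Prop :=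
  [/\ forall j, (j < m)%N -> isum x (q n j) (q n j.+1) ^+ 2 <= A ^+ 2 * (q n j.+1 - q n j)%:R,
   forall j e, (0 < j < m)%N -> (q n j < e <= n)%N ->
    `|isum x (q n j) e| <= eta * (e - q n j)%:R + A &
   forall j e, (0 < j < m)%N -> (e < q n j)%N ->
    `|isum x e (q n j)| <= eta * (q n j - e)%:R + A].

(** The lower bound on gamma forces exactly m - 1 jumps. The penalties then cancel in
    [argmin_basic], and [noise_absorbed] bounds the noise by a constant that depends on [A] but not
    on [M]. *)
Lemma step_rate_strong : exists N (c eta K1 : R), [/\ 0 < c, 0 < eta, 0 <= K1 &
  forall A, 0 <= A -> exists K, forall n (gamma M : R) (u : 'rV[R]_n) (x : 'I_n -> R),
   (N <= n)%N -> gamma <= c -> K1 * (1 + M) / n%:R < gamma -> fits gamma M u x ->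
   controlled n (ext x) eta A ->
   L2norm (embed u \- f) ^+ 2 <= K / n%:R].
Proof.
have [b b0 ab] := alpha_gap.
have [N [c [c0 HN]]] := step_structure b0.
have B0 : 0 < 2 * (2 * Bd + b / 2) by rewrite mulr_gt0// ltr_wpDl ?divr_gt0// mulr_ge0.
pose eta := b ^+ 2 / 8 / (2 * (2 * Bd + b / 2)).
have eta0 : 0 < eta by rewrite !divr_gt0// exprn_gt0.
exists N, c, eta, (3 / 2 * D + 8 * m%:R); split => //; first by rewrite addr_ge0// mulr_ge0.
move=> A A0; pose CA := m%:R * (4 * A ^+ 2 + 4 * (2 * Bd + b / 2) * A).
exists (2 * (10 * D + 4 * CA) + 8 * D) => n gamma M u x nN gc gM ft [Smid Sr Sl].
have [n0 [L [L0 sep small]]] := HN n gamma M u x nN gc ft.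
have [Mg hu hx] := ft.
have n0' : 0 < n%:R :> R by rewrite ltr0n.
have [p Hp] := pieces_exist (vec u) n0.
have [mJ _] := jumps_detected m0 L0 (q0 n) (qm n) sep (@vec_sampleE n) b0 ab small Hp.
have ho := fit_oracle hf (v n) n0 hu hx.
have Jv : (njump (vec (v n)) n <= m.-1)%N by exact: njump_vec_sample.
have M0 := noise_le_ge0 n0 hx.
have mu0 : 0 <= M / n%:R by rewrite divr_ge0.
have g0 : 0 <= gamma by lra.
have hv := step_sample_sqr n0.
have m1 : 1 <= m%:R :> R by rewrite ler1n.
(* If J >= m, then J + m <= 2 m (J - (m - 1)), so the oracle inequality bounds gamma times the
   surplus J - (m - 1) by (3/2 D + 8 m M) / n times the same surplus, contrary to the lower bound on
   gamma. *)
have JE : njump (vec u) n = m.-1.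
  apply/eqP; rewrite eqn_leq mJ andbT leqNgt; apply/negP => Jgt.
  move: ho; rewrite -[(_ + _).+1%:R]natr1 natrD.
  set J := (njump (vec u) n)%:R; set Jv' := (njump (vec (v n)) n)%:R.
  have J1 : m%:R <= J :> R by rewrite ler_nat -(prednK m0).
  have J2 : Jv' + 1 <= m%:R :> R by rewrite natr1 ler_nat -(prednK m0).
  have Jv0 : 0 <= Jv' :> R by [].
  have X0 := sqr_ge0 (L2norm (embed u \- embed (fbar f n))).
  have gM' : 3 / 2 * (D / n%:R) + 8 * m%:R * (M / n%:R) < gamma.
    apply: le_lt_trans gM.
    have -> : (3 / 2 * D + 8 * m%:R) * (1 + M) / n%:R =
      3 / 2 * (D / n%:R) + 8 * m%:R * (M / n%:R) + (3 / 2 * (D * M) + 8 * m%:R) / n%:R by ring.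
    by rewrite lerDl divr_ge0// addr_ge0 ?mulr_ge0.
  have h1 : gamma * Jv' <= gamma * (m%:R - 1) by rewrite ler_wpM2l//; lra.
  have h3 : (M / n%:R) * Jv' <= (M / n%:R) * (m%:R - 1) by rewrite ler_wpM2l//; lra.
  have hd : 0 < J - (m%:R - 1) by lra.
  have h2 : (3 / 2 * (D / n%:R) + 8 * m%:R * (M / n%:R)) * (J - (m%:R - 1)) < gamma * (J - (m%:R - 1)).
    by rewrite ltr_pM2r.
  have DD : 0 <= D / n%:R by rewrite divr_ge0.
  have h4 : 0 <= (D / n%:R) * (J - m%:R) by rewrite mulr_ge0// subr_ge0.
  have h5 : 0 <= (M / n%:R) * (J - m%:R) by rewrite mulr_ge0// subr_ge0.
  have h6 : 0 <= (M / n%:R) * ((J - m%:R) * (m%:R - 1)) by rewrite !mulr_ge0// subr_ge0.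
  have h7 : 0 <= (M / n%:R) * (m%:R - 1) by rewrite mulr_ge0// subr_ge0.
  set mu := M / n%:R in mu0 h2 h3 h5 h6 h7 gM' *.
  set e := D / n%:R in hv h2 h4 gM' DD *.
  nra.
have Hp' : pieces (vec u) n m.-1 p by rewrite -JE.
have Be : 2 * (2 * Bd + b / 2) * eta <= b ^+ 2 / 8.
  by rewrite /eta mulrC divfK// gt_eqF.
have na := noise_absorbed m0 L0 (q0 n) (qm n) sep (@vec_sampleE n) b0 ab alpha_le small Hp' A0 (ltW eta0) Be Smid Sr Sl.
have hb : potts_argmin gamma (\row_(i < n) (vec (fbar f n) i + ext x i)) u by rewrite -observationE.
have ab1 := argmin_basic (vec (v n)) n0 hb.
have Jle : n%:R * gamma * (njump (vec (v n)) n)%:R <= n%:R * gamma * (njump (vec u) n)%:R.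
  by rewrite ler_wpM2l ?mulr_ge0// ler_nat JE.
have half : 0 < 2^-1 :> R by rewrite invr_gt0.
(* With parameter 1/2 the absorbed half of |u - v|^2 costs 3/4 |u - fbar|^2 + 3/2 D, so a quarter of
   |u - fbar|^2 survives and yields 10 D + 4 CA. *)
have tr := @sqd_tri R n (vec u) (vec (fbar f n)) (vec (v n)) 2^-1 half.
rewrite invrK in tr.
have VF : sqd n (vec (v n)) (vec (fbar f n)) <= D.
  have := le_trans (sqr_homo (L2norm_ge0 _) (fbar_contraction hf (v n) n0)) hv.
  by rewrite L2norm_distC L2norm_vec// ler_pM2r ?invr_gt0.
rewrite (sqdC n (vec (fbar f n))) in tr.
apply: fit_sqr => //; rewrite L2norm_vec// ler_pM2r ?invr_gt0//.
rewrite -/CA in na.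
lra.
Qed.

End StepCase.

(** * Compactness of fits with boundedly many jumps *)

Section UltraLimits.
Context {R : realType}.
Variable (U : set_system nat).
Context {UU : UltraFilter U}.

(** Compactness of the segment provides a cluster point; an ultrafilter contains each neighbourhood
    of it or the complement, and a cluster point rules out the complement. *)
Lemma ultra_cvg (a : nat -> R) (B : R) : (\forall n \near U, `|a n| <= B) ->
  exists l : R, a n @[n --> U] --> l.
Proof.
move=> aB.
have aU : (a @ U) `[- B, B]%classic.
  by apply: filterS aB => n /=; rewrite in_itv/= -ler_norml.
have [l [_ cl]] := @segment_compact R (- B) B (a @ U) _ aU.
exists l => N Nl.
have [//|UN] := in_ultra_setVsetC (a @^-1` N) UU.
have aN : (a @ U) (~` N) by [].
by have [z []] := cl (~` N) N aN Nl.
Qed.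

Lemma ultra_pigeonhole (J : nat -> nat) (K : nat) : (\forall n \near U, (J n <= K)%N) ->
  exists k, \forall n \near U, J n = k.
Proof.
elim: K => [|K IH] H; first by exists 0%N; apply: filterS H => n; lia.
have [UK|UK] := in_ultra_setVsetC [set n | (J n <= K)%N] UU; first exact: IH.
exists K.+1; apply: filterS (filterI H UK) => n [/= h1 /negP h2]; lia.
Qed.

End UltraLimits.

(** * L2 distance between step functions, piece by piece *)

Section PieceNorms.
Context {R : realType}.
Notation mu := (@lebesgue_measure R).
Implicit Types (t alpha : nat -> R) (f g : R -> R).

Lemma in_L2_indic (c a b : R) : in_L2 (fun x => c * \1_(`[a, b[) x).
Proof.
apply: (@in_L2_bounded _ _ `|c|).
  by apply: measurable_funM => //; apply: measurable_indic; exact: measurable_itv.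
move=> x _; rewrite normrM -[leRHS]mulr1 ler_wpM2l// indicE.
by case: (_ \in _); rewrite ?normr0 ?normr1.
Qed.

Lemma L2norm_indic (c a b : R) : a <= b ->
  L2norm (fun x => c * \1_(`[a, b[) x) <= `|c| * Num.sqrt (b - a).
Proof.
move=> ab; apply: L2norm_le => //; [exact: in_L2_indic|].
rewrite exprMn sqr_sqrtr ?subr_ge0// real_normK ?num_real//.
have E : (fun x : R => (c * \1_(`[a, b[) x) ^+ 2) = (fun x => c ^+ 2 * \1_(`[a, b[) x).
  apply/funext => x; rewrite exprMn; congr (_ * _); rewrite indicE.
  by case: (_ \in _); rewrite ?expr0n ?expr1n.
rewrite (_ : \int[mu]_(x in unitI) _ = \int[mu]_(x in unitI) (c ^+ 2 * \1_(`[a, b[) x)); last by rewrite -E.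
rewrite RintegralZl//; last first.
  apply: measurable_bounded_integrable => //; first exact: unitI_lty.
  exists 1; split; first exact: num_real.
  move=> y y1 x _ /=; rewrite indicE; apply: le_trans (ltW y1).
  by case: (_ \in _); rewrite ?normr0 ?normr1.
rewrite ler_wpM2l ?sqr_ge0// /Rintegral integral_indic//.
have : (mu (`[a, b[%classic `&` unitI) <= (b - a)%:E)%E.
  have [ab'|ab'] := ltP a b; last first.
    have -> : b = a by apply/eqP; rewrite eq_le ab ab'.
    by rewrite set_itvco0 set0I measure0 subrr.
  have <- : mu `[a, b[%classic = (b - a)%:E.
    by rewrite lebesgue_measure_itv/= lte_fin ab' -EFinB.
  apply: le_measure => [||x []//]; rewrite inE; last exact: measurable_itvco.
  by apply: measurableI => //; exact: measurable_itvco.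
set z := (X in (X <= _)%E) => zle; change (fine z <= b - a).
have z0 : (0 <= z)%E by exact: measure_ge0.
by rewrite -lee_fin fineK// ge0_fin_numE// (le_lt_trans zle)// ltry.
Qed.

Lemma indic_co (a b : R) : a <= b ->
  (\1_(`[a, b[) : R -> R) = (fun x => \1_(`]-oo, b[) x - \1_(`]-oo, a[) x).
Proof.
move=> ab; apply/funext => x; rewrite !indicE !mem_setE /= !in_itv/=.
case: (leP a x) => ax; case: (ltP x b) => xb /=; rewrite ?subr0 ?subrr//.
by have := lt_le_trans ax ab; move: xb; lra.
Qed.

Lemma L2norm_le_add3 f g h (k : R -> R) : in_L2 f -> in_L2 g -> in_L2 h ->
  k = (fun x => f x + (g x + h x)) -> L2norm k <= L2norm f + (L2norm g + L2norm h).
Proof.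
move=> hf hg hh ->; apply: le_trans (L2normD hf (in_L2D hg hh)) _.
by rewrite lerD2l; exact: L2normD.
Qed.

Lemma L2norm_ray_sub (c a b : R) :
  L2norm (fun x => c * (\1_(`]-oo, b[) x - \1_(`]-oo, a[) x)) <= `|c| * Num.sqrt `|b - a|.
Proof.
have [ab|ba] := leP a b.
  have -> : `|b - a| = b - a by rewrite ger0_norm// subr_ge0.
  by have := L2norm_indic c ab; rewrite (indic_co ab).
have -> : `|b - a| = a - b by rewrite ltr0_norm ?subr_lt0// opprB.
rewrite -normrN.
have := L2norm_indic (- c) (ltW ba); rewrite (indic_co (ltW ba)).
apply: le_trans; rewrite le_eqVlt; apply/orP; left; apply/eqP.
by congr L2norm; apply/funext => x; ring.
Qed.

Lemma in_L2_ray_sub (c a b : R) : in_L2 (fun x => c * (\1_(`]-oo, b[) x - \1_(`]-oo, a[) x)).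
Proof.
have [ab|ba] := leP a b.
  by have := in_L2_indic c a b; rewrite (indic_co ab).
have := in_L2_indic (- c) b a; rewrite (indic_co (ltW ba)).
suff -> : (fun x => - c * (\1_(`]-oo, a[) x - \1_(`]-oo, b[) x)) =
   (fun x => c * (\1_(`]-oo, b[) x - \1_(`]-oo, a[) x)) by [].
by apply/funext => x; ring.
Qed.

(** Each indicator is a difference of two rays, so both ends can move independently without
    distinguishing how the two intervals overlap. *)
Lemma L2norm_piece_sub (c c' a b a' b' : R) : a <= b -> a' <= b' -> b - a <= 1 ->
  L2norm (fun x => c * \1_(`[a, b[) x - c' * \1_(`[a', b'[) x) <=
  `|c - c'| + (`|c'| * Num.sqrt `|b - b'| + `|c'| * Num.sqrt `|a - a'|).
Proof.
move=> ab ab' ba1.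
apply: (@le_trans _ _ (L2norm (fun x => (c - c') * \1_(`[a, b[) x) +
   (L2norm (fun x => c' * (\1_(`]-oo, b[) x - \1_(`]-oo, b'[) x)) +
    L2norm (fun x => - c' * (\1_(`]-oo, a[) x - \1_(`]-oo, a'[) x))))).
  apply: L2norm_le_add3; [exact: in_L2_indic|exact: in_L2_ray_sub|exact: in_L2_ray_sub|].
  by apply/funext => x; rewrite (indic_co ab) (indic_co ab'); ring.
rewrite lerD//.
  apply: le_trans (L2norm_indic _ ab) _; rewrite -[leRHS]mulr1 ler_wpM2l//.
  by rewrite -[leRHS]sqrtr1 ler_wsqrtr.
rewrite lerD//; first exact: L2norm_ray_sub.
by have := L2norm_ray_sub (- c') a' a; rewrite normrN.
Qed.

Lemma L2norm_wstep_sub m t alpha t' alpha' :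
  L2norm (wstep m t alpha \- wstep m t' alpha') <=
  \sum_(i < m) L2norm (fun x => alpha i * \1_(`[t i, t i.+1[) x - alpha' i * \1_(`[t' i, t' i.+1[) x).
Proof.
elim: m => [|m IH].
  rewrite big_ord0; apply: L2norm_le => //.
    by apply: in_L2B; exact: in_L2_wstep.
  rewrite (_ : (fun x => _) = fun=> 0) ?Rintegral_cst ?mul0r ?expr0n//.
  by apply/funext => x; rewrite /= /wstep !big_ord0 subrr expr0n.
rewrite big_ord_recr /=; apply: le_trans (lerD IH (lexx _)).
have := @L2normD R (wstep m t alpha \- wstep m t' alpha')
  (fun x => alpha m * \1_(`[t m, t m.+1[) x - alpha' m * \1_(`[t' m, t' m.+1[) x)
  (in_L2B (in_L2_wstep _ _ _) (in_L2_wstep _ _ _)) (in_L2B (in_L2_indic _ _ _) (in_L2_indic _ _ _)).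
apply: le_trans; rewrite le_eqVlt; apply/orP; left; apply/eqP.
by congr L2norm; apply/funext => x /=; rewrite /wstep !big_ord_recr/=; ring.
Qed.

End PieceNorms.

Section Prep.
Context {R : realType}.
Implicit Types (f g : R -> R) (t alpha : nat -> R).

Lemma sample_dense f (e : R) : in_L2 f -> 0 < e -> exists m t alpha N, subdivision m t /\
  forall n, (N <= n)%N -> (0 < n)%N /\ L2norm (f \- embed (sample (wstep m t alpha) n)) <= e.
Proof.
move=> hf e0; have e2 : 0 < e / 2 by rewrite divr_gt0.
have [m [t [alpha [H fs]]]] := step_dense hf e2.
have e22 : 0 < (e / 2) ^+ 2 by rewrite exprn_gt0.
have [N HN] := sqrtn_eventually ((2 * (\sum_(i < m) `|alpha i|)) ^+ 2 * m.+1%:R) e22.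
exists m, t, alpha, N; split => // n nN; have [n0 Dn] := HN n nN; split => //.
have sv : L2norm (wstep m t alpha \- embed (sample (wstep m t alpha) n)) <= e / 2.
  apply: L2norm_le_sqr; first exact: ltW.
  exact: le_trans (sample_error_sqr alpha H n0) Dn.
have := L2norm_tri hf (in_L2_wstep m t alpha) (in_L2_embed (sample (wstep m t alpha) n)).
lra.
Qed.

Lemma fbar_cvg f (e : R) : in_L2 f -> 0 < e ->
  exists N, forall n, (N <= n)%N -> (0 < n)%N /\ L2norm (embed (fbar f n) \- f) <= e.
Proof.
move=> hf e0; have e2 : 0 < e / 2 by rewrite divr_gt0.
have [m [t [alpha [N [H HN]]]]] := sample_dense hf e2.
exists N => n nN; have [n0 fv] := HN n nN; split => //.
set v := sample _ n in fv.
have := L2norm_tri (in_L2_embed (fbar f n)) (in_L2_embed v) hf.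
have := fbar_contraction hf v n0; rewrite (L2norm_distC (embed v)); lra.
Qed.

Lemma potts_cont_wstep_le (gamma : R) m t alpha f : 0 <= gamma -> subdivision m t ->
  (potts_cont gamma (wstep m t alpha) f <=
    (gamma * m.-1%:R + L2norm (f \- wstep m t alpha) ^+ 2)%:E)%E.
Proof.
move=> g0 H.
have refl : L2eq (wstep m t alpha) (wstep m t alpha) by exact: aeW.
rewrite /potts_cont asboolT; last by exists (wstep m t alpha) => //; exact: step_function_wstep.
rewrite EFinD leeD2r// EFinM lee_wpmul2l ?lee_fin//.
exact: counting_jump_set_le H refl.
Qed.

Lemma embed_pieces n k p (u : 'rV[R]_n) : (0 < n)%N -> pieces (vec u) n k p ->
  subdivision k.+1 (fun j => design n (p j) : R) /\
  L2eq (embed u) (wstep k.+1 (fun j => design n (p j)) (fun j => vec u (p j))).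
Proof.
move=> n0 H; have n0' : 0 < n%:R :> R by rewrite ltr0n.
have S : subdivision k.+1 (fun j => design n (p j) : R).
  split.
  - by rewrite (pieces0 H) /design mul0r.
  - by rewrite (piecesn H) /design divff// gt_eqF.
  - move=> j jk; rewrite /design ler_wpM2r ?invr_ge0// ler_nat.
    by apply: ltnW; exact: (pieces_lt H).
split => //; apply: aeW => x xI.
have [i iN ix] := cell_exists n0 xI.
rewrite (embedE (i := Ordinal iN) _ ix) -vec_ord /=.
have [j jk /andP[pj1 pj2]] := pieces_locate H iN.
rewrite (pieces_cst H jk) ?pj1//.
rewrite (wstepE _ S (i := j))//.
move: ix; rewrite /cell /= in_itv/= => /andP[a b]; apply/andP; split.
  by apply: le_trans a; rewrite /design ler_wpM2r ?invr_ge0// ler_nat.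
by apply: (lt_le_trans b); rewrite /design ler_wpM2r ?invr_ge0// ler_nat.
Qed.

(* Setting [u] to zero on one of its runs does not create jumps, so minimality bounds its mass there. *)
Lemma run_mass n (gamma M : R) (u : 'rV[R]_n) (fb x : nat -> R) k p j : (0 < n)%N -> 0 <= gamma ->
  potts_argmin gamma (\row_(i < n) (fb i + x i)) u -> noise_le x n M ->
  pieces (vec u) n k p -> (j <= k)%N ->
  (p j.+1 - p j)%:R * vec u (p j) ^+ 2 <= 8 * \sum_(p j <= i < p j.+1) fb i ^+ 2 + 8 * M.
Proof.
move=> n0 g0 hu hx H jk.
set V := zeroed (vec u) (p j) (p j.+1).
have hb := argmin_basic V n0 hu.
have pj := pieces_lt H jk.
have pn : (p j.+1 <= n)%N by rewrite -(piecesn H); apply: (pieces_mono H); lia.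
have JV : n%:R * gamma * (njump V n)%:R <= n%:R * gamma * (njump (vec u) n)%:R.
  by rewrite ler_wpM2l ?mulr_ge0// ler_nat (njump_zeroed n0 H jk).
set c := vec u (p j).
have split3 (F : nat -> R) : \sum_(0 <= i < n) F i = \sum_(0 <= i < p j) F i +
    (\sum_(p j <= i < p j.+1) F i + \sum_(p j.+1 <= i < n) F i).
  by rewrite (big_cat_nat (leq0n (p j)) (leq_trans (ltnW pj) pn)) (big_cat_nat (ltnW pj) pn).
have VI i : (p j <= i < p j.+1)%N -> V i = 0 by rewrite /V /zeroed => ->.
have VO i : ~~ (p j <= i < p j.+1)%N -> V i = vec u i by rewrite /V /zeroed => /negbTE->.
have uI i : (p j <= i < p j.+1)%N -> vec u i = c by exact: (pieces_cst H).
have eqI (F G : nat -> R) lo hi : (forall i, (lo <= i < hi)%N -> F i = G i) ->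
    \sum_(lo <= i < hi) F i = \sum_(lo <= i < hi) G i.
  by move=> FG; rewrite big_nat_cond [RHS]big_nat_cond; apply: eq_bigr => i /andP[ij _]; exact: FG.
have e1 : sqd n (vec u) fb - sqd n V fb = \sum_(p j <= i < p j.+1) (c ^+ 2 - 2 * c * fb i).
  rewrite /sqd !split3.
  rewrite (eqI (fun i => (V i - fb i) ^+ 2) (fun i => (vec u i - fb i) ^+ 2) 0%N (p j)); last first.
    by move=> i ij; rewrite VO//; lia.
  rewrite (eqI (fun i => (V i - fb i) ^+ 2) (fun i => (vec u i - fb i) ^+ 2) (p j.+1) n); last first.
    by move=> i ij; rewrite VO//; lia.
  rewrite (eqI (fun i => c ^+ 2 - 2 * c * fb i) (fun i => (vec u i - fb i) ^+ 2 - (V i - fb i) ^+ 2)).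
    by rewrite sumrB; ring.
  by move=> i ij; rewrite uI// VI//; ring.
have e2 : \sum_(0 <= i < n) (vec u i - V i) * x i = c * isum x (p j) (p j.+1).
  rewrite split3.
  rewrite (eqI _ (fun=> 0) 0%N (p j)); last by move=> i ij; rewrite VO ?subrr ?mul0r//; lia.
  rewrite (eqI _ (fun=> 0) (p j.+1) n); last by move=> i ij; rewrite VO ?subrr ?mul0r//; lia.
  rewrite !big1_eq add0r addr0.
  by apply: sum_block_mul => i ij; rewrite uI// VI// subr0.
have e3 : \sum_(p j <= i < p j.+1) (c ^+ 2 - 2 * c * fb i) >=
    \sum_(p j <= i < p j.+1) (3 / 4 * c ^+ 2 - 4 * fb i ^+ 2).
  apply: ler_sum => i _; have := sqr_ge0 (c / 2 - 2 * fb i).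
  have -> : (c / 2 - 2 * fb i) ^+ 2 = c ^+ 2 / 4 - 2 * c * fb i + 4 * fb i ^+ 2 by field.
  lra.
have e4 : \sum_(p j <= i < p j.+1) (3 / 4 * c ^+ 2 - 4 * fb i ^+ 2) =
    (p j.+1 - p j)%:R * (3 / 4 * c ^+ 2) - 4 * \sum_(p j <= i < p j.+1) fb i ^+ 2.
  by rewrite sumrB sumr_const_nat mulr_sumr -[X in X - _]mulr_natl.
have S := hx (p j) (p j.+1) ltac:(by rewrite pj pn).
rewrite e2 in hb.
set l := (p j.+1 - p j)%:R in S e4 *.
have l0 : 0 < l by rewrite ltr0n subn_gt0.
have e5 : 2 * (c * isum x (p j) (p j.+1)) <= l * c ^+ 2 / 4 + 4 * M.
  have sq : 0 <= (l / 2 * c - 2 * isum x (p j) (p j.+1)) ^+ 2 / l by rewrite divr_ge0 ?sqr_ge0// ltW.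
  have E : (l / 2 * c - 2 * isum x (p j) (p j.+1)) ^+ 2 / l =
     l / 4 * c ^+ 2 - 2 * (c * isum x (p j) (p j.+1)) + 4 * (isum x (p j) (p j.+1) ^+ 2 / l).
    by field; rewrite gt_eqF.
  have S' : isum x (p j) (p j.+1) ^+ 2 / l <= M by rewrite ler_pdivrMr// mulrC.
  rewrite E in sq; lra.
lra.
Qed.

(** An equi-integrability estimate: comparing fbar with a vector bounded by [B] splits its mass on
    the run into an approximation error and at most B^2 times the length. Hence a shrinking run
    carries only the error, which density makes arbitrarily small. *)
Lemma run_mass_small f n (gamma M : R) (u v : 'rV[R]_n) (x : 'I_n -> R) k p j (B : R) :
  in_L2 f -> (0 < n)%N -> 0 <= gamma ->
  potts_argmin gamma (\row_(i < n) (cell_mean f n i + x i)) u -> noise_le (ext x) n M ->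
  pieces (vec u) n k p -> (j <= k)%N -> (forall i, `|vec v i| <= B) ->
  vec u (p j) ^+ 2 * (design n (p j.+1) - design n (p j)) <=
   16 * L2norm (f \- embed v) ^+ 2 + 16 * B ^+ 2 * (design n (p j.+1) - design n (p j)) + 8 * (M / n%:R).
Proof.
move=> hf n0 g0 hu hx H jk vB; have n0' : 0 < n%:R :> R by rewrite ltr0n.
rewrite observationE in hu.
have h := run_mass n0 g0 hu hx H jk.
have pj := pieces_lt H jk.
have pn : (p j.+1 <= n)%N by rewrite -(piecesn H); apply: (pieces_mono H); lia.
have dE : design n (p j.+1) - design n (p j) = (p j.+1 - p j)%:R / n%:R :> R.
  by rewrite /design natrB ?mulrBl// ltnW.
rewrite dE.
have B0 : 0 <= B by exact: le_trans (normr_ge0 _) (vB 0%N).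
have h1 : \sum_(p j <= i < p j.+1) vec (fbar f n) i ^+ 2 <=
    2 * (n%:R * L2norm (f \- embed v) ^+ 2) + 2 * ((p j.+1 - p j)%:R * B ^+ 2).
  apply: (@le_trans _ _ (\sum_(p j <= i < p j.+1) (2 * (vec (fbar f n) i - vec v i) ^+ 2 + 2 * B ^+ 2))).
    apply: ler_sum => i _.
    have hB : vec v i ^+ 2 <= B ^+ 2 by rewrite -real_normK ?num_real// lerXn2r ?nnegrE.
    have := sqr_ge0 (vec (fbar f n) i - 2 * vec v i).
    have -> : (vec (fbar f n) i - 2 * vec v i) ^+ 2 =
      2 * (vec (fbar f n) i - vec v i) ^+ 2 - vec (fbar f n) i ^+ 2 + 2 * vec v i ^+ 2 by ring.
    lra.
  rewrite big_split /= sumr_const_nat -[X in _ + X <= _]mulr_natl -mulr_sumr.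
  apply: lerD; last by rewrite mulrCA.
  rewrite ler_wpM2l//.
  apply: (@le_trans _ _ (sqd n (vec (fbar f n)) (vec v))).
    by apply: sum_sub => [i|]; [exact: sqr_ge0|rewrite (ltnW pj) pn].
  have := sqr_homo (L2norm_ge0 _) (fbar_contraction hf v n0).
  by rewrite L2norm_vec// ler_pdivrMr// mulrC.
rewrite -(ler_pM2l n0').
set c := vec u (p j) in h *; set l := (p j.+1 - p j)%:R in h h1 *.
have -> : n%:R * (c ^+ 2 * (l / n%:R)) = l * c ^+ 2 by field; rewrite gt_eqF.
have -> : n%:R * (16 * L2norm (f \- embed v) ^+ 2 + 16 * B ^+ 2 * (l / n%:R) + 8 * (M / n%:R)) =
  16 * (n%:R * L2norm (f \- embed v) ^+ 2) + 16 * (l * B ^+ 2) + 8 * M by field; rewrite gt_eqF.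
lra.
Qed.

End Prep.

(** * Limits of step functions along an ultrafilter *)

Section StepCompactness.
Context {R : realType}.
Variable (U : set_system nat).
Context {UU : UltraFilter U}.
Implicit Types (t c : nat -> nat -> R).

Lemma cvg0_le (a : nat -> R) : (forall n, 0 <= a n) ->
  (forall e, 0 < e -> \forall n \near U, a n <= e) -> a n @[n --> U] --> 0.
Proof.
move=> a0 H; apply/cvgrPdist_le => e e0.
by apply: filterS (H e e0) => n an; rewrite sub0r normrN ger0_norm.
Qed.

Lemma cvg_near_eq (a : nat -> R) (l c : R) :
  a n @[n --> U] --> l -> (\forall n \near U, a n = c) -> l = c.
Proof. by move=> al ac; apply: (@norm_cvg_unique R R (a @ U) _ l c al); exact: cvg_near_cst. Qed.

(** On a piece whose limit has positive length, the mass bound controls the value, which then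
    converges. On a piece that collapses the values may be unbounded, but C times the length tends
    to 0 for every C, so the mass vanishes and the limiting value can be set to 0. *)
Lemma wstep_compact m t c : (\forall n \near U, subdivision m (t n)) ->
  (forall e, 0 < e -> exists C : R, \forall n \near U, forall j, (j < m)%N ->
     c n j ^+ 2 * (t n j.+1 - t n j) <= e + C * (t n j.+1 - t n j)) ->
  exists t' c' : nat -> R, subdivision m t' /\
    L2norm (wstep m (t n) (c n) \- wstep m t' c') @[n --> U] --> 0.
Proof.
move=> tS mass.
have t01 : \forall n \near U, forall j, (j <= m)%N -> 0 <= t n j <= 1.
  apply: filterS tS => n S j jm; have mono := subdivision_mono S.
  by case: (S) => <- <- _; rewrite !mono ?leq0n//= leqnn andbT.
have /choice[tau Htau] : forall j, exists l : R, (j <= m)%N -> t n j @[n --> U] --> l.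
  move=> j; have [jm|jm] := leqP j m; last by exists 0.
  have [l Hl] := @ultra_cvg R U UU (fun n => t n j) 1 ltac:(apply: filterS t01 => n /(_ j jm) /andP[a b]; rewrite ger0_norm//).
  by exists l.
have S : subdivision m tau.
  split.
  - by apply: (cvg_near_eq (Htau 0%N (leq0n m))); apply: filterS tS => n [].
  - by apply: (cvg_near_eq (Htau m (leqnn m))); apply: filterS tS => n [].
  - move=> j jm; apply: (ler_cvg_to (Htau j (ltnW jm)) (Htau j.+1 jm)).
    by apply: filterS tS => n [_ _]; exact.
have Dcvg j : (j < m)%N -> t n j.+1 - t n j @[n --> U] --> tau j.+1 - tau j.
  by move=> jm; apply: cvgB; apply: Htau => //; exact: ltnW.
have /choice[c' Hc'] : forall j, exists l : R, (j < m)%N ->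
    (tau j < tau j.+1 -> c n j @[n --> U] --> l) /\ (tau j = tau j.+1 -> l = 0).
  move=> j; have [jm|jm] := ltnP j m; last by exists 0.
  have [tj|tj] := eqVneq (tau j) (tau j.+1); first by exists 0; rewrite tj ltxx.
  have tj' : tau j < tau j.+1 by rewrite lt_neqAle tj; case: S => _ _ ->.
  have [C HC] := mass 1 ltr01.
  set d := (tau j.+1 - tau j) / 2.
  have d0 : 0 < d by rewrite divr_gt0// subr_gt0.
  have nd : \forall n \near U, d <= t n j.+1 - t n j.
    by apply: (cvgr_ge _ (Dcvg j jm)); rewrite /d ltr_pdivrMr// ltr_pMr ?subr_gt0// ltr1n.
  have [l Hl] : exists l : R, c n j @[n --> U] --> l.
    apply: (@ultra_cvg R U UU (fun n => c n j) (1 + (1 + `|C|) / d)).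
    apply: filterS (filterI (filterI nd HC) t01) => n [[h1 /(_ j jm) h2] h01].
    have /andP[a1 b1] := h01 j (ltnW jm); have /andP[a2 b2] := h01 j.+1 jm.
    set D := t n j.+1 - t n j in h1 h2.
    have D1 : D <= 1 by rewrite /D; lra.
    have h3 : c n j ^+ 2 * d <= 1 + `|C|.
      apply: (@le_trans _ _ (c n j ^+ 2 * D)); first by rewrite ler_wpM2l ?sqr_ge0.
      apply: (le_trans h2); rewrite lerD2l; apply: (le_trans (ler_norm _)).
      have D0 := le_trans (ltW d0) h1.
      by rewrite normrM (ger0_norm D0) ler_piMr.
    have h4 : c n j ^+ 2 <= (1 + `|C|) / d by rewrite ler_pdivlMr.
    apply: le_trans (_ : 1 + c n j ^+ 2 <= _); last by rewrite lerD2l.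
    rewrite -[c n j ^+ 2]real_normK ?num_real//.
    by have := sqr_ge0 (`|c n j| - 1); have := normr_ge0 (c n j); nra.
  by exists l => _; split => // E; rewrite E eqxx in tj.
exists tau, c'; split => //.
set piece := fun n (i : 'I_m) => L2norm (fun x => c n i * \1_(`[t n i, t n i.+1[) x - c' i * \1_(`[tau i, tau i.+1[) x).
have main (i : 'I_m) : piece n i @[n --> U] --> 0.
  have im := ltn_ord i; have [Hc0 Hc1] := Hc' i im.
  have [ti|ti] := eqVneq (tau i) (tau i.+1).
    apply: cvg0_le => [n|e e0]; first exact: L2norm_ge0.
    have e2 : 0 < e ^+ 2 / 2 by rewrite divr_gt0 ?exprn_gt0.
    have [C HC] := mass _ e2.
    have D0 : \forall n \near U, C * (t n i.+1 - t n i) < e ^+ 2 / 2.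
      have h : C * (t n i.+1 - t n i) @[n --> U] --> C * 0.
        by apply: cvgMr; have := Dcvg i im; rewrite ti subrr.
      by apply: (cvgr_lt _ h); rewrite mulr0.
    apply: filterS (filterI (filterI HC D0) tS) => n [[/(_ i im) h1 /= h2] [_ _ /(_ i im) h3]].
    rewrite /piece Hc1//.
    rewrite (_ : (fun x => _) = fun x => c n i * \1_(`[t n i, t n i.+1[) x); last first.
      by apply/funext => x; rewrite mul0r subr0.
    apply: (le_trans (L2norm_indic _ h3)).
    rewrite -sqrtr_sqr -sqrtrM ?sqr_ge0// -[leRHS](ger0_norm (ltW e0)) -[leRHS]sqrtr_sqr.
    by apply: ler_wsqrtr; lra.
  have ti' : tau i < tau i.+1 by rewrite lt_neqAle ti; case: S => _ _ ->.
  have cc := Hc0 ti'.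
  apply: (@squeeze_cvgr _ _ _ _ (fun=> 0) (fun n => `|c n i - c' i| +
     (`|c' i| * Num.sqrt `|t n i.+1 - tau i.+1| + `|c' i| * Num.sqrt `|t n i - tau i|))).
  - apply: filterS (filterI tS t01) => n [[_ _ /(_ i im) h3] h01].
    rewrite L2norm_ge0/= L2norm_piece_sub//; first exact: ltW.
    have /andP[a1 b1] := h01 i (ltnW im); have /andP[a2 b2] := h01 i.+1 im.
    lra.
  - exact: cvg_cst.
  - have dist (a : nat -> R) l : a n @[n --> U] --> l -> `|a n - l| @[n --> U] --> 0.
      move=> al; rewrite -[X in _ --> X](normr0 R); apply: cvg_norm.
      by rewrite -(subrr l); apply: cvgB => //; exact: cvg_cst.
    have sq (a : nat -> R) l : a n @[n --> U] --> l -> `|c' i| * Num.sqrt `|a n - l| @[n --> U] --> 0.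
      move=> /dist al; rewrite -(mulr0 `|c' i|); apply: cvgMr.
      rewrite -[X in _ --> X](@sqrtr0 R).
      exact: (cvg_comp _ _ al (@sqrt_continuous R 0)).
    rewrite -(addr0 0); apply: cvgD; first exact: dist.
    rewrite -(addr0 0); apply: cvgD; apply: sq; apply: Htau => //; exact: ltnW.
apply: (@squeeze_cvgr _ _ _ _ (fun=> 0) (fun n => \sum_(i < m) piece n i)).
- by apply: nearW => n; rewrite L2norm_ge0/= L2norm_wstep_sub.
- exact: cvg_cst.
- rewrite -[X in _ --> X](@big1 R 0 +%R 'I_m (index_enum _) predT (fun=> 0))//.
  apply: (@cvg_big R 'I_m +%R 0 predT _ nat U (index_enum _) (fun i n => piece n i) (fun=> 0)).
    exact: add_continuous.
  by move=> i _; exact: main.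
Qed.

End StepCompactness.

Lemma embed0 (R : realType) n : embed (0 : 'rV[R]_n) = fun=> 0.
Proof. by apply/funext => y; rewrite /embed big1// => i _; rewrite mxE mul0r. Qed.

Lemma njump_vec0 (R : realType) n : njump (vec (0 : 'rV[R]_n)) n = 0%N.
Proof.
rewrite (@eq_njump _ _ _ (fun=> 0)); last by move=> i iN; rewrite -[i]/(val (Ordinal iN)) vec_ord mxE.
by rewrite /njump big1// => i _; rewrite eqxx.
Qed.

(** * Convergence to the unique minimizer *)

Section UniqueMinimizer.
Context {R : realType}.
Variables (f fg : R -> R) (gamma0 : R).
Hypotheses (hf : in_L2 f) (g0 : 0 < gamma0) (hfg : unique_minimizer_cont gamma0 f fg).
Variables (u : forall n, 'rV[R]_n) (x : forall n, 'I_n -> R) (gamma M : nat -> R).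
Let mu n := M n / n%:R.
Let good n := potts_argmin (gamma n) (\row_(i < n) (cell_mean f n i + x i)) (u n) /\
  noise_le (ext (x (n := n))) n (M n).

(** The zero function has finite energy, so the minimizer does too and therefore lies in the step
    space. *)
Lemma minimizer_step : exists m t alpha, [/\ subdivision m t, L2eq (wstep m t alpha) fg &
  ((gamma0 * m.-1%:R + L2norm (f \- fg) ^+ 2)%:E <= potts_cont gamma0 fg f)%E].
Proof.
have [L2fg fgmin _] := hfg.
have S1 : subdivision 1 (fun i : nat => i%:R : R) by split => // i _; rewrite ler_nat.
have fgS : in_step_space fg.
  have := le_trans (fgmin _ (in_L2_wstep 1 (fun i => i%:R) (fun=> 0)))
    (potts_cont_wstep_le (fun=> 0) f (ltW g0) S1).
  rewrite /potts_cont; case: ifP => [/asboolP//|_]; by rewrite leye_eq.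
have [m [t [alpha [S ae lec]]]] := counting_jump_set_ge fgS.
exists m, t, alpha; split => //.
rewrite /potts_cont asboolT// EFinD leeD2r// EFinM lee_wpmul2l ?lee_fin//; exact: ltW.
Qed.

Variable (U : set_system nat).
Context {UU : UltraFilter U}.
Hypothesis (Uoo : \oo `<=` U).
Hypotheses (hgamma : gamma n @[n --> U] --> gamma0) (hmu : mu n @[n --> U] --> 0)
  (hgood : \forall n \near U, good n).

Lemma near_large N : \forall n \near U, (N <= n)%N.
Proof. by apply: Uoo; exists N. Qed.

(** The oracle inequality is used with the zero vector as competitor. Along [U], gamma is at least
    gamma0 / 2 and 4 M / n at most gamma0 / 4, so half of the penalty survives the noise. *)
Lemma njump_bounded : exists K, \forall n \near U, (njump (vec (u n)) n <= K)%N.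
Proof.
pose B := 6 * L2norm f ^+ 2 / gamma0 + 1.
exists (Num.truncn B).
have h1 : \forall n \near U, gamma0 / 2 <= gamma n.
  by apply: (cvgr_ge _ hgamma); rewrite ltr_pdivrMr// ltr_pMr// ltr1n.
have h2 : \forall n \near U, mu n <= gamma0 / 16.
  by apply: (cvgr_le _ hmu); rewrite divr_gt0.
apply: filterS (filterI (filterI h1 h2) (filterI hgood (near_large 1))) => n [/= [a b] [[hu hx] n0]].
have := fit_oracle hf 0 n0 hu hx.
rewrite embed0 njump_vec0 (_ : f \- (fun=> 0) = f); last by apply/funext => y /=; rewrite subr0.
rewrite addn0 mulr0 addr0 -/(mu n).
set J := njump _ _; set A := L2norm (embed _ \- _); set F := L2norm f.
have A0 : 0 <= A ^+ 2 / 2 by rewrite divr_ge0 ?sqr_ge0.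
move=> h.
have J0 : 0 <= J%:R :> R by [].
have c1 : 4 * J.+1%:R * mu n <= J.+1%:R * (gamma0 / 4).
  by rewrite -mulrA [4 * _]mulrC -mulrA ler_wpM2l//; move: (mu n) b => q; lra.
have c2 : gamma0 / 2 * J%:R <= gamma n * J%:R by rewrite ler_wpM2r.
rewrite -[J.+1%:R]natr1 in c1 h.
have c3 : gamma0 / 4 * J%:R <= 3 / 2 * F ^+ 2 + gamma0 / 4 by move: (mu n) c1 h => q; lra.
rewrite -[J](@natrK R) le_truncn// /B -(ler_pM2l g0).
have -> : gamma0 * (6 * L2norm f ^+ 2 / gamma0 + 1) = 6 * F ^+ 2 + gamma0 by rewrite /F; field; rewrite gt_eqF.
lra.
Qed.

Lemma limit_step : exists k t c, [/\ subdivision k.+1 t,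
  \forall n \near U, njump (vec (u n)) n = k &
  L2norm (embed (u n) \- wstep k.+1 t c) @[n --> U] --> 0].
Proof.
have [K HK] := njump_bounded.
have [k Hk] := ultra_pigeonhole HK.
have /choice[p Hp] : forall n, exists p, (0 < n)%N -> pieces (vec (u n)) n (njump (vec (u n)) n) p.
  move=> [|n]; first by exists id.
  by have [p] := @pieces_exist _ (vec (u n.+1)) n.+1 isT; exists p.
have HP : \forall n \near U, (0 < n)%N /\ pieces (vec (u n)) n k (p n).
  by apply: filterS (filterI Hk (near_large 1)) => n [E n0]; split => //; rewrite -E; exact: Hp.
pose t n j : R := design n (p n j); pose c n j := vec (u n) (p n j).
have tS : \forall n \near U, subdivision k.+1 (t n).
  by apply: filterS HP => n [n0 /(embed_pieces n0)[]].
have gpos : \forall n \near U, 0 <= gamma n by apply: (cvgr_ge _ hgamma).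
have mass (e : R) : 0 < e -> exists C : R, \forall n \near U, forall j, (j < k.+1)%N ->
    c n j ^+ 2 * (t n j.+1 - t n j) <= e + C * (t n j.+1 - t n j).
  (* The accuracy squared is e/32 and M / n is at most e/16, so that 16 (e/32) + 8 (e/16) = e in
     [run_mass_small]. *)
  move=> e0; have e1 : 0 < Num.sqrt (e / 32) by rewrite sqrtr_gt0 divr_gt0.
  have [m [s [alpha [N [S HN]]]]] := sample_dense hf e1.
  pose B := \sum_(i < m) `|alpha i|.
  have B0 : 0 <= B by apply: sumr_ge0.
  exists (16 * B ^+ 2).
  have smu : \forall n \near U, mu n <= e / 16 by apply: (cvgr_le _ hmu); rewrite divr_gt0.
  apply: filterS (filterI (filterI gpos smu) (filterI (filterI HP hgood) (near_large N))).
  move=> n [/= [gn smn] [[[n0 Hpn] [hu hx]] nN]] j jk.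
  have vB i : `|vec (sample (wstep m s alpha) n) i| <= B.
    have [iN|iN] := ltnP i n.
      by rewrite -[i]/(val (Ordinal iN)) vec_ord mxE; exact: wstep_bound.
    by rewrite /vec /ext insubF ?normr0//; apply/negbTE; rewrite -leqNgt.
  have h := run_mass_small hf n0 gn hu hx Hpn jk vB.
  have [_ h2] := HN n nN.
  have h3 := sqr_homo (L2norm_ge0 _) h2.
  rewrite sqr_sqrtr ?divr_ge0 ?(ltW e0)// in h3.
  rewrite -/(mu n) -/(c n j) -/(t n j) -/(t n j.+1) in h.
  by apply: le_trans h _; move: (mu n) smn => q; lra.
have [t' [c' [S cv]]] := wstep_compact tS mass.
exists k, t', c'; split => //.
apply: (cvg_trans _ cv); apply: near_eq_cvg.
apply: filterS HP => n [n0 Hpn].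
have [Sn aen] := embed_pieces n0 Hpn.
apply: L2norm_eq.
- by apply: in_L2B; exact: in_L2_wstep.
- by apply: in_L2B; [exact: in_L2_embed|exact: in_L2_wstep].
- by apply: L2eq_sub; exact: L2eq_sym.
Qed.

Lemma minimizer_limit : L2norm (embed (u n) \- fg) @[n --> U] --> 0.
Proof.
have [L2fg fgmin fguniq] := hfg.
have [k [t [c [S Hk cv]]]] := limit_step.
have [m [s [alpha [Ss ae pfg]]]] := minimizer_step.
set g := wstep k.+1 t c in cv; have L2g : in_L2 g by exact: in_L2_wstep.
pose v n := sample (wstep m s alpha) n.
have cdist (a b : nat -> R -> R) (h h' : R -> R) : (forall n, in_L2 (a n)) -> (forall n, in_L2 (b n)) ->
    in_L2 h -> in_L2 h' ->
    L2norm (a n \- h) @[n --> U] --> 0 -> L2norm (b n \- h') @[n --> U] --> 0 ->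
    L2norm (a n \- b n) @[n --> U] --> L2norm (h \- h').
  move=> ha hb Lh Lh' ca cb; apply/cvgrPdist_le => e e0; have e2 : 0 < e / 2 by rewrite divr_gt0.
  have na : \forall n \near U, L2norm (a n \- h) <= e / 2 by exact: (cvgr_le _ ca).
  have nb : \forall n \near U, L2norm (b n \- h') <= e / 2 by exact: (cvgr_le _ cb).
  apply: filterS (filterI na nb) => n [/= n1 n2].
  have q1 := L2norm_tri (ha n) Lh (hb n); have q2 := L2norm_tri Lh Lh' (hb n).
  have q3 := L2norm_tri Lh (ha n) Lh'; have q4 := L2norm_tri (ha n) (hb n) Lh'.
  rewrite (L2norm_distC h (a n)) in q3; rewrite (L2norm_distC h' (b n)) in q2.
  by rewrite ler_norml; lra.
have cfb : L2norm (embed (fbar f n) \- f) @[n --> U] --> 0.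
  apply: cvg0_le => [n|e e0]; first exact: L2norm_ge0.
  have [N HN] := fbar_cvg hf e0.
  by apply: filterS (near_large N) => n /HN[].
have cvv : L2norm (embed (v n) \- wstep m s alpha) @[n --> U] --> 0.
  apply: cvg0_le => [n|e e0]; first exact: L2norm_ge0.
  have e2 : 0 < e ^+ 2 by rewrite exprn_gt0.
  have [N HN] := sqrtn_eventually ((2 * (\sum_(i < m) `|alpha i|)) ^+ 2 * m.+1%:R) e2.
  apply: filterS (near_large N) => n /HN[n0 Dn]; rewrite L2norm_distC.
  apply: L2norm_le_sqr; first exact: ltW.
  exact: le_trans (sample_error_sqr alpha Ss n0) Dn.
have L2s := in_L2_wstep m s alpha.
have cA := cdist _ _ _ _ (fun n => in_L2_embed (u n)) (fun n => in_L2_embed (fbar f n)) L2g hf cv cfb.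
have cY := cdist _ _ _ _ (fun n => in_L2_embed (v n)) (fun n => in_L2_embed (fbar f n)) L2s hf cvv cfb.
have cZ := cdist _ _ _ _ (fun n => in_L2_embed (u n)) (fun n => in_L2_embed (v n)) L2g L2s cv cvv.
set A := L2norm (g \- f) in cA; set Y := L2norm (_ \- f) in cY; set Z := L2norm (_ \- _) in cZ.
have sqc (a : nat -> R) (l : R) : a n @[n --> U] --> l -> a n ^+ 2 @[n --> U] --> l ^+ 2.
  by move=> al; rewrite expr2; under eq_fun do rewrite expr2; exact: cvgM.
(* For fixed [l] the noise term is a constant times M / n and vanishes in the limit, leaving only l
   Z^2. The limit in n therefore precedes the limit in [l]. *)
have lim l : 0 < l -> A ^+ 2 + gamma0 * k%:R <= Y ^+ 2 + gamma0 * m.-1%:R + l * Z ^+ 2.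
  move=> l0.
  have c1 : L2norm (embed (u n) \- embed (fbar f n)) ^+ 2 + gamma n * k%:R @[n --> U]
      --> A ^+ 2 + gamma0 * k%:R by apply: cvgD; [exact: sqc|exact: cvgMl].
  have c2 : L2norm (embed (v n) \- embed (fbar f n)) ^+ 2 + gamma n * m.-1%:R +
     (l * L2norm (embed (u n) \- embed (v n)) ^+ 2 + (k + m.-1).+1%:R / l * mu n) @[n --> U]
      --> Y ^+ 2 + gamma0 * m.-1%:R + (l * Z ^+ 2 + (k + m.-1).+1%:R / l * 0).
    apply: cvgD; first by apply: cvgD; [exact: sqc|exact: cvgMl].
    by apply: cvgD; [apply: cvgMr; exact: sqc|exact: cvgMr].
  rewrite mulr0 addr0 in c2.
  apply: (ler_cvg_to c1 c2).
  have gpos : \forall n \near U, 0 <= gamma n by apply: (cvgr_ge _ hgamma).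
  apply: filterS (filterI (filterI Hk gpos) (filterI hgood (near_large 1))) => n [/= [E gn] [[hu hx] n0]].
  have n0' : 0 < n%:R :> R by rewrite ltr0n.
  have M0 := noise_le_ge0 n0 hx.
  rewrite observationE in hu.
  have := argmin_energy (vec (v n)) n0 l0 hu hx; rewrite E.
  have jv : (njump (vec (v n)) n <= m.-1)%N by exact: njump_vec_sample.
  rewrite !L2norm_vec// => h.
  rewrite -(ler_pM2l n0').
  have -> : n%:R * (sqd n (vec (u n)) (vec (fbar f n)) / n%:R + gamma n * k%:R) =
    sqd n (vec (u n)) (vec (fbar f n)) + n%:R * gamma n * k%:R by field; rewrite gt_eqF.
  apply: (le_trans h).
  have -> : n%:R * (sqd n (vec (v n)) (vec (fbar f n)) / n%:R + gamma n * m.-1%:R +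
      (l * (sqd n (vec (u n)) (vec (v n)) / n%:R) + (k + m.-1).+1%:R / l * mu n)) =
      sqd n (vec (v n)) (vec (fbar f n)) + n%:R * gamma n * m.-1%:R +
      (l * sqd n (vec (u n)) (vec (v n)) + (k + m.-1).+1%:R * (M n / l)).
    by rewrite /mu; field; rewrite !gt_eqF.
  rewrite lerD//.
    by rewrite lerD2l ler_wpM2l ?mulr_ge0// ler_nat.
  by rewrite lerD2l ler_wpM2r ?divr_ge0 ?(ltW l0)// ler_nat ltnS leq_add2l.
have lim0 : A ^+ 2 + gamma0 * k%:R <= Y ^+ 2 + gamma0 * m.-1%:R.
  apply/ler_addgt0Pr => e e0.
  have Z1 : 0 < 1 + Z ^+ 2 by have := sqr_ge0 Z; lra.
  (* Dividing by 1 + Z^2 rather than Z^2 covers Z = 0. *)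
  have := lim (e / (1 + Z ^+ 2)) (divr_gt0 e0 Z1).
  have : e / (1 + Z ^+ 2) * Z ^+ 2 <= e.
    by rewrite mulrAC ler_pdivrMr// ler_pM2l//; lra.
  lra.
have YE : Y = L2norm (f \- fg).
  by rewrite (L2norm_distC f); apply: L2norm_eq; [exact: in_L2B|exact: in_L2B|exact: L2eq_sub].
have gfg : L2eq g fg.
  (* If pieces merge, the limit has fewer than k jumps; the upper bound k on its number of jumps is
     enough for this comparison. *)
  apply: fguniq => // h Lh; apply: le_trans (fgmin h Lh).
  apply: le_trans pfg; apply: le_trans (potts_cont_wstep_le c f (ltW g0) S) _.
  rewrite lee_fin (L2norm_distC f) -/g -/A -YE /=; lra.
have z0 : L2norm (g \- fg) = 0.
  have -> : L2norm (g \- fg) = L2norm (g \- g).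
    by rewrite L2norm_distC; apply: L2norm_eq; [exact: in_L2B|exact: in_L2B|exact/L2eq_sub/L2eq_sym].
  apply/eqP; rewrite eq_le L2norm_ge0 andbT; apply: L2norm_le => //; first exact: in_L2B.
  rewrite (_ : (fun x => _) = fun=> 0) ?Rintegral_cst ?mul0r ?expr0n//.
  by apply/funext => y /=; rewrite subrr expr0n.
apply: cvg0_le => [n|e e0]; first exact: L2norm_ge0.
have ng : \forall n \near U, L2norm (embed (u n) \- g) <= e by exact: (cvgr_le _ cv).
apply: filterS ng => n h.
by have := L2norm_tri (in_L2_embed (u n)) L2g L2fg; rewrite z0; lra.
Qed.

End UniqueMinimizer.

(** If convergence fails, the indices at distance more than some [e] meet every neighbourhood of
    infinity. An ultrafilter refining infinity and containing them would contradict
    [minimizer_limit]. *)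
Lemma unique_minimizer_cvg {R : realType} (f fg : R -> R) (gamma0 : R)
    (u : forall n, 'rV[R]_n) (x : forall n, 'I_n -> R) (gamma M : nat -> R) :
  in_L2 f -> 0 < gamma0 -> unique_minimizer_cont gamma0 f fg ->
  gamma n @[n --> \oo] --> gamma0 -> M n / n%:R @[n --> \oo] --> 0 ->
  (\forall n \near \oo, potts_argmin (gamma n) (\row_(i < n) (cell_mean f n i + x n i)) (u n) /\
     noise_le (ext (x n)) n (M n)) ->
  L2norm (embed (u n) \- fg) @[n --> \oo] --> 0.
Proof.
move=> hf g0 hfg cg cM good; apply: contrapT => ncv.
have [e e0 bad] : exists2 e : R, 0 < e & ~ \forall n \near \oo, L2norm (embed (u n) \- fg) <= e.
  apply: contrapT => H; apply: ncv; apply/cvgrPdist_le => e e0.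
  apply: contrapT => H2; apply: H; exists e => // H3; apply: H2.
  by apply: filterS H3 => n h; rewrite sub0r normrN ger0_norm// L2norm_ge0.
pose bads := [set n | ~ L2norm (embed (u n) \- fg) <= e].
have FP : ProperFilter (within bads \oo).
  apply: Build_ProperFilter_ex.
  move=> S; rewrite /within /= => WS; apply: contrapT => S0; apply: bad.
  apply: filterS WS => n h; apply: contrapT => nb.
  by apply: S0; exists n; exact: h.
have [U [UU FU]] := @ultraFilterLemma _ _ FP.
have Uoo : \oo `<=` U by move=> S oS; apply: FU; apply: filterS oS => n.
have cv := @minimizer_limit R f fg gamma0 hf g0 hfg u x gamma M U UU Uoo
  (cvg_trans (cvg_app _ Uoo) cg) (cvg_trans (cvg_app _ Uoo) cM) (Uoo _ good).
have h : \forall n \near U, L2norm (embed (u n) \- fg) <= e by exact: (cvgr_le _ cv).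
have hb : U bads by apply: FU; exact: withinT.
have hI : U ([set n | L2norm (embed (u n) \- fg) <= e] `&` bads) by exact: filterI.
by have [n [/= a b]] := filter_ex hI.
Qed.

(** * Almost sure convergence *)

(** ln n = 2 ln (sqrt n) <= 2 sqrt n, so the quotient is at most 2 / sqrt n. *)
Lemma ln_div_cvg0 (R : realType) : ln n%:R / n%:R @[n --> \oo] --> (0 : R).
Proof.
have sq0 : (Num.sqrt (n%:R^-1) : R) @[n --> \oo] --> (0 : R).
  rewrite -[X in _ --> X](@sqrtr0 R).
  have c : (n%:R^-1 : R) @[n --> \oo] --> (0 : R) by rewrite -cvg_shiftS; exact: cvg_harmonic.
  exact: (cvg_comp _ _ c (@sqrt_continuous R 0)).
apply: (@squeeze_cvgr _ _ _ _ (fun=> 0) (fun n => 2 * Num.sqrt (n%:R^-1))).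
- near=> n; have n0 : (0 < n)%N by near: n; exists 1%N.
  have n1 : 1 <= n%:R :> R by rewrite ler1n.
  have n0' : 0 < n%:R :> R by rewrite ltr0n.
  rewrite divr_ge0 ?ln_ge0//= ler_pdivrMr// sqrtrV ?ler0n//.
  have s0 : 0 < Num.sqrt n%:R :> R by rewrite sqrtr_gt0.
  have E : n%:R = Num.sqrt n%:R * Num.sqrt n%:R :> R by rewrite -expr2 sqr_sqrtr ?ltW.
  rewrite {3}E mulrA mulfVK ?gt_eqF// {1}E lnM ?posrE//.
  have := @le_ln1Dx R (Num.sqrt n%:R - 1) ltac:(lra).
  by rewrite addrC subrK; lra.
- exact: cvg_cst.
- by rewrite -(mulr0 2); apply: cvgMr.
Unshelve. all: by end_near.
Qed.

Section NoiseEventually.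
Context {d : measure_display} {T : measurableType d} {R : realType}.
Variable P : probability T R.

(** The Borel-Cantelli lemma for a quadratic tail; the shift by 2 matches [noise_bad_le], which
    requires n > 1. *)
Lemma eventually_not (F : nat -> set T) (C : R) : (forall n, measurable (F n)) ->
  (forall n, (P (F n) <= (C / n.+2%:R ^+ 2)%:E)%E) ->
  {ae P, forall w, \forall n \near \oo, ~ F n w}.
Proof.
move=> mF FC.
have C0 : 0 <= C.
  have := le_trans (measure_ge0 P (F 0%N)) (FC 0%N).
  by rewrite lee_fin pmulr_lge0// invr_gt0 exprn_gt0.
have fin : (\sum_(n <oo) P (F n) < +oo)%E.
  apply: (@le_lt_trans _ _ C%:E); last exact: ltry.
  apply: lime_le; first exact: is_cvg_nneseries.
  apply: nearW => N.
  (* The telescoping majorant 1 - 1/(N+1) bounds the sum of the 1/(i+2)^2. *)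
  have h : \sum_(0 <= i < N) (C / i.+2%:R ^+ 2) <= C * (1 - N.+1%:R^-1).
    elim: N => [|N IH]; first by rewrite big_geq// invr1 subrr mulr0.
    rewrite big_nat_recr//=; apply: (@le_trans _ _ (C * (1 - N.+1%:R^-1) + C / N.+2%:R ^+ 2)).
      by rewrite lerD2r.
    rewrite -mulrDr ler_wpM2l//.
    have -> : N.+2%:R = N.+1%:R + 1 :> R by rewrite natr1.
    set L := N.+1%:R; have L0 : 0 < L :> R by rewrite ltr0n.
    rewrite -subr_ge0.
    have -> : 1 - (L + 1)^-1 - (1 - L^-1 + (L + 1) ^- 2) = (L * (L + 1) ^+ 2)^-1.
      by field; rewrite !gt_eqF//; lra.
    by rewrite invr_ge0 mulr_ge0 ?sqr_ge0// ltW.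
  apply: (@le_trans _ _ (\sum_(0 <= i < N) (C / i.+2%:R ^+ 2)%:E)%E).
    by apply: lee_sum => i _.
  rewrite sumEFin lee_fin; apply: (le_trans h).
  by rewrite ler_piMr// lerBlDr lerDl invr_ge0.
have null := lim_sup_set_cvg0 mF fin.
exists (lim_sup_set F); split => //.
  by apply: bigcap_measurableType => n _; apply: bigcup_measurable.
move=> w /= nw; rewrite /lim_sup_set /= => N _.
apply: contrapT => H; apply: nw; exists N => // j /= Nj Fj.
by apply: H; exists j.
Qed.

Variable xi : forall n : nat, 'I_n -> {RV P >-> R}.
Hypothesis hxi : condition_A xi.

(** Increasing the constant weakens the moment bound, and a positive one can stand in denominators
    of the tail exponents. *)
Lemma noise_subgaussian_pos : exists2 beta : R, 0 < beta &
  forall n (i : 'I_n) nu, ('M_P (xi i) nu <= (expR (beta * nu ^+ 2))%:E)%E.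
Proof.
have [_ _ [beta H]] := hxi.
exists (Num.max beta 1); first by rewrite lt_max ltr01 orbT.
move=> n i nu; apply: le_trans (H n i nu) _; rewrite lee_fin ler_expR.
by rewrite ler_wpM2r ?sqr_ge0// le_max lexx.
Qed.

Lemma noise_eventually (beta : R) : 0 < beta ->
  (forall n (i : 'I_n) nu, ('M_P (xi i) nu <= (expR (beta * nu ^+ 2))%:E)%E) ->
  {ae P, forall w, \forall n \near \oo,
    noise_le (ext ((@xi n)^~ w)) n ((beta + 4) ^+ 2 * ln n%:R)}.
Proof.
move=> b0 mgf.
have := @eventually_not (fun n => noise_bad (@xi n.+2) ((beta + 4) ^+ 2 * ln n.+2%:R)) 2.
case.
- by move=> n; have [] := deviates_someP (@xi n.+2) (segs n.+2) (fun e => Num.sqrt ((e.2 - e.1)%:R * ((beta + 4) ^+ 2 * ln n.+2%:R))).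
- by move=> n; apply: noise_bad_le => //; exact: (noise_independent hxi).
move=> A [mA A0 sA]; exists A; split => // w /= nw; apply: sA => /= -[N _ HN].
apply: nw; exists N.+2 => // n /= Nn.
have [n' nE] : exists n', n = n'.+2 by exists n.-2; case: n Nn => // -[].
subst n; apply: noise_badE; last by apply: HN; rewrite /=.
by rewrite mulr_ge0 ?sqr_ge0// ln_ge0// ler1n.
Qed.

End NoiseEventually.

Lemma dominates_ln (R : realType) (g : nat -> R) (C : R) :
  g n * n%:R / ln n%:R @[n --> \oo] --> +oo ->
  \forall n \near \oo, C * ln n%:R < g n * n%:R.
Proof.
move=> /cvgryPgt/(_ C) h; near=> n.
have n1 : (1 < n)%N by near: n; exists 2%N.
rewrite -ltr_pdivlMr; last by rewrite ln_gt0// ltr1n.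
by near: n.
Unshelve. all: by end_near.
Qed.

Lemma in_step_space_wstep (R : realType) (f : R -> R) : in_step_space f ->
  exists m t alpha, [/\ subdivision m t, (forall i, (i < m)%N -> t i < t i.+1),
    (forall i, (i.+1 < m)%N -> alpha i != alpha i.+1) & L2eq (wstep m t alpha) f].
Proof.
move=> [s /step_functionP[m [t [alpha [S _ ->]]]] sf].
have [m' [t' [alpha' [_ S' E tlt ane]]]] := wstep_reduce alpha S.
by exists m', t', alpha'; split => //; rewrite -E.
Qed.

Section AlmostSure.
Context {d : measure_display} {T : measurableType d} {R : realType}.
Variables (P : probability T R) (xi : forall n : nat, 'I_n -> {RV P >-> R}).
Variables (f : R -> R) (gamma : nat -> {RV P >-> R}) (fhat : nat -> T -> R -> R).
Hypotheses (hxi : condition_A xi) (hf : in_L2 f).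
Hypothesis hfhat : forall n w, (0 < n)%N ->
      (@embed R n @` potts_argmin (gamma n w) (observation f xi n w)) (fhat n w).

Lemma strong_consistency_fixed (gamma0 : R) (fgamma : R -> R) : 0 < gamma0 ->
  unique_minimizer_cont gamma0 f fgamma ->
  {ae P, forall w, gamma n w @[n --> \oo] --> gamma0} ->
  {ae P, forall w, L2norm (fhat n w \- fgamma) @[n --> \oo] --> 0}.
Proof.
move=> g0 um gcv; have [beta b0 mgf] := noise_subgaussian_pos hxi.
have nle := noise_eventually hxi b0 mgf.
move: gcv nle; apply: filterS2 => w gw nw.
have ex n : exists u : 'rV[R]_n, (0 < n)%N ->
    potts_argmin (gamma n w) (observation f xi n w) u /\ embed u = fhat n w.
  have [->|n0] := posnP n; first by exists 0.
  by have [u hu uE] := hfhat w n0; exists u.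
pose u n := sval (cid (ex n)); have hu n := svalP (cid (ex n)).
have cM : (beta + 4) ^+ 2 * ln n%:R / n%:R @[n --> \oo] --> (0 : R).
  under eq_fun do rewrite -mulrA.
  by rewrite -(mulr0 ((beta + 4) ^+ 2)); apply: cvgMr; exact: ln_div_cvg0.
have cv := @unique_minimizer_cvg R f fgamma gamma0 u (fun n i => xi i w) (fun n => gamma n w) _
  hf g0 um gw cM.
have pos : \forall n \near \oo, (0 < n)%N by exists 1%N.
have good : forall n, (0 < n)%N -> noise_le (ext ((@xi n)^~ w)) n ((beta + 4) ^+ 2 * ln n%:R) ->
  potts_argmin (gamma n w) (\row_(i < n) (cell_mean f n i + xi i w)) (u n) /\
  noise_le (ext ((@xi n)^~ w)) n ((beta + 4) ^+ 2 * ln n%:R).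
  by move=> n n0; split => //; have [] := hu n n0.
have {}cv : L2norm (embed (u n) \- fgamma) @[n --> \oo] --> 0.
  by apply: cv; apply: filterS (filterI pos nw) => n [n0 xn]; exact: good.
apply: cvg_trans cv; apply: near_eq_cvg; apply: filterS pos => n n0.
by have [_ <-] := hu n n0.
Qed.

Hypotheses (g0 : {ae P, forall w, gamma n w @[n --> \oo] --> 0})
  (gln : {ae P, forall w, gamma n w * n%:R / ln n%:R @[n --> \oo] --> +oo}).

Lemma strong_consistency : {ae P, forall w, L2norm (fhat n w \- f) @[n --> \oo] --> 0}.
Proof.
have [beta b0 mgf] := noise_subgaussian_pos hxi.
have nle := noise_eventually hxi b0 mgf.
move: g0 gln nle; apply: filterS3 => w gw dw nw.
apply/cvgrPdist_le => e e0.
have [N [c [c0 H]]] := consistency hf e0.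
have gc : \forall n \near \oo, gamma n w <= c by exact: (cvgr_le _ gw).
have gd := dominates_ln (4 * (beta + 4) ^+ 2) dw.
near=> n; have n0 : (0 < n)%N by near: n; exists 1%N.
rewrite sub0r normrN ger0_norm ?L2norm_ge0//.
have [u hu <-] := hfhat w n0.
apply: (H n (gamma n w) ((beta + 4) ^+ 2 * ln n%:R) u (fun i => xi i w)) => //.
- by near: n; exists N.
- by near: n.
- rewrite mulrA ler_pdivrMr ?ltr0n// mulrA; apply: ltW; by near: n.
- by near: n.
Unshelve. all: by end_near.
Qed.

Lemma strong_rate : in_step_space f ->
  {ae P, forall w, (fun n : nat => L2norm (fhat n w \- f) : R)
          =O_\oo (fun n : nat => Num.sqrt (ln n%:R / n%:R) : R)}.
Proof.
move=> /in_step_space_wstep[m [t [alpha [S tlt ane sf]]]].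
have [beta b0 mgf] := noise_subgaussian_pos hxi.
have nle := noise_eventually hxi b0 mgf.
have [N [c [K [c0 K0 H]]]] := step_rate hf S tlt ane sf.
move: g0 gln nle; apply: filterS3 => w gw dw nw.
have gc : \forall n \near \oo, gamma n w <= c by exact: (cvgr_le _ gw).
have gd := dominates_ln (4 * (beta + 4) ^+ 2) dw.
set B := (beta + 4) ^+ 2.
have B0 : 0 <= B by exact: sqr_ge0.
have l2 : 0 < ln 2 :> R by rewrite ln_gt0// ltr1n.
(* Since ln n >= ln 2, the 1 in 1 + M is at most ln n / ln 2, so 1 + M is at most ((ln 2)^-1 + B) ln
   n. *)
pose L := K * ((ln 2)^-1 + B).
have L0 : 0 <= L by rewrite mulr_ge0// addr_ge0// invr_ge0 ltW.
apply/eqO_exP; exists (Num.sqrt L + 1); first by rewrite ltr_wpDl// sqrtr_ge0.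
near=> n; have n1 : (1 < n)%N by near: n; exists 2%N.
have n0 : (0 < n)%N by exact: ltnW.
have n0' : 0 < n%:R :> R by rewrite ltr0n.
have [u hu uE] := hfhat w n0.
rewrite -uE /= (ger0_norm (L2norm_ge0 _)) (ger0_norm (sqrtr_ge0 _)).
apply: (@le_trans _ _ (Num.sqrt L * Num.sqrt (ln n%:R / n%:R))); last first.
  by rewrite ler_wpM2r ?sqrtr_ge0// lerDl.
rewrite -sqrtrM//; apply: L2norm_le_sqr; first exact: sqrtr_ge0.
have ln0 : 0 <= ln n%:R :> R by rewrite ln_ge0// ler1n.
rewrite sqr_sqrtr; last by rewrite mulr_ge0// divr_ge0.
apply: le_trans (H n (gamma n w) (B * ln n%:R) u (fun i => xi i w) _ _ _) _.
- by near: n; exists N.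
- by near: n.
- split => //; last by near: n.
  rewrite mulrA ler_pdivrMr// mulrA; apply: ltW; by near: n.
- rewrite mulrA ler_wpM2r ?invr_ge0 ?(ltW n0')// /L -[leRHS]mulrA ler_wpM2l// mulrDl lerD2r.
  by rewrite mulrC ler_pdivlMr// mul1r ler_ln ?posrE// ler_nat.
Unshelve. all: by end_near.
Qed.

End AlmostSure.

(** * Boundedness in probability *)

Section OuterBounds.
Context {d : measure_display} {T : measurableType d} {R : realType}.
Variable P : probability T R.

(** Outer probability at most [e], witnessed by a measurable cover: events about [fhat] need not be
    measurable, and covers are easy to unite. *)
Definition outer_le (D : set T) (e : R) : Prop :=
  exists E, [/\ measurable E, (P E <= e%:E)%E & D `<=` E].

Lemma outer_leS D D' e e' : D `<=` D' -> e' <= e -> outer_le D' e' -> outer_le D e.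
Proof.
move=> DD ee [E [mE PE D'E]]; exists E; split => //; last exact: subset_trans DD D'E.
by apply: le_trans PE _; rewrite lee_fin.
Qed.

Lemma outer_leU D D' e e' : outer_le D e -> outer_le D' e' -> outer_le (D `|` D') (e + e').
Proof.
move=> [E [mE PE DE]] [E' [mE' PE' DE']]; exists (E `|` E'); split.
- exact: measurableU.
- by apply: (le_trans (measureU2 P mE mE')); rewrite EFinD leeD.
- exact: setUSS.
Qed.

Lemma outer_le_bigcup (m : nat) (D : nat -> set T) e : (forall j, (j < m)%N -> outer_le (D j) e) ->
  outer_le [set w | exists2 j, (j < m)%N & D j w] (m%:R * e).
Proof.
elim: m => [_|m IH H].
  exists set0; split; [exact: measurable0|by rewrite measure0 mul0r|by move=> w []].
apply: (outer_leS _ _ (outer_leU (IH (fun j jm => H j (ltnW jm))) (H m (ltnSn m)))).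
  move=> w [j jm Dj]; have [jm'|jm'] := ltnP j m; first by left; exists j.
  by right; have -> : m = j by apply/eqP; rewrite eqn_leq jm' -ltnS jm.
by rewrite -natr1 mulrDl mul1r.
Qed.

Lemma outer_le_mu_ext D e : outer_le D e -> (mu_ext P D <= e%:E)%E.
Proof.
move=> [E [mE PE DE]]; apply: le_trans PE.
by rewrite -(measurable_mu_extE P mE); exact: le_mu_ext.
Qed.

(** The tail unions decrease to the upper limit of the events, a null set; by continuity from above
    their probabilities tend to 0. *)
Lemma ae_eventually_small (F : nat -> set T) (e : R) : (forall n, measurable (F n)) ->
  {ae P, forall w, \forall n \near \oo, ~ F n w} -> 0 < e ->
  \forall n \near \oo, outer_le (F n) e.
Proof.
move=> mF [A [mA A0 sA]] e0.
have mL : measurable (lim_sup_set F).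
  by apply: bigcap_measurableType => n _; apply: bigcup_measurable.
have L0 : P (lim_sup_set F) = 0%E.
  apply: (subset_measure0 mL mA _ A0) => w Lw; apply: sA => /= -[N _ HN].
  have [j /= Nj Fj] := Lw N I; exact: (HN j Nj).
have fin : (P (\bigcup_(n >= 0) F n) < +oo)%E.
  exact: (le_lt_trans (probability_le1 _ (bigcup_measurable _))) (ltry _).
have cv : P (\bigcup_(k >= n) F k) @[n --> \oo] --> 0%E.
  by rewrite -L0; exact: lim_sup_set_cvg.
have h : \forall n \near \oo, (P (\bigcup_(k >= n) F k) <= e%:E)%E.
  have /fine_cvgP[fn /(@cvgr_le R nat _ _ _ _) fc] := cv.
  have fc' := fc e e0.
  near=> n; rewrite -[P _]fineK; last by near: n.
  by rewrite lee_fin; near: n.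
apply: filterS h => n hn; exists (\bigcup_(k >= n) F k); split => //.
  exact: bigcup_measurable.
by move=> w Fw; exists n => //=.
Unshelve. all: by end_near.
Qed.

Lemma measurable_lt_set (g h : T -> R) : measurable_fun setT g -> measurable_fun setT h ->
  measurable [set w | g w < h w].
Proof.
move=> mg mh; rewrite -[X in measurable X]setTI.
exact: (measurable_fun_ltr mg mh measurableT (Y := [set true])).
Qed.

Lemma outer_le_tight (g : T -> R) (e : R) : measurable_fun setT g -> 0 < e ->
  exists A : R, outer_le [set w | A < g w] e.
Proof.
move=> mg e0.
have mF (n : nat) : measurable [set w | n%:R < g w] by exact: measurable_lt_set.
have cF : {ae P, forall w, \forall n \near \oo, ~ (n%:R < g w)}.
  apply: aeW => w; near=> n; apply/negP; rewrite -leNgt; near: n; exact: nbhs_infty_ger.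
have [N _ HN] := ae_eventually_small mF cF e0.
by exists N%:R; apply: HN; rewrite /=.
Unshelve. all: by end_near.
Qed.

(** Boundedness is required for every n >= 1. A common constant serves large n, and the finitely
    many other n contribute one constant each, added in absolute value. *)
Lemma bounded_in_probability_intro (X : nat -> T -> R) (r : nat -> R) : (forall n, 0 <= r n) ->
  (forall e : R, 0 < e -> exists C : R, \forall n \near \oo, outer_le [set w | C * r n < `|X n w|] e) ->
  (forall e : R, 0 < e -> forall n, (0 < n)%N -> exists C : R, outer_le [set w | C * r n < `|X n w|] e) ->
  bounded_in_probability P X r.
Proof.
move=> r0 large small e e0; have [C [N _ HN]] := large e e0.
have /choice[c Hc] : forall n, exists c : R, (0 < n)%N -> outer_le [set w | c * r n < `|X n w|] e.
  move=> [|n]; first by exists 0.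
  by have [c] := small e e0 n.+1 isT; exists c.
exists (`|C| + \sum_(i < N) `|c i|) => n n0; apply: outer_le_mu_ext.
have mono (C' : R) : C' <= `|C| + \sum_(i < N) `|c i| -> outer_le [set w | C' * r n < `|X n w|] e ->
    outer_le [set w | (`|C| + \sum_(i < N) `|c i|) * r n < `|X n w|] e.
  move=> CC; apply: outer_leS => // w /=; apply: le_lt_trans.
  exact: ler_wpM2r.
have [Nn|nN] := leqP N n.
  apply: mono (HN n Nn); apply: (le_trans (ler_norm C)).
  by rewrite lerDl sumr_ge0.
apply: mono (Hc n n0); apply: (le_trans (ler_norm _)).
rewrite (bigD1 (Ordinal nN))//= addrCA lerDl addr_ge0// sumr_ge0//.
Qed.

End OuterBounds.

(** The inequality 1 + y <= exp y gives an explicit threshold for [A]. *)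
Lemma exp_small (R : realType) (C kappa e : R) : 0 <= C -> 0 < kappa -> 0 < e ->
  exists2 A0, 0 <= A0 & forall A, A0 <= A -> C * expR (- (kappa * A)) <= e.
Proof.
move=> C0 k0 e0; exists (C / (kappa * e)); first by rewrite divr_ge0// mulr_ge0// ltW.
move=> A hA; rewrite expRN ler_pdivrMr ?expR_gt0// mulrC -ler_pdivrMr//.
apply: le_trans (expR_ge1Dx _).
have ke : 0 < kappa * e by rewrite mulr_gt0.
rewrite ler_pdivrMr// in hA.
by rewrite ler_pdivrMr//; lra.
Qed.

(** * Tightness of the controlled noise sums *)

Section Tightness.
Context {d : measure_display} {T : measurableType d} {R : realType}.
Variable P : probability T R.

(** Each j contributes one fixed interval and two one-sided families, enumerated by length so that
    [drift_tail] applies to both. The resulting bound does not involve n. *)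
Lemma not_controlled_small n (X : 'I_n -> {RV P >-> R}) (m : nat) (t : nat -> R) (beta eta A : R) :
  subdivision m t -> (0 < n)%N -> independent_family X -> 0 < beta -> 0 < eta ->
  (forall i nu, ('M_P (X i) nu <= (expR (beta * nu ^+ 2))%:E)%E) -> 0 <= A ->
  outer_le P [set w | ~ controlled m t n (ext (X^~ w)) eta A]
   (m%:R * (2 * expR (beta - A) +
      (2 * expR (- (eta * A / (2 * beta))) / (1 - expR (- (eta ^+ 2 / (4 * beta)))) +
       2 * expR (- (eta * A / (2 * beta))) / (1 - expR (- (eta ^+ 2 / (4 * beta))))))).
Proof.
move=> S n0 ind b0 eta0 mgf A0.
set G := 2 * _ / _.
pose q j := gridpos n (t j).
have qn j : (j <= m)%N -> (q j <= n)%N.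
  move=> jm; rewrite -[leqRHS](@gridpos1 R n); apply: gridpos_le => //.
  have mono := subdivision_mono S.
  by case: (S) => <- <- _; rewrite !mono ?leq0n// jm leqnn.
pose right j l := (q j, (q j + l)%N).
pose left j l := ((q j - l)%N, q j).
pose lev (e : nat * nat) : R := eta * (e.2 - e.1)%:R + A.
pose E1 j := deviates X (q j) (q j.+1) (A * Num.sqrt (q j.+1 - q j)%:R).
pose E2 j := deviates_some X [seq right j l | l <- iota 0 (n - q j).+1] lev.
pose E3 j := deviates_some X [seq left j l | l <- iota 0 (q j).+1] lev.
apply: (outer_leS _ (lexx _) (outer_le_bigcup (D := fun j => E1 j `|` (E2 j `|` E3 j)) _)); last first.
  move=> j jm; apply: outer_leU; last apply: outer_leU.
  - exists (E1 j); split => //; first exact: measurable_deviates.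
    have [l0|l0] := leqP (q j.+1) (q j).
      rewrite (_ : E1 j = set0) ?measure0 ?lee_fin ?mulr_ge0 ?expR_ge0//.
      apply/seteqP; split => // w; rewrite /E1 /deviates /= isum_geq// normr0.
      have /eqP -> : (q j.+1 - q j == 0)%N by rewrite subn_eq0.
      by rewrite sqrtr0 mulr0 ltxx.
    have l0' : 0 < (q j.+1 - q j)%:R :> R by rewrite ltr0n subn_gt0.
    have s0 : 0 < Num.sqrt (q j.+1 - q j)%:R :> R by rewrite sqrtr_gt0.
    (* With nu the inverse square root of the length, the exponent at level A sqrt(length) is beta -
       A, whatever the length. *)
    have nu0 : 0 < (Num.sqrt (q j.+1 - q j)%:R)^-1 :> R by rewrite invr_gt0.
    have tail := deviates_tail (A * Num.sqrt (q j.+1 - q j)%:R) (q j) (qn _ jm) ind nu0 mgf.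
    apply: (le_trans tail).
    rewrite lee_fin ler_wpM2l// ler_expR exprVn sqr_sqrtr ?(ltW l0')// mulrCA mulfV ?gt_eqF// mulr1.
    by rewrite mulrCA mulVf ?gt_eqF// mulr1.
  - exists (E2 j); split => //; first by have [] := deviates_someP X [seq right j l | l <- iota 0 (n - q j).+1] lev.
    apply: drift_tail => // l; rewrite ltnS /right /= addKn => ln; split => //.
    by rewrite -(subnKC (qn j (ltnW jm))) leq_add2l.
  - exists (E3 j); split => //; first by have [] := deviates_someP X [seq left j l | l <- iota 0 (q j).+1] lev.
    apply: drift_tail => // l; rewrite ltnS /left /= => ln; split; first exact: qn (ltnW jm).
    by rewrite subKn.
move=> w /= nc; apply: contrapT => H; apply: nc.
have nE j : (j < m)%N -> ~ (E1 j `|` (E2 j `|` E3 j)) w by move=> jm Ej; apply: H; exists j.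
split.
- move=> j jm; have := nE j jm; rewrite -/(q j) -/(q j.+1) => h.
  have h1 : ~ E1 j w by move=> E; apply: h; left.
  move/negP: h1; rewrite /E1 /deviates /= -leNgt => h1.
  have := sqr_homo (normr_ge0 _) h1.
  by rewrite real_normK ?num_real// exprMn sqr_sqrtr.
- move=> j e /andP[j0 jm] /andP[qe en]; have h := nE j jm; rewrite -/(q j) in qe *.
  have h1 : ~ E2 j w by move=> E; apply: h; right; left.
  rewrite leNgt; apply/negP => h2; apply: h1; exists (q j, e) => //.
  apply/mapP; exists (e - q j)%N; last by rewrite /right subnKC// ltnW.
  by rewrite mem_iota add0n ltnS leq_sub2r.
- move=> j e /andP[j0 jm] qe; have h := nE j jm; rewrite -/(q j) in qe *.
  have h1 : ~ E3 j w by move=> E; apply: h; right; right.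
  rewrite leNgt; apply/negP => h2; apply: h1; exists (e, q j) => //.
  apply/mapP; exists (q j - e)%N; last by rewrite /left subKn// ltnW.
  by rewrite mem_iota add0n ltnS leq_subr.
Qed.

Lemma controlled_tight (m : nat) (t : nat -> R) (beta eta e : R) :
  subdivision m t -> 0 < beta -> 0 < eta -> 0 < e -> exists2 A, 0 <= A &
  forall n (X : 'I_n -> {RV P >-> R}), (0 < n)%N -> independent_family X ->
  (forall i nu, ('M_P (X i) nu <= (expR (beta * nu ^+ 2))%:E)%E) ->
  outer_le P [set w | ~ controlled m t n (ext (X^~ w)) eta A] e.
Proof.
move=> S b0 eta0 e0; have m0 : 0 < m%:R :> R by rewrite ltr0n (subdivision_gt0 S).
set D := 1 - expR (- (eta ^+ 2 / (4 * beta))).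
have D0 : 0 < D.
  by rewrite subr_gt0 expR_lt1 oppr_lt0 divr_gt0 ?exprn_gt0// mulr_gt0.
have e1 : 0 < e / m%:R / 4 by rewrite !divr_gt0.
have [A1 A10 H1] := exp_small (mulr_ge0 (ler0n R 2) (expR_ge0 beta)) ltr01 e1.
have D2 : 0 <= 2 / D :> R by rewrite divr_ge0// ltW.
have k0 : 0 < eta / (2 * beta) by rewrite divr_gt0// mulr_gt0.
have [A2 A20 H2] := exp_small D2 k0 e1.
exists (Num.max A1 A2); first by rewrite le_max A10.
move=> n X n0 ind mgf; set A := Num.max A1 A2.
have A0 : 0 <= A by rewrite le_max A10.
apply: (outer_leS _ _ (not_controlled_small S n0 ind b0 eta0 mgf A0)) => //.
have h1 : 2 * expR (beta - A) <= e / m%:R / 4.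
  by have := H1 A; rewrite mul1r expRD mulrA le_max lexx; exact.
have h2 := H2 A ltac:(by rewrite le_max lexx orbT).
rewrite -/D.
have -> : 2 * expR (- (eta * A / (2 * beta))) / D = 2 / D * expR (- (eta / (2 * beta) * A)).
  by rewrite [eta / _ * A]mulrAC [LHS]mulrAC.
rewrite -ler_pdivlMl// [leRHS]mulrC; set x := e / m%:R in e1 h1 h2 *.
move: (2 / D * _) h2 => y h2; move: (expR _) h1 => z h1; lra.
Qed.

End Tightness.

(** Comparison with the zero vector. It serves finitely many n, where gamma may be of any sign or
    size, whence [|gamma| n]; the inequality a <= 1 + a^2 removes square roots and leaves an
    expression in the data and gamma, which is measurable even if the minimizer is not. *)
Lemma argmin_crude (R : realType) (f : R -> R) n (gamma : R) (u y : 'rV[R]_n) : in_L2 f -> (0 < n)%N ->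
  potts_argmin gamma y u ->
  L2norm (embed u \- f) <=
    2 + 2 * (n%:R^-1 * \sum_(i < n) y ord0 i ^+ 2) + `|gamma| * n%:R + L2norm f.
Proof.
move=> hf n0 /(_ 0); rewrite /potts [num_jumps 0]num_jumpsE njump_vec0 mulr0 addr0.
under [X in _ <= _ * X]eq_bigr do rewrite mxE sub0r sqrrN.
pose Z := 0 : 'rV[R]_n.
set S := _^-1 * \sum_(i < n) y ord0 i ^+ 2 => h.
have jn : (num_jumps u)%:R <= n%:R :> R by rewrite ler_nat -[leqRHS]card_ord max_card.
have gJ : - (`|gamma| * n%:R) <= gamma * (num_jumps u)%:R.
  apply: (@le_trans _ _ (- (`|gamma| * (num_jumps u)%:R))); first by rewrite lerN2 ler_wpM2l.
  by rewrite -mulNr ler_wpM2r// lerNl ler_normr lexx orbT.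
have uy : L2norm (embed u \- embed y) ^+ 2 <= S + `|gamma| * n%:R by rewrite L2norm_embed//; lra.
have y0 : L2norm (embed y \- embed Z) ^+ 2 <= S.
  by rewrite L2norm_embed// /S; under eq_bigr do rewrite mxE subr0.
have f0 : L2norm (embed Z \- f) = L2norm f.
  by rewrite L2norm_distC /Z (embed0 R n); congr L2norm; apply/funext => x /=; rewrite subr0.
have t1 := L2norm_tri (in_L2_embed u) (in_L2_embed y) hf.
have t2 := L2norm_tri (in_L2_embed y) (in_L2_embed Z) hf.
have sq (a : R) : a <= 1 + a ^+ 2 by have := sqr_ge0 (a - 1); nra.
have := sq (L2norm (embed u \- embed y)); have := sq (L2norm (embed y \- embed Z)).
lra.
Qed.

(** * The rate in probability *)

Section InProbability.
Context {d : measure_display} {T : measurableType d} {R : realType}.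
Variables (P : probability T R) (xi : forall n : nat, 'I_n -> {RV P >-> R}).
Variables (f : R -> R) (gamma : nat -> {RV P >-> R}) (fhat : nat -> T -> R -> R).
Hypotheses (hxi : condition_A xi) (hf : in_L2 f).
Hypothesis hfhat : forall n w, (0 < n)%N ->
      (@embed R n @` potts_argmin (gamma n w) (observation f xi n w)) (fhat n w).

Lemma fit_tight n (e : R) : (0 < n)%N -> 0 < e ->
  exists A : R, outer_le P [set w | A < `|L2norm (fhat n w \- f)| ] e.
Proof.
move=> n0 e0.
pose g w := 2 + 2 * (n%:R^-1 * \sum_(i < n) observation f xi n w ord0 i ^+ 2) +
  `|gamma n w| * n%:R + L2norm f.
have mg : measurable_fun setT g.
  apply: measurable_funD => //; apply: measurable_funD; last first.
    by apply: measurable_funM => //; exact: measurableT_comp.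
  apply: measurable_funD => //; apply: measurable_funM => //; apply: measurable_funM => //.
  apply: measurable_sum => i; apply: measurable_funX.
  under eq_fun do rewrite mxE.
  exact: measurable_funD.
have [A HA] := outer_le_tight P mg e0.
exists A; apply: (outer_leS _ (lexx _) HA) => w /=; move/lt_le_trans; apply.
rewrite ger0_norm ?L2norm_ge0//.
by have [u hu <-] := hfhat w n0; exact: argmin_crude.
Qed.

Hypotheses (g0 : {ae P, forall w, gamma n w @[n --> \oo] --> 0})
  (gln : {ae P, forall w, gamma n w * n%:R / ln n%:R @[n --> \oo] --> +oo}).

(** Four exceptional events of probability at most e/4 each are discarded: gamma too large, gamma n
    too small, bad noise over some interval, and uncontrolled noise at the break points of f. Off
    these events [step_rate_strong] applies. *)
Lemma rate_large_n (e : R) : in_step_space f -> 0 < e ->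
  exists C : R, \forall n \near \oo,
    outer_le P [set w | C * Num.sqrt (n%:R^-1) < `|L2norm (fhat n w \- f)| ] e.
Proof.
move=> /in_step_space_wstep[m [t [alpha [S tlt ane sf]]]] e0.
have [beta b0 mgf] := noise_subgaussian_pos hxi.
have [N [c [eta [K1 [c0 eta0 K10 H]]]]] := step_rate_strong hf S tlt ane sf.
have e4 : 0 < e / 4 by rewrite divr_gt0.
have [A A0 ctrl] := controlled_tight P S b0 eta0 e4.
have [K HK] := H A A0.
set B := (beta + 4) ^+ 2.
have B0 : 0 <= B by exact: sqr_ge0.
have l2 : 0 < ln 2 :> R by rewrite ln_gt0// ltr1n.
(* One lower bound L ln n on gamma n yields both demands on gamma, 4 M <= gamma n and K1 (1 + M) <
   gamma n; the final 1 makes the second one strict. *)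
pose L := 4 * B + K1 * ((ln 2)^-1 + B) + 1.
pose F1 n := [set w | c < gamma n w].
pose F2 n := [set w | gamma n w * n%:R < L * ln n%:R].
have mF1 n : measurable (F1 n) by exact: measurable_lt_set.
have mF2 n : measurable (F2 n).
  by apply: measurable_lt_set => //; apply: measurable_funM.
have aeF1 : {ae P, forall w, \forall n \near \oo, ~ F1 n w}.
  move: g0; apply: filterS => w gw.
  have gc : \forall n \near \oo, gamma n w <= c by exact: (cvgr_le _ gw).
  by apply: filterS gc => n h /=; apply/negP; rewrite -leNgt.
have aeF2 : {ae P, forall w, \forall n \near \oo, ~ F2 n w}.
  move: gln; apply: filterS => w dw.
  by apply: filterS (dominates_ln L dw) => n h /=; apply/negP; rewrite -leNgt ltW.
have small1 := ae_eventually_small mF1 aeF1 e4.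
have small2 := ae_eventually_small mF2 aeF2 e4.
have [N2 HN2] := sqrtn_eventually 2 e4.
exists (Num.sqrt `|K|); near=> n.
have n1 : (1 < n)%N by near: n; exists 2%N.
have nN2 : (N2 <= n)%N by near: n; exists N2.
have n0 : (0 < n)%N by exact: ltnW.
have n0' : 0 < n%:R :> R by rewrite ltr0n.
have s3 : outer_le P (noise_bad (@xi n) (B * ln n%:R)) (e / 4).
  exists (noise_bad (@xi n) (B * ln n%:R)); split => //.
    by have [] := deviates_someP (@xi n) (segs n) (fun e => Num.sqrt ((e.2 - e.1)%:R * (B * ln n%:R))).
  have tail := noise_bad_le n1 (noise_independent hxi (n := n)) b0 (mgf n).
  apply: (le_trans tail).
  have [_ h] := HN2 n nN2; rewrite lee_fin.
  apply: le_trans h; rewrite ler_wpM2l// lef_pV2 ?posrE ?exprn_gt0//.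
  by rewrite expr2 ler_peMr ?ler1n// ltW.
have s4 := ctrl n (@xi n) n0 (noise_independent hxi (n := n)) (mgf n).
have s1 : outer_le P (F1 n) (e / 4) by near: n.
have s2 : outer_le P (F2 n) (e / 4) by near: n.
apply: (outer_leS _ _ (outer_leU (outer_leU s1 s2) (outer_leU s3 s4))); last by lra.
move=> w /= bad; apply: contrapT => /not_orP[/not_orP[n1w n2w] /not_orP[n3w /contrapT n4w]].
move: bad; apply/negP; rewrite -leNgt ger0_norm ?L2norm_ge0//.
have ln0 : 0 < ln n%:R :> R by rewrite ln_gt0// ltr1n.
have ln2n : ln 2 <= ln n%:R :> R by rewrite ler_ln ?posrE// ler_nat.
have gc : gamma n w <= c by rewrite leNgt; apply/negP.
have gL : L * ln n%:R <= gamma n w * n%:R by rewrite leNgt; apply/negP.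
have xM : noise_le (ext ((@xi n)^~ w)) n (B * ln n%:R).
  by apply: noise_badE n3w; rewrite mulr_ge0// ltW.
have [u hu <-] := hfhat w n0.
have one : 1 <= (ln 2)^-1 * ln n%:R :> R by rewrite mulrC ler_pdivlMr// mul1r.
have K1L : K1 * (1 + B * ln n%:R) <= K1 * ((ln 2)^-1 + B) * ln n%:R.
  by rewrite -mulrA ler_wpM2l// mulrDl lerD2r.
have BL : 0 <= B * ln n%:R by rewrite mulr_ge0// ltW.
have L1 : 0 <= K1 * ((ln 2)^-1 + B) * ln n%:R.
  by rewrite !mulr_ge0// ?addr_ge0// ?invr_ge0 ltW.
have LE : L * ln n%:R = 4 * (B * ln n%:R) + K1 * ((ln 2)^-1 + B) * ln n%:R + ln n%:R.
  by rewrite /L; ring.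
rewrite LE in gL.
rewrite -sqrtrM//; apply: L2norm_le_sqr; first exact: sqrtr_ge0.
rewrite sqr_sqrtr; last by rewrite mulr_ge0// invr_ge0 ltW.
apply: (@le_trans _ _ (K / n%:R)); last by rewrite ler_wpM2r ?invr_ge0 ?ler_norm// ltW.
apply: (HK n (gamma n w) (B * ln n%:R) u (fun i => xi i w)) => //.
- by near: n; exists N.
- by rewrite ltr_pdivrMr//; lra.
- by split => //; rewrite [leLHS]mulrA ler_pdivrMr//; lra.
Unshelve. all: by end_near.
Qed.

Lemma rate_in_probability : in_step_space f ->
  bounded_in_probability P (fun n w => L2norm (fhat n w \- f)) (fun n => Num.sqrt (n%:R^-1)).
Proof.
move=> fS; apply: bounded_in_probability_intro.
- by move=> n; exact: sqrtr_ge0.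
- by move=> e e0; exact: rate_large_n.
- move=> e e0 n n0; have [A HA] := fit_tight n0 e0.
  have s0 : 0 < Num.sqrt n%:R^-1 :> R by rewrite sqrtr_gt0 invr_gt0 ltr0n.
  by exists (A / Num.sqrt n%:R^-1); rewrite mulfVK// gt_eqF.
Qed.

End InProbability.

Theorem theorem1 (R : realType) (d : measure_display) (T : measurableType d)
    (P : probability T R) (xi : forall n : nat, 'I_n -> {RV P >-> R})
    (f : R -> R) (gamma : nat -> {RV P >-> R}) (fhat : nat -> T -> R -> R)
    (hxi : condition_A xi) (hf : in_L2 f)
    (hfhat : forall n w, (0 < n)%N ->
      (@embed R n @` potts_argmin (gamma n w) (observation f xi n w))
        (fhat n w)) :
  [/\ (forall (gamma0 : R) (fgamma : R -> R), 0 < gamma0 ->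
        unique_minimizer_cont gamma0 f fgamma ->
        {ae P, forall w, gamma n w @[n --> \oo] --> gamma0} ->
        {ae P, forall w, L2norm (fhat n w \- fgamma) @[n --> \oo] --> 0}),
      ({ae P, forall w, gamma n w @[n --> \oo] --> 0} ->
       {ae P, forall w, gamma n w * n%:R / ln n%:R @[n --> \oo] --> +oo} ->
       {ae P, forall w, L2norm (fhat n w \- f) @[n --> \oo] --> 0}) &
      (in_step_space f ->
       {ae P, forall w, gamma n w @[n --> \oo] --> 0} ->
       {ae P, forall w, gamma n w * n%:R / ln n%:R @[n --> \oo] --> +oo} ->
       {ae P, forall w, (fun n : nat => L2norm (fhat n w \- f) : R)
          =O_\oo (fun n : nat => Num.sqrt (ln n%:R / n%:R) : R)} /\
       bounded_in_probability P (fun n w => L2norm (fhat n w \- f))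
          (fun n => Num.sqrt (n%:R^-1)))].
Proof.
split.
- by move=> gamma0 fgamma; exact: (strong_consistency_fixed hxi hf hfhat).
- exact: (strong_consistency hxi hf hfhat).
- move=> fS g0 gln; split; first exact: (strong_rate hxi hf hfhat g0 gln fS).
  exact: (rate_in_probability hxi hf hfhat g0 gln fS).
Qed.
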